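(* Let $\widetilde W$ be the complexification of a finite real reflection group acting on a real vector space $\widetilde V'$, with $\widetilde V=\widetilde V'\otimes_{\mathbf{R}}\mathbf{C}$, let $G$ be a good normal subgroup of $\widetilde W$, $W=\widetilde W/G$, and $q:\widetilde W\to W$ the quotient map. Let $\widetilde B$ and $B$ be the braid groups of $\widetilde W$ and $W$ and $p_*:\widetilde B\to B$ the canonical map. Then $p_*$ is surjective. It sends $\sigma_{\tilde s}$ to $\sigma_{q(\tilde s)}$ if $\tilde s\notin G$ and to $1$ otherwise, for every $\tilde s\in\widetilde S$, where $\sigma_{\tilde s}$ ($\tilde s\in\widetilde S$) and $\sigma_s$ ($s\in S$) are the standard generators of $\widetilde B$ and $B$.
   Context: Goodness. Work over a field $k$ of characteristic $0$ (here $k=\mathbf{C}$, or $\mathbf{R}$ for the real forms). A reflection is an automorphism of finite order whose fixed space is a hyperplane; a finite linear group is a reflection group if generated by reflections. Let $\mathcal{O}=k[\widetilde V]$ be the symmetric algebra of $\widetilde V^*$, $\widetilde V/G=\operatorname{Spec}\mathcal{O}^G$, and $V=(\mathcal{O}^G_+/(\mathcal{O}^G_+)^2)^*$ the tangent space at $0$. A graded splitting $V^*\to\mathcal{O}^G_+$ equivariant under the normalizer of $G$ induces a surjection $A=k[V]\to\mathcal{O}^G$ with kernel $I$, hence a closed immersion $\widetilde V/G\hookrightarrow V$ and a map $p:\widetilde V\to V$. $G$ is good in $\widetilde W$ if $I$ is minimally generated by $\dim V-\dim\widetilde V$ elements and $W$ acts trivially on $I/A_+I$; then $W$ is a reflection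 group on $V$. In the real situation all this data is taken compatibly over $\mathbf{R}$: $V=V'\otimes_{\mathbf{R}}\mathbf{C}$ with $V'$ the tangent space at $0$ of $\widetilde V'/G$, and $p$ maps $\widetilde V'$ to $V'$. Braid groups. $\mathcal{A}(\cdot)$ denotes the set of reflecting hyperplanes. Put $\widetilde{\mathcal{M}}=\widetilde V-\bigcup_{\widetilde H\in\mathcal{A}(\widetilde W)}\widetilde H$ and $\mathcal{M}=V-\bigcup_{H\in\mathcal{A}(W)}H$ (classical topology). Since $p(\widetilde{\mathcal{M}})\subset\mathcal{M}$, for $x_0\in\widetilde{\mathcal{M}}$ there is an induced homomorphism $p_*:\widetilde B=\pi_1(\widetilde{\mathcal{M}}/\widetilde W,x_0)\to B=\pi_1(\mathcal{M}/W,p(x_0))$. Generators. Fix a chamber $\widetilde C$ of $\widetilde W$ in $\widetilde V'$ (a connected component of the complement of the reflecting hyperplanes), let $x_0\in\widetilde C$, and let $\widetilde S$ be the set of reflections in the walls of $\widetilde C$. Let $C$ be the chamber of $W$ in $V'$ containing $p(\widetilde C)$. Let $S$ be the set of non-trivial elements of $q(\widetilde S)$; $(W,S)$ is a Coxeter system and $S$ is the set of reflections in the walls of $C$. For $\tilde s\in\widetilde S$ with hyperplane $\widetilde H$, choose a path $\gamma$ in $\widetilde V'$ with $\gamma(0)=x_0$, $\gamma(t)\in\widetilde C$ for $t<1$ and $\widetilde W_{\gamma(1)}=\langle\tilde s\rangle$. Then $\sigma_{\tilde s}\in\widetilde B$ is the class of the path from $x_0$ to $\tilde s(x_0)$ in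 $\widetilde{\mathcal{M}}$ which follows $\gamma$ up to a point $\gamma(t)$ near $\gamma(1)$, written $\gamma(t)=h+l$ with $h\in\widetilde H$ and $l\in\ker(\tilde s+1)$, then the half-turn $\theta\mapsto h+e^{i\pi\theta}l$ ($0\le\theta\le1$), then the image under $\tilde s$ of the reversed path back. The elements $\sigma_s\in B$, $s\in S$, are defined in the same way from $C$ and the base point $p(x_0)$. *)

(* Defs.v *)
From HB Require Import structures.
From mathcomp Require Import all_boot all_order all_algebra all_fingroup.
From mathcomp Require Import mxrepresentation generic_quotient complex.
From mathcomp Require mpoly.

Set Implicit Arguments.
Unset Strict Implicit.
Unset Printing Implicit Defensive.

Import Order.TTheory GRing.Theory Num.Theory.
Local Open Scope ring_scope.

(* Linear groups act on row vectors from the right, x |-> x *m rho g, and hence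
   on polynomial functions by f |-> (x |-> f (x *m rho g)). *)

(* The notations of mpoly clash with those of the analysis library: they are
   imported in this module only. *)
Module InvariantTheory.
Import mpoly.

Section Substitution.
Variable k : fieldType.

(* The polynomial function x |-> f (x *m A). *)
Definition msubst n p (A : 'M[k]_(n, p)) (f : {mpoly k[p]}) : {mpoly k[n]} :=
  f \mPo [tuple \sum_(i < n) A i j *: 'X_i | j < p].

Definition mpoly_fun n m (f : m.-tuple {mpoly k[n]}) (x : 'rV[k]_n) : 'rV[k]_m :=
  \row_i (tnth f i).@[fun j => x 0 j].

Lemma meval_msubst n p (A : 'M[k]_(n, p)) f (x : 'rV[k]_n) :
  (msubst A f).@[fun j => x 0 j] = f.@[fun j => (x *m A) 0 j].
Proof.
rewrite /msubst comp_mpoly_meval; apply: meval_eq => j.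
rewrite tnth_mktuple mxE raddf_sum; apply: eq_bigr => i _ /=.
by rewrite mevalZ mevalXU mulrC.
Qed.

End Substitution.

Section Invariants.
Variables (k : fieldType) (gT : finGroupType) (G : {group gT}) (n : nat).
Variable rho : gT -> 'M[k]_n.

Definition is_invariant (f : {mpoly k[n]}) :=
  forall g, g \in G -> msubst (rho g) f = f.

Definition inv_plus (f : {mpoly k[n]}) := is_invariant f /\ f@_0%MM = 0.

Definition inv_plus_sqr (f : {mpoly k[n]}) :=
  exists s : seq ({mpoly k[n]} * {mpoly k[n]}),
    (forall ab, ab \in s -> inv_plus ab.1 /\ inv_plus ab.2) /\
    f = \sum_(ab <- s) ab.1 * ab.2.

Definition normalizes (A : 'M[k]_n) :=
  A \in unitmx /\
  forall g, g \in G -> exists2 h, h \in G & invmx A *m rho g *m A = rho h.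

(* A graded splitting of inv_plus -> inv_plus / inv_plus_sqr = V^* is given by
   the images f_1, ..., f_m of a homogeneous basis of V^*; this basis identifies
   V with k^m.  The splitting commutes with A exactly when the span of the f_i
   is stable under A. *)
Record graded_splitting m (f : m.-tuple {mpoly k[n]}) : Prop := {
  splitting_inv_plus : forall i, inv_plus (tnth f i);
  splitting_graded : forall i, exists d, tnth f i \is d.-homog;
  splitting_span : forall h, inv_plus h ->
    exists c : 'I_m -> k, inv_plus_sqr (h - \sum_i c i *: tnth f i);
  splitting_free : forall c : 'I_m -> k,
    inv_plus_sqr (\sum_i c i *: tnth f i) -> forall i, c i = 0;
  splitting_normalizer : forall A, normalizes A ->
    exists M : 'M[k]_m, forall i,
      msubst A (tnth f i) = \sum_j M j i *: tnth f j
}.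

End Invariants.

Section Good.
Variables (k : fieldType) (m : nat).
Implicit Types (I : {mpoly k[m]} -> Prop) (a : {mpoly k[m]}).

Definition relation_ideal n (f : m.-tuple {mpoly k[n]}) a := a \mPo f = 0.

Definition generates I d (r : d.-tuple {mpoly k[m]}) :=
  forall a, I a <-> exists c : 'I_d -> {mpoly k[m]}, a = \sum_i c i * tnth r i.

Definition minimally_generated I d :=
  (exists r : d.-tuple {mpoly k[m]}, generates I r) /\
  (forall e (r : e.-tuple {mpoly k[m]}), generates I r -> (d <= e)%N).

(* The ideal A_+ I, where A_+ consists of the a with a@_0 = 0. *)
Definition plus_mul I a :=
  exists s : seq ({mpoly k[m]} * {mpoly k[m]}),
    (forall bc, bc \in s -> bc.1@_0%MM = 0 /\ I bc.2) /\
    a = \sum_(bc <- s) bc.1 * bc.2.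

(* rho is the representation on V of the quotient W of the reflection group. *)
Definition good n (f : m.-tuple {mpoly k[n]}) (gT : finGroupType)
    (W : {group gT}) (rho : gT -> 'M[k]_m) :=
  (exists2 d, m = (n + d)%N & minimally_generated (relation_ideal f) d) /\
  (forall w a, w \in W -> relation_ideal f a ->
     plus_mul (relation_ideal f) (msubst (rho w) a - a)).

End Good.

Section QuotientAction.
Variables (k : fieldType) (gT : finGroupType) (W G : {group gT}) (n m : nat).
Variables (rho : gT -> 'M[k]_n) (rhoq : coset_of G -> 'M[k]_m).

(* rhoq is the action of W / G on V = k^m defined by f, i.e., the one for which
   mpoly_fun f (x *m rho w) = mpoly_fun f x *m rhoq (coset G w). *)
Definition induced_action (f : m.-tuple {mpoly k[n]}) :=
  forall w i, w \in W ->
    msubst (rho w) (tnth f i) = \sum_j rhoq (coset G w) j i *: tnth f j.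

Lemma induced_actionE f w x : induced_action f -> w \in W ->
  mpoly_fun f (x *m rho w) = mpoly_fun f x *m rhoq (coset G w).
Proof.
move=> act Ww; apply/rowP => i; rewrite !mxE -meval_msubst act// raddf_sum.
by apply: eq_bigr => j _ /=; rewrite mevalZ mxE mulrC.
Qed.

End QuotientAction.

Section Base.
Variables (k K : fieldType) (phi : {rmorphism k -> K}).

Definition map_mpolys n m (f : m.-tuple {mpoly k[n]}) : m.-tuple {mpoly K[n]} :=
  [tuple map_mpoly phi (tnth f i) | i < m].

Lemma map_msubst n p (A : 'M[k]_(n, p)) f :
  map_mpoly phi (msubst A f) = msubst (map_mx phi A) (map_mpoly phi f).
Proof.
rewrite /msubst [in LHS]comp_mpolyEX [in RHS](mpolyE f).
rewrite raddf_sum (raddf_sum (map_mpoly phi)) /= [RHS]raddf_sum.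
apply: eq_bigr => mm _ /=.
rewrite !map_mpolyZ map_mpolyX comp_mpolyZ !comp_mpolyX rmorph_prod.
congr (_ *: _); apply: eq_bigr => i _ /=.
rewrite rmorphXn /= !tnth_mktuple raddf_sum; congr (_ ^+ _).
by apply: eq_bigr => j _ /=; rewrite map_mpolyZ map_mpolyX mxE.
Qed.

Lemma map_induced_action (gT : finGroupType) (W G : {group gT}) n m
    (rho : gT -> 'M[k]_n) (rhoq : coset_of G -> 'M[k]_m) f :
  induced_action W rho rhoq f ->
  induced_action W (fun g => map_mx phi (rho g))
    (fun c => map_mx phi (rhoq c)) (map_mpolys f).
Proof.
move=> act w i Ww; rewrite tnth_mktuple -map_msubst act// raddf_sum.
by apply: eq_bigr => j _ /=; rewrite map_mpolyZ tnth_mktuple mxE.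
Qed.

End Base.

End InvariantTheory.
Export InvariantTheory.
From mathcomp Require Import all_classical all_reals all_analysis.
From mathcomp Require Import lra.
Import numFieldNormedType.Exports.

Local Open Scope classical_set_scope.
Local Open Scope quotient_scope.

Local Ltac arith :=
  repeat match goal with H : @eq (Topological.sort ?T) _ _ |- _ => is_var T; clear H end;
  tryif lazymatch goal with |- @eq (Topological.sort ?T) _ _ => is_var T end
  then (exfalso; lra) else lra.

Section WithinContinuity.
Context {U X Y : topologicalType}.

Lemma within_ext (A : set U) (f g : U -> X) : (forall u, A u -> f u = g u) ->
  {within A, continuous f} -> {within A, continuous g}.
Proof.
move=> fg; apply: subspace_eq_continuous => u.
by rewrite inE => Au; exact: fg.
Qed.

Lemma within_comp (A : set U) (B : set X) (f : U -> X) (g : X -> Y) :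
  {within A, continuous f} -> (forall u, A u -> B (f u)) ->
  {within B, continuous g} -> {within A, continuous (g \o f)}.
Proof.
move=> /subspace_continuousP cf fAB /subspace_continuousP cg.
apply/subspace_continuousP => u Au V nV.
have := cg (f u) (fAB u Au) V nV; rewrite /= /nbhs /= /within /= => nW.
have := cf u Au _ nW; rewrite /nbhs /= /within /=.
by apply: filterS => v vP Av; apply: vP => //; apply: fAB.
Qed.

Lemma within_paste (A B C : set U) (b : pred U) (f g : U -> X) :
  closed A -> closed B -> C `<=` A `|` B ->
  (forall u, A u -> ~~ b u -> f u = g u) -> (forall u, B u -> b u -> f u = g u) ->
  {within A, continuous f} -> {within B, continuous g} ->
  {within C, continuous (fun u => if b u then f u else g u)}.
Proof.
move=> cA cB CAB fgA fgB cf cg; apply: (continuous_subspaceW CAB).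
apply: withinU_continuous => //.
- by apply: within_ext cf => u Au; case: ifPn => // /(fgA u Au).
- by apply: within_ext cg => u Bu; case: ifPn => // /(fgB u Bu).
Qed.

End WithinContinuity.

Section Homotopy.
Context {R : realType} {X : topologicalType}.
Implicit Types (f g h : R -> X) (x y z : X).

Definition is_path x y f :=
  [/\ {within `[0, 1], continuous f}, f 0 = x & f 1 = y].

(* Homotopies are relative to the end points. *)
Definition is_homotopy x y f g (H : R * R -> X) :=
  [/\ {within `[0, 1] `*` `[0, 1], continuous H},
      (forall t, 0 <= t <= 1 -> H (0, t) = f t),
      (forall t, 0 <= t <= 1 -> H (1, t) = g t),
      (forall s, 0 <= s <= 1 -> H (s, 0) = x) &
      (forall s, 0 <= s <= 1 -> H (s, 1) = y)].

Definition homotopic x y f g := exists H, is_homotopy x y f g H.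

Definition path_cat f g : R -> X :=
  fun t => if t <= 2^-1 then f (2 * t) else g (2 * t - 1).

Definition path_rev f : R -> X := fun t => f (1 - t).

Let I01P (t : R) : (`[0, 1]%classic : set R) t = (0 <= t <= 1).
Proof. by rewrite /= in_itv. Qed.

Lemma is_path_cst x : is_path x x (cst x).
Proof. by split=> //; apply: continuous_subspaceT => t; exact: cvg_cst. Qed.

Lemma is_path_comp x y f (phi : R -> R) : is_path x y f -> continuous phi ->
  (forall t, 0 <= t <= 1 -> 0 <= phi t <= 1) ->
  {within `[0, 1], continuous (f \o phi)}.
Proof.
move=> [cf _ _] cphi phiI; apply: within_comp cf.
  exact: continuous_subspaceT.
by move=> t; rewrite !I01P; exact: phiI.
Qed.

Lemma is_path_rev x y f : is_path x y f -> is_path y x (path_rev f).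
Proof.
move=> pf; split; last 2 first.
- by rewrite /path_rev subr0; case: pf.
- by rewrite /path_rev subrr; case: pf.
apply: (is_path_comp pf) => [t|t t01]; last by arith.
by apply: cvgB; [exact: cvg_cst|exact: cvg_id].
Qed.

Lemma is_path_cat x y z f g :
  is_path x y f -> is_path y z g -> is_path x z (path_cat f g).
Proof.
move=> [cf f0 f1] [cg g0 g1]; split; last 2 first.
- by rewrite /path_cat ifT ?mulr0// invr_ge0.
- rewrite /path_cat ifF; last by apply/negbTE; arith.
  by rewrite (_ : 2 * 1 - 1 = 1 :> R)//; arith.
have cM : continuous (fun t : R => 2 * t).
  by move=> t; apply: cvgM; [exact: cvg_cst|exact: cvg_id].
refine (@within_paste R X `[0, 2^-1]%classic `[2^-1, 1]%classic _
  (fun t => t <= 2^-1) (fun t => f (2 * t)) (fun t => g (2 * t - 1))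
  _ _ _ _ _ _ _).
- exact: interval_closed.
- exact: interval_closed.
- move=> t; rewrite I01P /= !in_itv /= => t01.
  by case: (lerP t 2^-1) => ?; [left|right]; arith.
- by move=> t; rewrite /= in_itv /= => t01 tN; exfalso; arith.
- move=> t; rewrite /= in_itv /= => t01 tN.
  by rewrite (_ : t = 2^-1); [rewrite mulfV// subrr f1 g0|arith].
- refine (@within_comp _ _ _ _ _ (fun t : R => 2 * t) _ _ _ cf).
    exact: continuous_subspaceT.
  by move=> t; rewrite I01P /= in_itv /=; arith.
- refine (@within_comp _ _ _ _ _ (fun t : R => 2 * t - 1) _ _ _ cg).
    by apply: continuous_subspaceT => t; apply: cvgB; [exact: cM|exact: cvg_cst].
  by move=> t; rewrite I01P /= in_itv /=; arith.
Qed.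

Lemma closed_prod (A B : set R) : closed A -> closed B -> closed (A `*` B).
Proof.
move=> cA cB; rewrite (_ : A `*` B = (fst @^-1` A) `&` (snd @^-1` B)).
  by apply: closedI; apply: closed_comp => // p _; [exact: cvg_fst|exact: cvg_snd].
by apply/seteqP; split.
Qed.

Lemma homotopic_reparam x y f g (phi psi : R -> R) a b :
  {within `[0, 1], continuous f} -> continuous phi -> continuous psi ->
  (forall t, 0 <= t <= 1 -> 0 <= phi t <= 1) ->
  (forall t, 0 <= t <= 1 -> 0 <= psi t <= 1) ->
  phi 0 = a -> psi 0 = a -> phi 1 = b -> psi 1 = b -> f a = x -> f b = y ->
  (forall t, 0 <= t <= 1 -> g t = f (phi t)) ->
  forall h, (forall t, 0 <= t <= 1 -> h t = f (psi t)) -> homotopic x y g h.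
Proof.
move=> cf cphi cpsi phiI psiI phi0 psi0 phi1 psi1 fa fb gE h hE.
exists (f \o (fun p : R * R => (1 - p.1) * phi p.2 + p.1 * psi p.2)).
split=> [|t t01|t t01|s s01|s s01] /=.
- apply: within_comp cf.
    apply: continuous_subspaceT => p; apply: cvgD; apply: cvgM.
    + by apply: cvgB; [exact: cvg_cst|exact: cvg_fst].
    + by apply: continuous_comp; [exact: cvg_snd|exact: cphi].
    + exact: cvg_fst.
    + by apply: continuous_comp; [exact: cvg_snd|exact: cpsi].
  move=> [s t] [/= + +]; rewrite !in_itv /= => s01 t01.
  have := phiI t t01; have := psiI t t01; move=> *; apply/andP; split; nra.
- by rewrite subr0 mul1r mul0r addr0 gE.
- by rewrite subrr mul1r mul0r add0r hE.
- by rewrite phi0 psi0 -mulrDl subrK mul1r.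
- by rewrite phi1 psi1 -mulrDl subrK mul1r.
Qed.

Let continuous_fst_R : continuous (fst : R * R -> R).
Proof. by move=> p; exact: (@cvg_fst _ _ _ _ _). Qed.

Let continuous_snd_R : continuous (snd : R * R -> R).
Proof. by move=> p; exact: (@cvg_snd _ _ _ _ _). Qed.

Let continuous_pair_R (a b : R * R -> R) :
  continuous a -> continuous b -> continuous (fun p => (a p, b p)).
Proof. by move=> ca cb p; exact: (cvg_pair (ca p) (cb p)). Qed.

Let continuous_id_R : continuous (id : R -> R).
Proof. by move=> t A. Qed.

Lemma homotopic_refl x y f : is_path x y f -> homotopic x y f f.
Proof.
move=> [cf f0 f1]; apply: (@homotopic_reparam x y f f id id 0 1) => //;
  exact: continuous_id_R.
Qed.

Lemma homotopic_sym x y f g : homotopic x y f g -> homotopic x y g f.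
Proof.
move=> [H [cH H0 H1 Hx Hy]].
exists (H \o (fun p => (1 - p.1, p.2))); split=> [|t t01|t t01|s s01|s s01] /=.
- apply: within_comp cH.
    apply: continuous_subspaceT ; apply: continuous_pair_R; last exact: continuous_snd_R.
    by move=> p; apply: cvgB; [exact: cvg_cst|exact: cvg_fst].
  by move=> [s t] [/= + +]; rewrite !in_itv /= => s01 t01; split; arith.
- by rewrite subr0 H1.
- by rewrite subrr H0.
- by rewrite Hx//; arith.
- by rewrite Hy//; arith.
Qed.

Lemma homotopic_trans x y f g h :
  homotopic x y f g -> homotopic x y g h -> homotopic x y f h.
Proof.
move=> [H [cH H0 H1 Hx Hy]] [K [cK K0 K1 Kx Ky]].
exists (fun p => if p.1 <= 2^-1 then H (2 * p.1, p.2) else K (2 * p.1 - 1, p.2)).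
have cM : continuous (fun p : R * R => 2 * p.1).
  by move=> p; apply: cvgM; [exact: cvg_cst|exact: cvg_fst].
split=> [|t t01|t t01|s s01|s s01] /=.
- refine (@within_paste (R * R)%type X (`[0, 2^-1]%classic `*` `[0, 1]%classic)
    (`[2^-1, 1]%classic `*` `[0, 1]%classic)
    _ (fun p => p.1 <= 2^-1) (fun p => H (2 * p.1, p.2))
    (fun p => K (2 * p.1 - 1, p.2)) _ _ _ _ _ _ _).
  + by apply: closed_prod; exact: interval_closed.
  + by apply: closed_prod; exact: interval_closed.
  + move=> [s t] [/= + +]; rewrite !in_itv /= => s01 t01.
    by case: (lerP s 2^-1) => ?; [left|right]; split=> /=; arith.
  + by move=> [s t] [/= + +]; rewrite !in_itv /= => s01 t01 sN; exfalso; arith.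
  + move=> [s t] [/= + +]; rewrite !in_itv /= => s01 t01 sN.
    by rewrite (_ : s = 2^-1); [rewrite mulfV// subrr H1 ?K0|arith].
  + refine (@within_comp _ _ _ _ _ (fun p : R * R => (2 * p.1, p.2)) _ _ _ cH).
      by apply: continuous_subspaceT ; apply: continuous_pair_R; [exact: cM|exact: continuous_snd_R].
    by move=> [s t] [/= + +]; rewrite !in_itv /= => s01 t01; split=> /=; arith.
  + refine (@within_comp _ _ _ _ _ (fun p : R * R => (2 * p.1 - 1, p.2)) _ _ _ cK).
      apply: continuous_subspaceT ; apply: continuous_pair_R; last exact: continuous_snd_R.
      by move=> p; apply: cvgB; [exact: cM|exact: cvg_cst].
    by move=> [s t] [/= + +]; rewrite !in_itv /= => s01 t01; split=> /=; arith.
- by rewrite ifT ?mulr0 ?H0// invr_ge0.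
- rewrite ifF; last by apply/negbTE; arith.
  by rewrite (_ : 2 * 1 - 1 = 1 :> R) ?K1//; arith.
- by case: ifPn => ?; [rewrite Hx|rewrite Kx] => //; arith.
- by case: ifPn => ?; [rewrite Hy|rewrite Ky] => //; arith.
Qed.

Lemma homotopic_rev x y f g :
  homotopic x y f g -> homotopic y x (path_rev f) (path_rev g).
Proof.
move=> [H [cH H0 H1 Hx Hy]].
exists (H \o (fun p => (p.1, 1 - p.2))); split=> [|t t01|t t01|s s01|s s01] /=.
- apply: within_comp cH.
    apply: continuous_subspaceT ; apply: continuous_pair_R; first exact: continuous_fst_R.
    by move=> p; apply: cvgB; [exact: cvg_cst|exact: cvg_snd].
  by move=> [s t] [/= + +]; rewrite !in_itv /= => s01 t01; split; arith.
- by rewrite H0//; arith.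
- by rewrite H1//; arith.
- by rewrite subr0 Hy.
- by rewrite subrr Hx.
Qed.

Lemma homotopic_cat x y z f f' g g' :
  homotopic x y f f' -> homotopic y z g g' ->
  homotopic x z (path_cat f g) (path_cat f' g').
Proof.
move=> [H [cH H0 H1 Hx Hy]] [K [cK K0 K1 Kx Ky]].
exists (fun p => if p.2 <= 2^-1 then H (p.1, 2 * p.2) else K (p.1, 2 * p.2 - 1)).
have cM : continuous (fun p : R * R => 2 * p.2).
  by move=> p; apply: cvgM; [exact: cvg_cst|exact: cvg_snd].
split=> [|t t01|t t01|s s01|s s01] /=.
- refine (@within_paste (R * R)%type X (`[0, 1]%classic `*` `[0, 2^-1]%classic)
    (`[0, 1]%classic `*` `[2^-1, 1]%classic)
    _ (fun p => p.2 <= 2^-1) (fun p => H (p.1, 2 * p.2))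
    (fun p => K (p.1, 2 * p.2 - 1)) _ _ _ _ _ _ _).
  + by apply: closed_prod; exact: interval_closed.
  + by apply: closed_prod; exact: interval_closed.
  + move=> [s t] [/= + +]; rewrite !in_itv /= => s01 t01.
    by case: (lerP t 2^-1) => ?; [left|right]; split=> /=; arith.
  + by move=> [s t] [/= + +]; rewrite !in_itv /= => s01 t01 sN; exfalso; arith.
  + move=> [s t] [/= + +]; rewrite !in_itv /= => s01 t01 sN.
    by rewrite (_ : t = 2^-1); [rewrite mulfV// subrr Hy ?Kx|arith].
  + refine (@within_comp _ _ _ _ _ (fun p : R * R => (p.1, 2 * p.2)) _ _ _ cH).
      by apply: continuous_subspaceT ; apply: continuous_pair_R; [exact: continuous_fst_R|exact: cM].
    by move=> [s t] [/= + +]; rewrite !in_itv /= => s01 t01; split=> /=; arith.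
  + refine (@within_comp _ _ _ _ _ (fun p : R * R => (p.1, 2 * p.2 - 1)) _ _ _ cK).
      apply: continuous_subspaceT ; apply: continuous_pair_R; first exact: continuous_fst_R.
      by move=> p; apply: cvgB; [exact: cM|exact: cvg_cst].
    by move=> [s t] [/= + +]; rewrite !in_itv /= => s01 t01; split=> /=; arith.
- by rewrite /path_cat; case: ifPn => ?; [rewrite H0|rewrite K0] => //; arith.
- by rewrite /path_cat; case: ifPn => ?; [rewrite H1|rewrite K1] => //; arith.
- by rewrite ifT ?mulr0 ?Hx// invr_ge0.
- rewrite ifF; last by apply/negbTE; arith.
  by rewrite (_ : 2 * 1 - 1 = 1 :> R) ?Ky//; arith.
Qed.

Let continuous_aff (a b : R) : continuous (fun t : R => a * t + b).
Proof.
move=> t; apply: cvgD; last exact: cvg_cst.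
by apply: cvgM; [exact: cvg_cst|exact: cvg_id].
Qed.

Lemma homotopic_cat1 x y f : is_path x y f ->
  homotopic x y (path_cat (cst x) f) f.
Proof.
move=> pf; have [cf f0 f1] := pf.
apply: (@homotopic_reparam x y f _ (cst 0 \max (fun t => 2 * t + -1)) id 0 1) => //.
- by move=> t; apply: continuous_max; [exact: cvg_cst|exact: continuous_aff].
- by move=> t t01 /=; case: (leP 0 (2 * t + -1)) => ?; arith.
- by rewrite /= maxEle ifF//; apply/negbTE; arith.
- by rewrite /= maxEle ifT; arith.
move=> t t01; rewrite /path_cat /= maxEle.
case: ifPn => th; case: ifPn => th' //; last by arith.
by rewrite (_ : 2 * t + -1 = 0) ?f0//; arith.
Qed.

Lemma homotopic_cat1r x y f : is_path x y f ->
  homotopic x y (path_cat f (cst y)) f.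
Proof.
move=> pf; have [cf f0 f1] := pf.
apply: (@homotopic_reparam x y f _ ((fun t => 2 * t + 0) \min cst 1) id 0 1) => //.
- by move=> t; apply: continuous_min; [exact: continuous_aff|exact: cvg_cst].
- by move=> t t01 /=; case: (leP (2 * t + 0) 1) => ?; arith.
- by rewrite /= minEle ifT; arith.
- by rewrite /= minEle ifF//; apply/negbTE; arith.
move=> t t01; rewrite /path_cat /= minEle addr0.
by case: ifPn => th; case: ifPn => th' //; arith.
Qed.

Lemma homotopic_catVr x y f : is_path x y f ->
  homotopic x x (path_cat f (path_rev f)) (cst x).
Proof.
move=> pf; have [cf f0 f1] := pf.
apply: (@homotopic_reparam x x f _
  ((fun t => 2 * t + 0) \min (fun t => -2 * t + 2)) (cst 0) 0 0) => //.
- by move=> t; apply: continuous_min; exact: continuous_aff.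
- by move=> t; exact: cvg_cst.
- by move=> t t01 /=; case: (leP (2 * t + 0) (-2 * t + 2)) => ?; arith.
- by move=> t t01 /=; arith.
- by rewrite /= minEle ifT; arith.
- by rewrite /= minEle ifF; [arith|apply/negbTE; arith].
move=> t t01; rewrite /path_cat /path_rev /= minEle addr0.
case: ifPn => th; case: ifPn => th' //; try arith.
by congr f; arith.
Qed.

Lemma path_revK f t : path_rev (path_rev f) t = f t.
Proof. by rewrite /path_rev subKr. Qed.

Lemma homotopic_catVl x y f : is_path x y f ->
  homotopic y y (path_cat (path_rev f) f) (cst y).
Proof.
move=> /is_path_rev/homotopic_catVr.
rewrite (_ : path_rev (path_rev f) = f)//.
by apply/funext => t; rewrite path_revK.
Qed.

Lemma homotopic_catA x y z w f g h :
  is_path x y f -> is_path y z g -> is_path z w h ->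
  homotopic x w (path_cat f (path_cat g h)) (path_cat (path_cat f g) h).
Proof.
move=> pf pg ph; have [ck k0 k1] := is_path_cat pf (is_path_cat pg ph).
apply: homotopic_sym.
apply: (@homotopic_reparam x w _ _
  ((fun t => 2 * t + 0) \min
    ((fun t => 1 * t + 4^-1) \min (fun t => 2^-1 * t + 2^-1))) id 0 1 ck) => //.
- move=> t; apply: continuous_min; first exact: continuous_aff.
  by apply: continuous_min; exact: continuous_aff.
- move=> t t01 /=; rewrite !le_min !ge_min.
  by apply/andP; split; [apply/and3P; split; arith|apply/or3P; apply: Or33; arith].
- by rewrite /= [X in Num.min _ X]min_l ?min_l; arith.
- by rewrite /= [X in Num.min _ X]min_r ?min_r; arith.
move=> t t01 /=; rewrite /path_cat.
case: (pf) => _ f0 f1; case: (pg) => _ g0 g1; case: (ph) => _ h0 h1.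
case: (leP (1 * t + 4^-1) (2^-1 * t + 2^-1)) => ?;
  [case: (leP (2 * t + 0) (1 * t + 4^-1)) => ?
  |case: (leP (2 * t + 0) (2^-1 * t + 2^-1)) => ?];
  repeat (case: ifPn => ?); try (by congr f; arith); try (by congr g; arith);
  try (by congr h; arith); try arith.
Qed.

End Homotopy.

Section FundamentalGroup.
Context {R : realType} {X : topologicalType}.

Definition loop (x : X) := {f : R -> X | is_path x x f}.

HB.instance Definition _ x := gen_eqMixin (loop x).
HB.instance Definition _ x := gen_choiceMixin (loop x).

Variable x : X.

Definition loop_homotopic (f g : loop x) : bool := `[< homotopic x x (sval f) (sval g) >].

Lemma loop_homotopic_refl : reflexive loop_homotopic.
Proof. by move=> f; apply/asboolP/homotopic_refl/(svalP f). Qed.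

Lemma loop_homotopic_sym : symmetric loop_homotopic.
Proof. by move=> f g; apply/asboolP/asboolP; exact: homotopic_sym. Qed.

Lemma loop_homotopic_trans : transitive loop_homotopic.
Proof.
by move=> g f h /asboolP fg /asboolP gh; apply/asboolP/(homotopic_trans fg gh).
Qed.

Canonical loop_homotopic_equiv := EquivRel loop_homotopic
  loop_homotopic_refl loop_homotopic_sym loop_homotopic_trans.

Definition pi1 := {eq_quot loop_homotopic_equiv}.

HB.instance Definition _ := Choice.on pi1.
HB.instance Definition _ := EqQuotient.on pi1.

Definition pi1_class (f : loop x) : pi1 := \pi_pi1 f.

Lemma pi1_classP (f g : loop x) :
  pi1_class f = pi1_class g <-> homotopic x x (sval f) (sval g).
Proof.
split; first by move=> /eqmodP /asboolP.
by move=> fg; apply/eqmodP/asboolP.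
Qed.

Lemma pi1_surj (c : pi1) : exists f, c = pi1_class f.
Proof. by exists (repr c); rewrite /pi1_class reprK. Qed.

Lemma pi1_ind (P : pi1 -> Prop) : (forall f, P (pi1_class f)) -> forall c, P c.
Proof. by move=> Pf c; rewrite -[c]reprK; exact: Pf. Qed.

Definition loop_cst : loop x := exist _ (cst x) (is_path_cst x).

Definition loop_cat (f g : loop x) : loop x :=
  exist _ (path_cat (sval f) (sval g)) (is_path_cat (svalP f) (svalP g)).

Definition loop_rev (f : loop x) : loop x :=
  exist _ (path_rev (sval f)) (is_path_rev (svalP f)).

Definition pi1_one : pi1 := pi1_class loop_cst.
Definition pi1_mul (c d : pi1) : pi1 := pi1_class (loop_cat (repr c) (repr d)).
Definition pi1_inv (c : pi1) : pi1 := pi1_class (loop_rev (repr c)).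

Lemma repr_pi1_class f : homotopic x x (sval (repr (pi1_class f))) (sval f).
Proof. by apply/pi1_classP; rewrite /pi1_class reprK. Qed.

Lemma pi1_mulE f g :
  pi1_mul (pi1_class f) (pi1_class g) = pi1_class (loop_cat f g).
Proof. by apply/pi1_classP/homotopic_cat; exact: repr_pi1_class. Qed.

Lemma pi1_invE f : pi1_inv (pi1_class f) = pi1_class (loop_rev f).
Proof. by apply/pi1_classP/homotopic_rev; exact: repr_pi1_class. Qed.

Lemma pi1_mulA : associative pi1_mul.
Proof.
elim/pi1_ind => f; elim/pi1_ind => g; elim/pi1_ind => h.
rewrite !pi1_mulE; apply/pi1_classP.
exact: (homotopic_catA (svalP f) (svalP g) (svalP h)).
Qed.

Lemma pi1_mul1 : left_id pi1_one pi1_mul.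
Proof.
elim/pi1_ind => f; rewrite pi1_mulE; apply/pi1_classP.
exact: homotopic_cat1 (svalP f).
Qed.

Lemma pi1_mul1r : right_id pi1_one pi1_mul.
Proof.
elim/pi1_ind => f; rewrite pi1_mulE; apply/pi1_classP.
exact: homotopic_cat1r (svalP f).
Qed.

Lemma pi1_mulV : left_inverse pi1_one pi1_inv pi1_mul.
Proof.
elim/pi1_ind => f; rewrite pi1_invE pi1_mulE; apply/pi1_classP.
exact: homotopic_catVl (svalP f).
Qed.

Lemma pi1_mulVr : right_inverse pi1_one pi1_inv pi1_mul.
Proof.
elim/pi1_ind => f; rewrite pi1_invE pi1_mulE; apply/pi1_classP.
exact: homotopic_catVr (svalP f).
Qed.

HB.instance Definition _ := isGroup.Build pi1
  pi1_mulA pi1_mul1 pi1_mul1r pi1_mulV pi1_mulVr.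

End FundamentalGroup.

Arguments loop R {X} x.
Arguments pi1 R {X} x.

Section InducedMap.
Context {R : realType} {X Y : topologicalType}.
Variables (h : X -> Y) (ch : continuous h) (x : X) (y : Y) (hx : h x = y).

Lemma is_path_map (f : loop R x) : is_path y y (h \o sval f).
Proof.
have [cf f0 f1] := svalP f; split; rewrite /= ?f0 ?f1 ?hx//.
refine (@within_comp _ _ _ _ setT (sval f) h cf _ _) => //.
exact: continuous_subspaceT.
Qed.

Definition loop_map (f : loop R x) : loop R y := exist _ _ (is_path_map f).

Definition pi1_map (c : pi1 R x) : pi1 R y := pi1_class (loop_map (repr c)).

Lemma pi1_mapE f : pi1_map (pi1_class f) = pi1_class (loop_map f).
Proof.
apply/pi1_classP; have [H [cH H0 H1 Hx Hy]] := repr_pi1_class f.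
exists (h \o H); split=> [|t t01|t t01|s s01|s s01] /=.
- refine (@within_comp _ _ _ _ setT H h cH _ _) => //.
  exact: continuous_subspaceT.
- by rewrite H0.
- by rewrite H1.
- by rewrite Hx.
- by rewrite Hy.
Qed.

Lemma pi1_mapM : {morph pi1_map : c d / (c * d)%g}.
Proof.
move=> c d; have [f ->] := pi1_surj c; have [g ->] := pi1_surj d.
rewrite [(_ * _)%g]pi1_mulE !pi1_mapE [RHS]pi1_mulE; congr pi1_class.
apply: eq_exist => /=; apply/funext => t /=.
by rewrite /path_cat /=; case: ifP.
Qed.

Lemma pi1_map1 : pi1_map 1%g = 1%g.
Proof.
by rewrite [LHS]pi1_mapE; congr pi1_class; apply: eq_exist; apply/funext.
Qed.

HB.instance Definition _ := isMultiplicative.Build _ _ pi1_map pi1_mapM.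
HB.instance Definition _ :=
  Multiplicative_isUMagmaMorphism.Build _ _ pi1_map pi1_map1.

End InducedMap.

Section Arrangement.
Variables (k : fieldType) (gT : finGroupType) (W : {group gT}) (n : nat).
Variable rho : mx_representation k W n.

Definition is_reflection (s : gT) : bool :=
  (s \in W) && ((\rank (eigenspace (rho s) 1)).+1 == n).

Definition reflection_group := <<[set s | is_reflection s]%SET>>%g = W.

Definition fixed_space (s : gT) : set 'rV[k]_n := [set x | x *m rho s = x].

Definition hyperplanes : set (set 'rV[k]_n) :=
  [set fixed_space s | s in [set s | is_reflection s]].

Definition regular_pts : set 'rV[k]_n := ~` \bigcup_(H in hyperplanes) H.

Lemma regularP x :
  regular_pts x <-> forall s, is_reflection s -> ~ fixed_space s x.
Proof.
split=> [rx s rs sx|rx]; first by apply: rx; exists (fixed_space s) => //; exists s.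
by move=> [_ [s rs <-]]; exact: rx.
Qed.

Lemma repr_actM (x : 'rV[k]_n) g h : g \in W -> h \in W ->
  x *m rho (g * h)%g = x *m rho g *m rho h.
Proof. by move=> Wg Wh; rewrite repr_mxM// mulmxA. Qed.

End Arrangement.

Section OrbitSpace.
Variables (K : numFieldType) (gT : finGroupType) (W : {group gT}) (n : nat).
Variable rho : mx_representation K W n.

Definition orbit_equal (x y : set_type (regular_pts rho)) : bool :=
  [exists w in W, \val x *m rho w == \val y].

Lemma orbit_rel_refl : reflexive orbit_equal.
Proof. by move=> x; apply/exists_inP; exists 1%g; rewrite ?repr_mx1 ?mulmx1. Qed.

Lemma orbit_rel_sym : symmetric orbit_equal.
Proof.
suff imp x y : orbit_equal x y -> orbit_equal y x by move=> x y; apply/idP/idP; exact: imp.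
move=> /exists_inP[w Ww /eqP xy]; apply/exists_inP; exists (w^-1)%g.
  by rewrite groupV.
by rewrite -xy -repr_actM ?groupV// mulgV repr_mx1 mulmx1.
Qed.

Lemma orbit_rel_trans : transitive orbit_equal.
Proof.
move=> y x z /exists_inP[w Ww /eqP xy] /exists_inP[v Wv /eqP yz].
apply/exists_inP; exists (w * v)%g; first by rewrite groupM.
by rewrite repr_actM// xy yz.
Qed.

Canonical orbit_equiv :=
  EquivRel orbit_equal orbit_rel_refl orbit_rel_sym orbit_rel_trans.

Definition orbit_space := quotient_topology {eq_quot orbit_equiv}.

HB.instance Definition _ := Topological.on orbit_space.
HB.instance Definition _ := Quotient.on orbit_space.

Definition orbit_class (x : set_type (regular_pts rho)) : orbit_space :=
  \pi_orbit_space x.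

Lemma orbitP x y : orbit_class x = orbit_class y <-> orbit_equal x y.
Proof.
rewrite /orbit_class (_ : (_ = _) = (\pi_{eq_quot orbit_equiv} x = \pi y))//.
by split=> [/eqmodP//|xy]; exact/eqmodP.
Qed.

End OrbitSpace.

(* As a numFieldType, R[i] receives the topology of its norm. *)
Definition Cx (R : realType) : numFieldType := R[i].

Section Complexification.
Variable R : realType.

Definition toCx : {rmorphism R -> Cx R} := real_complex R.

Definition cvec n (x : 'rV[R]_n) : 'rV[Cx R]_n := map_mx toCx x.

Variables (gT : finGroupType) (W : {group gT}) (n : nat).
Variable rho : mx_representation R W n.

Definition crepr : mx_representation (Cx R) W n := map_repr toCx rho.

Lemma is_reflection_crepr : is_reflection crepr =1 is_reflection rho.
Proof.
move=> s; rewrite /is_reflection; congr (_ && (_.+1 == _)).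
by rewrite /crepr /= -(rmorph1 toCx) -map_eigenspace mxrank_map.
Qed.

Lemma regular_cvec x : regular_pts rho x -> regular_pts crepr (cvec x).
Proof.
move=> /regularP rx; apply/regularP => s; rewrite is_reflection_crepr => rs.
rewrite /fixed_space /= /cvec -map_mxM => sx; apply: (rx s rs).
exact: (map_mx_inj sx).
Qed.

Definition is_chamber (C : set 'rV[R]_n) :=
  exists2 x, regular_pts rho x & C = connected_component (regular_pts rho) x.

Lemma chamber_regular C x : is_chamber C -> C x -> regular_pts rho x.
Proof. by move=> [y _ ->]; exact: connected_component_sub. Qed.

(* H is the support of a face of C: some point of the closure of C lies on H and
   on no other hyperplane. *)
Definition is_wall (C H : set 'rV[R]_n) :=
  hyperplanes rho H /\
  exists x, [/\ closure C x, H x & forall H', hyperplanes rho H' -> H' x -> H' = H].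

Definition wall_reflection (C : set 'rV[R]_n) (s : gT) :=
  is_reflection rho s /\ is_wall C (fixed_space rho s).

Definition braid_group (b : set_type (regular_pts crepr)) := pi1 R (orbit_class b).

HB.instance Definition _ b := Group.on (braid_group b).

Definition base_point C x (hC : is_chamber C) (Cx0 : C x) :
    set_type (regular_pts crepr) :=
  exist _ (cvec x) (mem_set (regular_cvec (chamber_regular hC Cx0))).

Definition half_turn (h l : 'rV[R]_n) (theta : R) : 'rV[Cx R]_n :=
  cvec h + ((cos (pi * theta) +i* sin (pi * theta))%C : Cx R) *: cvec l.

(* A path from gamma 0 to gamma 0 *m rho s, where gamma t = h + l, s fixes h and
   negates l. *)
Definition half_monodromy (s : gT) (gamma : R -> 'rV[R]_n) (t : R)
    (h l : 'rV[R]_n) : R -> 'rV[Cx R]_n :=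
  let leg := fun u => cvec (gamma (u * t)) in
  path_cat (path_cat leg (half_turn h l))
    (fun u => path_rev leg u *m crepr s).

(* c is the class sigma_s attached to the chamber C and the real base point b.
   The half-turn is made at gamma t for t close enough to 1, and the path from
   b to b *m rho s is read as a loop in the orbit space. *)
Definition standard_generator (C : set 'rV[R]_n) (b : set_type (regular_pts crepr))
    (s : gT) (c : braid_group b) :=
  exists gamma : R -> 'rV[R]_n,
    [/\ {within `[0, 1], continuous gamma},
        cvec (gamma 0) = \val b,
        (forall t, 0 <= t < 1 -> C (gamma t)),
        rstab rho (gamma 1) = <[s]>%g &
        \forall t \near 1^'-, exists h l (f : loop R (orbit_class b)),
          [/\ gamma t = h + l, h *m rho s = h, l *m rho s = - l,
              (forall u, 0 <= u <= 1 -> exists2 y,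
                 \val y = half_monodromy s gamma t h l u & sval f u = orbit_class y) &
              c = pi1_class f]].

End Complexification.

Lemma continuous_mpoly_fun (K : numFieldType) p q (g : q.-tuple (mpoly.mpoly p K)) :
  continuous (mpoly_fun g : 'rV[K]_p -> 'rV[K]_q).
Proof.
have cX (e : nat) (h : 'rV[K]_p -> K) : continuous h -> continuous (fun y => h y ^+ e).
  move=> ch; elim: e => [|e IHe].
    rewrite (_ : (fun y => _) = cst 1); first exact: cst_continuous.
    by apply/funext => y; rewrite expr0.
  rewrite (_ : (fun y => _) = (fun y => h y * h y ^+ e)).
    by move=> y; exact: (cvgM (ch y) (IHe y)).
  by apply/funext => y; rewrite exprS.
have cP (s : seq 'I_p) (mm : 'I_p -> nat) :
    continuous (fun y : 'rV[K]_p => \prod_(j <- s) y 0 j ^+ mm j).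
  elim: s => [|j s IHs].
    rewrite (_ : (fun y => _) = cst 1); first exact: cst_continuous.
    by apply/funext => y; rewrite big_nil.
  rewrite (_ : (fun y => _) =
      (fun y : 'rV[K]_p => y 0 j ^+ mm j * \prod_(j <- s) y 0 j ^+ mm j)).
    move=> y; apply: (cvgM _ (IHs y)).
    by apply: (@cX _ (fun y : 'rV[K]_p => y 0 j)); exact: coord_continuous.
  by apply/funext => y; rewrite big_cons.
have cS (h : mpoly.mpoly p K) (s : seq _) : continuous (fun y : 'rV[K]_p =>
    \sum_(mm <- s) mpoly.mcoeff mm h * \prod_j y 0 j ^+ mpoly.fun_of_multinom mm j).
  elim: s => [|mm s IHs].
    rewrite (_ : (fun y => _) = cst 0); first exact: cst_continuous.
    by apply/funext => y; rewrite big_nil.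
  rewrite (_ : (fun y => _) = (fun y : 'rV[K]_p =>
      mpoly.mcoeff mm h * \prod_j y 0 j ^+ mpoly.fun_of_multinom mm j +
      \sum_(mm <- s) mpoly.mcoeff mm h * \prod_j y 0 j ^+ mpoly.fun_of_multinom mm j)).
    move=> y; apply: (cvgD _ (IHs y)).
    apply: (cvgM _ (cP _ (mpoly.fun_of_multinom mm) y)).
    exact: (@cst_continuous _ _ (mpoly.mcoeff mm h) y).
  by apply/funext => y; rewrite big_cons.
move=> x A [P PA sub].
have nP : \forall y \near x, forall j, P 0 j (mpoly_fun g y 0 j).
  apply: (filter_forall (nbhs_filter x)) => j.
  have := cS (tnth g j) (mpoly.msupp (tnth g j)) x (P 0 j).
  rewrite /= -mpoly.mevalE; have := PA 0 j; rewrite mxE => nP /(_ nP).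
  by apply: (@filterS _ _ (nbhs_filter x)) => y; rewrite /= mxE mpoly.mevalE.
by apply: (@filterS _ _ (nbhs_filter x) _ _ _ nP) => y Py; apply: sub => i j; rewrite (ord1 i).
Qed.

Section BraidMap.
Variables (R : realType) (gT : finGroupType) (W G : {group gT}) (n m : nat).
Variables (rho : mx_representation R W n).
Variables (rhoq : mx_representation R (W / G)%G m).
Variables (f : m.-tuple (mpoly.mpoly n R)).

Definition cmap : 'rV[Cx R]_n -> 'rV[Cx R]_m := mpoly_fun (map_mpolys (toCx R) f).

Definition rmap : 'rV[R]_n -> 'rV[R]_m := mpoly_fun f.

Hypothesis act : induced_action W rho rhoq f.

Lemma cmap_act x w : w \in W ->
  cmap (x *m crepr rho w) = cmap x *m crepr rhoq (coset G w).
Proof.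
by move=> Ww; exact: (induced_actionE x (map_induced_action (toCx R) act) Ww).
Qed.

Hypothesis pM : forall x, regular_pts (crepr rho) x -> regular_pts (crepr rhoq) (cmap x).

Definition regular_map (x : set_type (regular_pts (crepr rho))) :
    set_type (regular_pts (crepr rhoq)) :=
  exist _ (cmap (\val x)) (mem_set (pM (set_valP x))).

Lemma continuous_regular_map : continuous regular_map.
Proof.
have c : continuous (cmap \o (set_val : set_type (regular_pts (crepr rho)) -> _)).
  move=> x; apply: continuous_comp; first exact: initial_continuous.
  exact: continuous_mpoly_fun.
by apply: continuous_comp_initial; exact: c.
Qed.

Lemma orbit_regular_map x y :
  orbit_class x = orbit_class y -> orbit_class (regular_map x) = orbit_class (regular_map y).
Proof.
move=> /orbitP/exists_inP[w Ww /eqP xy]; apply/orbitP/exists_inP.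
by exists (coset G w); rewrite ?mem_quotient//= -cmap_act// xy.
Qed.

Definition orbit_map : orbit_space (crepr rho) -> orbit_space (crepr rhoq) :=
  (fun x => orbit_class (regular_map x)) \o repr.

Lemma orbit_mapE x : orbit_map (orbit_class x) = orbit_class (regular_map x).
Proof. by apply: orbit_regular_map; exact: reprK. Qed.

Lemma continuous_orbit_map : continuous orbit_map.
Proof.
apply: repr_comp_continuous.
  move=> x; apply: continuous_comp; first exact: continuous_regular_map.
  exact: pi_continuous.
by move=> x y /eqP xy; apply/eqP/orbit_regular_map.
Qed.

Definition braid_map (b : set_type (regular_pts (crepr rho))) :
    braid_group b -> braid_group (regular_map b) :=
  pi1_map continuous_orbit_map (orbit_mapE b).

HB.instance Definition _ b := UMagmaMorphism.on (@braid_map b).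

End BraidMap.

Arguments braid_map {R gT W G n m rho rhoq f} act pM b c.

(* Main.v *)
Require Import Defs.
From mathcomp Require Import all_boot all_order all_algebra all_fingroup.
From mathcomp Require Import mxrepresentation generic_quotient complex.
From mathcomp Require mpoly.
From mathcomp Require Import ring lra.

(* Cover the regular points of V by the sets star b (b real regular), where for
   every reflecting hyperplane the value of its linear form avoids the closed
   half-line opposite to its value at i b.  Each of them is star-shaped around i b,
   so two paths in star b with the same end points are homotopic, and it contains
   all real regular points.  Cutting a loop of the orbit space into pieces that lift
   to such sets writes it as a product of half-turns at the walls of a chamber.

   At a point x of the wall of s outside G whose stabiliser in G is trivial, the
   pull-back of the linear form of q(s) is the form of s times a function that does
   not vanish at x, because G-invariants separate x from its G-translates; goodness
   makes V^- one-dimensional, i.e., q(s) is a reflection (Nakayama).  Hence p sends a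
   small half-turn at x into star b, for b on the right side, and in there the image
   is homotopic to the standard half-turn.  If s is in G, the image is a loop in
   star b and is null-homotopic.  A half-turn on the other side is the translate by
   q(s) of a reversed one, so that all the generating loops lift. *)

Set Implicit Arguments.
Unset Strict Implicit.
Unset Printing Implicit Defensive.

Import Order.TTheory GRing.Theory Num.Theory.
Local Open Scope ring_scope.

(** * Polynomial invariants *)

(** The hyperplanes have real codimension two, and the usual argument pushes a loop into general
    position with respect to them. The star regions replace this: each one contains every real
    chamber, and up to homotopy a path in it is known from its ends, so only the side on which [b]
    lies matters. The points at which a loop is cut are not real. Each is tied to a real chamber by
    a straight segment whose real part avoids the hyperplanes before its end; any chamber whose
    closure contains the real part of the point will do. In the algebra, Nakayama's argument gives a
    denominator that is only known to be nonzero at the origin, while the wall points lie away from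
    it. Since walls are cones and nonzero multiples of a point have the same stabiliser, a wall
    point can be replaced by a multiple of itself at which the denominator does not vanish. *)

Module Invariants.
Import mpoly.

Section Substitution.
Variable k : fieldType.

(** Identities between ring morphisms need only be checked on constants and variables; many
    polynomial identities below are proved in this way. *)
Lemma mpoly_ring_ind n (P : {mpoly k[n]} -> Prop) :
  (forall c, P c%:MP) -> (forall i, P 'X_i) ->
  (forall p q, P p -> P q -> P (p + q)) -> (forall p q, P p -> P q -> P (p * q)) ->
  forall p, P p.
Proof.
move=> PC PX PD PM; elim/mpolyind => [|c mm p _ _ Pp]; first by rewrite -mpolyC0; exact: PC.
apply: (PD _ _ _ Pp); rewrite -mul_mpolyC; apply: (PM _ _ (PC c)).
rewrite mpolyXE_id; elim: (index_enum _) => [|i l IH].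
  by rewrite big_nil -mpolyC1; exact: PC.
rewrite big_cons; apply: (PM _ _ _ IH); elim: (mm i) => [|e IHe].
  by rewrite expr0 -mpolyC1; exact: PC.
by rewrite exprS; exact: (PM _ _ (PX i) IHe).
Qed.

Definition point_eval n (x : 'rV[k]_n) (p : {mpoly k[n]}) : k := p.@[fun j => x 0 j].

Lemma point_evalD n (x : 'rV[k]_n) p q : point_eval x (p + q) = point_eval x p + point_eval x q.
Proof. exact: mevalD. Qed.

Lemma point_evalB n (x : 'rV[k]_n) p q : point_eval x (p - q) = point_eval x p - point_eval x q.
Proof. exact: mevalB. Qed.

Lemma point_evalM n (x : 'rV[k]_n) p q : point_eval x (p * q) = point_eval x p * point_eval x q.
Proof. exact: mevalM. Qed.

Lemma point_evalZ n (x : 'rV[k]_n) c p : point_eval x (c *: p) = c * point_eval x p.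
Proof. exact: mevalZ. Qed.

Lemma point_eval1 n (x : 'rV[k]_n) : point_eval x 1 = 1.
Proof. exact: meval1. Qed.

Lemma point_eval0 n (x : 'rV[k]_n) : point_eval x 0 = 0.
Proof. exact: meval0. Qed.

Lemma point_eval_sum n (x : 'rV[k]_n) I (l : seq I) (P : pred I) (F : I -> {mpoly k[n]}) :
  point_eval x (\sum_(i <- l | P i) F i) = \sum_(i <- l | P i) point_eval x (F i).
Proof. exact: raddf_sum. Qed.

Lemma point_eval_msubst n p (A : 'M[k]_(n, p)) q (x : 'rV[k]_n) :
  point_eval x (msubst A q) = point_eval (x *m A) q.
Proof. exact: meval_msubst. Qed.

Lemma point_eval_comp n m (f : m.-tuple {mpoly k[n]}) a (x : 'rV[k]_n) :
  point_eval x (a \mPo f) = point_eval (mpoly_fun f x) a.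
Proof. by rewrite /point_eval comp_mpoly_meval; apply: meval_eq => j; rewrite mxE. Qed.

Lemma point_eval_origin n (p : {mpoly k[n]}) : point_eval 0 p = p@_0.
Proof.
elim/mpoly_ring_ind: p => [c|i|p q IHp IHq|p q IHp IHq].
- by rewrite /point_eval mevalC mcoeffC eqxx mulr1.
- by rewrite /point_eval mevalXU mxE mcoeffX mnm1_eq0.
- by rewrite point_evalD IHp IHq mcoeffD.
- by rewrite point_evalM IHp IHq rmorphM.
Qed.

Section Fixed.
Variables (n p : nat) (A : 'M[k]_(n, p)).

Lemma msubstD q r : msubst A (q + r) = msubst A q + msubst A r.
Proof. exact: comp_mpolyD. Qed.

Lemma msubstB q r : msubst A (q - r) = msubst A q - msubst A r.
Proof. exact: comp_mpolyB. Qed.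

Lemma msubstM q r : msubst A (q * r) = msubst A q * msubst A r.
Proof. exact: rmorphM. Qed.

Lemma msubstZ c q : msubst A (c *: q) = c *: msubst A q.
Proof. exact: comp_mpolyZ. Qed.

Lemma msubstC c : msubst A c%:MP = c%:MP.
Proof. exact: comp_mpolyC. Qed.

Lemma msubst_sum I (l : seq I) (P : pred I) (F : I -> {mpoly k[p]}) :
  msubst A (\sum_(i <- l | P i) F i) = \sum_(i <- l | P i) msubst A (F i).
Proof. exact: raddf_sum. Qed.

Lemma msubstX j : msubst A 'X_j = \sum_i A i j *: 'X_i.
Proof. by rewrite /msubst comp_mpolyXU -tnth_nth tnth_mktuple. Qed.

End Fixed.

Lemma msubst_msubst n p q (A : 'M[k]_(n, p)) (B : 'M[k]_(p, q)) r :
  msubst A (msubst B r) = msubst (A *m B) r.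
Proof.
elim/mpoly_ring_ind: r => [c|j|r s IHr IHs|r s IHr IHs].
- by rewrite !msubstC.
- rewrite !msubstX msubst_sum; under eq_bigr do rewrite msubstZ msubstX scaler_sumr.
  rewrite exchange_big; apply: eq_bigr => i _; rewrite mxE scaler_suml.
  by apply: eq_bigr => l _; rewrite scalerA mulrC.
- by rewrite !msubstD IHr IHs.
- by rewrite !msubstM IHr IHs.
Qed.

Lemma msubst1 n (r : {mpoly k[n]}) : msubst 1%:M r = r.
Proof.
elim/mpoly_ring_ind: r => [c|j|r s IHr IHs|r s IHr IHs].
- by rewrite msubstC.
- rewrite msubstX (bigD1 j)//= mxE eqxx scale1r big1 ?addr0// => i ij.
  by rewrite mxE (negbTE ij) scale0r.
- by rewrite msubstD IHr IHs.
- by rewrite msubstM IHr IHs.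
Qed.

(** One affine factor for each unwanted point [y], built on a coordinate where [y] and [x] differ
    and normalised to be 1 at [x]. *)
Lemma interpolation n (pts : seq 'rV[k]_n) (x : 'rV[k]_n) :
  exists q, point_eval x q = 1 /\ forall y, y \in pts -> y != x -> point_eval y q = 0.
Proof.
elim: pts => [|y pts [q [qx qy]]]; first by exists 1; split=> //; exact: point_eval1.
have [->|yx] := eqVneq y x.
  exists q; split=> // z; rewrite inE => /orP[/eqP -> /eqP //|]; exact: qy.
have /rV0Pn[j yj] : y - x != 0 by rewrite subr_eq0.
move: yj; rewrite !mxE => yj.
have xy : x 0 j - y 0 j != 0 by rewrite -opprB oppr_eq0.
exists ((x 0 j - y 0 j)^-1 *: ('X_j - (y 0 j)%:MP) * q).
have ev z : point_eval z ((x 0 j - y 0 j)^-1 *: ('X_j - (y 0 j)%:MP) * q) =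
    (x 0 j - y 0 j)^-1 * (z 0 j - y 0 j) * point_eval z q.
  by rewrite point_evalM point_evalZ point_evalB /point_eval mevalXU mevalC.
split=> [|z]; first by rewrite ev mulVf// mul1r.
rewrite ev inE => /orP[/eqP ->|zp zx]; first by rewrite subrr mulr0 mul0r.
by rewrite qy// mulr0.
Qed.

Definition linear_form n (u : 'cV[k]_n) : {mpoly k[n]} := \sum_i u i 0 *: 'X_i.

Lemma point_eval_linear n (u : 'cV[k]_n) x : point_eval x (linear_form u) = (x *m u) 0 0.
Proof.
rewrite /linear_form point_eval_sum mxE; apply: eq_bigr => i _.
by rewrite point_evalZ /point_eval mevalXU mulrC.
Qed.

Lemma msubst_linear n p (A : 'M[k]_(n, p)) u : msubst A (linear_form u) = linear_form (A *m u).
Proof.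
rewrite /linear_form msubst_sum; under eq_bigr do rewrite msubstZ msubstX scaler_sumr.
rewrite exchange_big; apply: eq_bigr => i _; rewrite mxE scaler_suml.
by apply: eq_bigr => l _; rewrite scalerA mulrC.
Qed.

Lemma linear_form_eq0 n (u : 'cV[k]_n) : linear_form u = 0 -> u = 0.
Proof.
move=> u0; apply/colP => i; have := point_eval_linear u (delta_mx 0 i).
by rewrite u0 point_eval0 -rowE !mxE.
Qed.

(* The divided difference of q along the reflection 1 + u v. *)
Lemma divided_difference n (u : 'cV[k]_n) (v : 'rV[k]_n) q :
  exists r, q - msubst (1%:M + u *m v) q = linear_form u * r.
Proof.
elim/mpoly_ring_ind: q => [c|j|p q [r rE] [s sE]|p q [r rE] [s sE]].
- by exists 0; rewrite msubstC subrr mulr0.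
- exists (- (v 0 j)%:MP); rewrite mulrN [_ * (v 0 j)%:MP]mulrC mul_mpolyC.
  rewrite -{1}[X in X - _](msubst1 'X_j) -/(msubst _ _) !msubstX -sumrB.
  rewrite /linear_form scaler_sumr -sumrN; apply: eq_bigr => i _.
  rewrite -scalerBl scalerA -scaleNr; congr (_ *: _).
  by rewrite [(1%:M + _) i j]mxE opprD addNKr mxE big_ord1 mulrC.
- by exists (r + s); rewrite msubstD mulrDr -rE -sE opprD addrACA.
(* Twisted Leibniz rule: the first factor is changed while [q] is kept, then the second one while
   the transformed [p] is kept. *)
- exists (r * q + msubst (1%:M + u *m v) p * s).
  by rewrite msubstM mulrDr mulrA -rE mulrCA -sE; ring.
Qed.

End Substitution.
End Invariants.

(** * Homogeneous components, averages over [G] and separation of orbits *)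

Module InvariantRing.
Import mpoly Invariants.

Section Homogeneous.
Variable k : fieldType.

Lemma msubst_homog n p (A : 'M[k]_(n, p)) d q : q \is d.-homog -> msubst A q \is d.-homog.
Proof.
move=> /dhomogP hq; rewrite /msubst comp_mpolyEX rpred_sum// => mm _.
have [mmq|] := boolP (mm \in msupp q); last first.
  by move=> /memN_msupp_eq0 ->; rewrite scale0r rpred0.
apply: rpredZ; rewrite comp_mpolyX.
have -> : d = (\sum_i mm i)%N by rewrite -(hq _ mmq) -mdegE.
elim: (index_enum _) => [|i l IH]; first by rewrite !big_nil; exact: dhomog1.
rewrite !big_cons; apply: dhomogM IH.
rewrite -[X in X.-homog]mul1n; apply: dhomogMn; rewrite tnth_mktuple rpred_sum// => j _.
by apply: rpredZ; rewrite dhomogX; apply/eqP; exact: mdeg1.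
Qed.

Lemma pihomog_msubst n p (A : 'M[k]_(n, p)) d q :
  pihomog mdeg d (msubst A q) = msubst A (pihomog mdeg d q).
Proof.
(* The bound [maxn (msize q) d.+1] makes [d] an index of the sum even when it exceeds the degree of
   [q]. *)
rewrite {1}(@pihomog_partitionE _ _ mdeg (maxn (msize q) d.+1) q) ?leq_maxl//.
rewrite msubst_sum raddf_sum /=.
rewrite (bigD1 (Ordinal (leq_maxr (msize q) d.+1)))//= big1 ?addr0.
  by rewrite pihomog_dE// msubst_homog// pihomogP.
move=> i id; apply: (@pihomog_ne0 _ _ _ i); last by rewrite msubst_homog// pihomogP.
by apply: contra id => /eqP e; apply/eqP/val_inj.
Qed.

Lemma homog0_const n (q : {mpoly k[n]}) : q \is 0.-homog -> q = (q@_0)%:MP.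
Proof.
move=> /dhomogP h; apply: msize1_polyC; rewrite msizeE.
apply/bigmax_leqP_seq => mm mmq _; by rewrite (h mm).
Qed.

Lemma homog_coef0 n d (q : {mpoly k[n]}) : q \is d.+1.-homog -> q@_0 = 0.
Proof.
move=> h; apply: (dhomog_nemf_coeff h).
have : mdeg (0 : 'X_{1..n})%MM != d.+1 by rewrite mdeg0.
exact.
Qed.

End Homogeneous.

Section Splitting.
Variables (k : fieldType) (gT : finGroupType) (G : {group gT}) (n m : nat).
Variables (rho : gT -> 'M[k]_n) (f : m.-tuple {mpoly k[n]}).
Hypothesis f_splitting : graded_splitting G rho f.

Let generated F := exists a, F = a \mPo f.

Let generated_sum (T : eqType) (l : seq T) (F : T -> {mpoly k[n]}) :
  (forall i, i \in l -> generated (F i)) -> generated (\sum_(i <- l) F i).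
Proof.
elim: l => [_|i l IH H]; first by exists 0; rewrite big_nil comp_mpoly0.
have [a Fa] := H i (mem_head _ _).
have [|b Fb] := IH; first by move=> j jl; apply: H; rewrite inE jl orbT.
by exists (a + b); rewrite big_cons comp_mpolyD Fa Fb.
Qed.

Let generatedM F H : generated F -> generated H -> generated (F * H).
Proof. by move=> [a ->] [b ->]; exists (a * b); rewrite rmorphM. Qed.

Let invariant_pihomog d F : is_invariant G rho F -> is_invariant G rho (pihomog mdeg d F).
Proof. by move=> FG g Gg; rewrite -pihomog_msubst FG. Qed.

(** Graded Nakayama: modulo products of two invariants without constant term, an invariant is a
    combination of the [f_i], and the homogeneous factors of such products have smaller degree. *)
Lemma invariants_generated F : is_invariant G rho F -> exists a, F = a \mPo f.
Proof.
have key d H : is_invariant G rho H -> H \is d.-homog -> generated H.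
  have [D] := ubnP d; elim: D => // D IH in d H *; rewrite ltnS => dD HG Hd.
  case: d => [|d] in dD Hd *.
    by exists (H@_0)%:MP; rewrite comp_mpolyC; exact: homog0_const.
  have [c [s [sP sE]]] := splitting_span f_splitting (conj HG (homog_coef0 Hd)).
  (* Neither the combination nor the products supplied by the splitting need be homogeneous; only
     their parts of degree [d.+1] are kept. *)
  have -> : H = \sum_i c i *: pihomog mdeg d.+1 (tnth f i) +
      \sum_(ab <- s) pihomog mdeg d.+1 (ab.1 * ab.2).
    rewrite -[LHS](pihomog_dE Hd) -[in LHS](subrK (\sum_i c i *: tnth f i) H) sE.
    rewrite addrC pihomogD !raddf_sum /=; congr (_ + _).
    by apply: eq_bigr => i _; rewrite linearZ.
  have [a1 E1] : generated (\sum_i c i *: pihomog mdeg d.+1 (tnth f i)).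
    apply: generated_sum => i _.
    have [e fe] := splitting_graded f_splitting i.
    have [<-|ed] := eqVneq e d.+1.
      rewrite pihomog_dE//; exists (c i *: 'X_i).
      by rewrite comp_mpolyZ comp_mpolyXU -tnth_nth.
    by exists 0; rewrite (pihomog_ne0 ed fe) scaler0 comp_mpoly0.
  have [a2 E2] : generated (\sum_(ab <- s) pihomog mdeg d.+1 (ab.1 * ab.2)).
    apply: generated_sum => -[a b] /sP /= [[aG a0] [bG b0]].
    rewrite (@pihomog_partitionE _ _ mdeg _ a (leqnn _)).
    rewrite (@pihomog_partitionE _ _ mdeg _ b (leqnn _)) mulr_suml raddf_sum /=.
    apply: generated_sum => i _; rewrite mulr_sumr raddf_sum /=.
    apply: generated_sum => j _.
    have hij := dhomogM (pihomogP mdeg i a) (pihomogP mdeg j b).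
    (* Hence the terms with [i = 0] or [j = 0] vanish, and in the others [i + j = d.+1] makes both
       degrees smaller than [d.+1]. *)
    have z (F' : {mpoly k[n]}) : F'@_0 = 0 -> pihomog mdeg 0 F' = 0.
      move=> F0; rewrite (homog0_const (pihomogP mdeg 0 F')) -[RHS]mpolyC0 -F0.
      congr _%:MP.
      rewrite [in RHS](@pihomog_partitionE _ _ mdeg (msize F').+1 F') ?leqnSn//.
      rewrite big_ord_recl mcoeffD [X in _ = _ + X](_ : _ = 0) ?addr0//.
      elim/big_rec: _ => [|l q _ q0]; first by rewrite mcoeff0.
      by rewrite mcoeffD q0 addr0; exact: homog_coef0 (pihomogP mdeg _ _).
    have [ij|ne] := eqVneq (i + j)%N d.+1; last first.
      by exists 0; rewrite (pihomog_ne0 ne hij) comp_mpoly0.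
    rewrite pihomog_dE; last by rewrite -ij.
    have [i0|i0] := posnP i.
      by exists 0; rewrite i0 z// mul0r comp_mpoly0.
    have [j0|j0] := posnP j.
      by exists 0; rewrite j0 z// mulr0 comp_mpoly0.
    apply: generatedM.
      apply: (IH i); rewrite ?pihomogP//; last exact: invariant_pihomog.
      by apply: leq_trans dD; rewrite -ij -addn1 leq_add2l.
    apply: (IH j); rewrite ?pihomogP//; last exact: invariant_pihomog.
    by apply: leq_trans dD; rewrite -ij -add1n leq_add2r.
  by exists (a1 + a2); rewrite comp_mpolyD E1 E2.
move=> FG; rewrite (@pihomog_partitionE _ _ mdeg _ F (leqnn _)).
apply: generated_sum => i _; apply: (key i); last exact: pihomogP.
exact: invariant_pihomog.
Qed.

End Splitting.

Section Reynolds.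
Variables (k : fieldType) (gT : finGroupType) (W G : {group gT}) (n : nat).
Variables (rho : mx_representation k W n).
Hypothesis GW : G \subset W.

(** Not divided by [#|G|], so that it makes sense over any field; the division is made only over
    [K], of characteristic 0. *)
Definition reynolds h := \sum_(g in G) msubst (rho g) h.

Lemma reynolds_invariant h : is_invariant G rho (reynolds h).
Proof.
move=> g Gg; rewrite /reynolds msubst_sum.
rewrite [RHS](reindex_inj (mulgI g)) /=; apply: eq_big => [x|x Gx].
  by rewrite groupMl.
by rewrite msubst_msubst repr_mxM// (subsetP GW).
Qed.

Lemma reynoldsM F h : is_invariant G rho F -> reynolds (F * h) = F * reynolds h.
Proof.
by move=> FG; rewrite /reynolds mulr_sumr; apply: eq_bigr => g Gg; rewrite msubstM FG.
Qed.

Lemma reynolds_id F : is_invariant G rho F -> reynolds F = #|G|%:R *: F.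
Proof.
move=> FG; rewrite /reynolds (eq_bigr (fun _ => F)) ?sumr_const// ?scaler_nat//.
Qed.

Lemma reynoldsD h h' : reynolds (h + h') = reynolds h + reynolds h'.
Proof. by rewrite /reynolds -big_split; apply: eq_bigr => g _; rewrite msubstD. Qed.

Lemma reynoldsZ c h : reynolds (c *: h) = c *: reynolds h.
Proof. by rewrite /reynolds scaler_sumr; apply: eq_bigr => g _; rewrite msubstZ. Qed.

Lemma reynolds_eval h x : point_eval x (reynolds h) = \sum_(g in G) point_eval (x *m rho g) h.
Proof. by rewrite point_eval_sum; apply: eq_bigr => g _; rewrite point_eval_msubst. Qed.

End Reynolds.

Section BaseChange.
Variables (k : fieldType) (K : numFieldType) (phi : {rmorphism k -> K}).
Variables (gT : finGroupType) (W G : {group gT}) (n m : nat).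
Variables (rho : mx_representation k W n) (f : m.-tuple {mpoly k[n]}).
Hypothesis GW : G \subset W.
Hypothesis gen : forall F, is_invariant G rho F -> exists a, F = a \mPo f.

Local Notation rhoK := (map_repr phi rho).
Local Notation fK := (map_mpolys phi f).

Lemma map_mpoly_comp (a : {mpoly k[m]}) : map_mpoly phi (a \mPo f) = map_mpoly phi a \mPo fK.
Proof.
elim/mpoly_ring_ind: a => [c|i|p q IHp IHq|p q IHp IHq].
- by rewrite comp_mpolyC !map_mpolyC comp_mpolyC.
- by rewrite comp_mpolyXU map_mpolyX comp_mpolyXU -!tnth_nth tnth_mktuple.
- by rewrite comp_mpolyD !rmorphD /= IHp IHq.
- by rewrite !rmorphM /= IHp IHq.
Qed.

Lemma point_eval_map l (x : 'rV[k]_l) p :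
  point_eval (map_mx phi x) (map_mpoly phi p) = phi (point_eval x p).
Proof.
elim/mpoly_ring_ind: p => [c|i|p q IHp IHq|p q IHp IHq].
- by rewrite map_mpolyC /point_eval !mevalC.
- by rewrite map_mpolyX /point_eval !mevalXU mxE.
- by rewrite rmorphD /= !point_evalD IHp IHq rmorphD.
- by rewrite rmorphM /= !point_evalM IHp IHq rmorphM.
Qed.

Lemma mpoly_fun_map x : mpoly_fun fK (map_mx phi x) = map_mx phi (mpoly_fun f x).
Proof.
by apply/rowP => i; rewrite !mxE tnth_mktuple -/(point_eval _ _) point_eval_map.
Qed.

Lemma map_mpoly_mul l (p q : {mpoly k[l]}) :
  map_mpoly phi (p * q) = map_mpoly phi p * map_mpoly phi q.
Proof. exact: rmorphM. Qed.

Lemma map_linear_form l (u : 'cV[k]_l) :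
  map_mpoly phi (linear_form u) = linear_form (map_mx phi u).
Proof.
rewrite /linear_form raddf_sum /=; apply: eq_bigr => i _.
by rewrite map_mpolyZ map_mpolyX mxE.
Qed.

(* Averages of monomials span the invariants over K. *)
Lemma monomial_average mm :
  exists a, reynolds G rhoK 'X_[mm] = map_mpoly phi a \mPo fK.
Proof.
have [a aE] := gen (reynolds_invariant rho GW 'X_[mm]).
exists a; rewrite -map_mpoly_comp -aE /reynolds raddf_sum /=; apply: eq_bigr => g _.
by rewrite map_msubst map_mpolyX.
Qed.

(** The average is [K]-linear, and monomials are defined over [k], where generation by [f] is
    known. *)
Lemma reynolds_generated h : exists a, reynolds G rhoK h = a \mPo fK.
Proof.
rewrite (mpolyE h); elim: (msupp h) => [|mm l [a aE]].
  by exists 0; rewrite big_nil comp_mpoly0 /reynolds big1// => g _; rewrite /msubst comp_mpoly0.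
have [b bE] := monomial_average mm.
exists (h@_mm *: map_mpoly phi b + a).
by rewrite big_cons reynoldsD reynoldsZ bE aE comp_mpolyD comp_mpolyZ.
Qed.

Lemma invariants_generated_map F : is_invariant G rhoK F -> exists a, F = a \mPo fK.
Proof.
move=> FG; have [a aE] := reynolds_generated F.
exists (#|G|%:R^-1 *: a); rewrite comp_mpolyZ -aE reynolds_id// scalerA mulVf ?scale1r//.
by rewrite pnatr_eq0 -lt0n cardG_gt0.
Qed.

(** Average a polynomial that is 1 at [x] and 0 at the other points of the two orbits. If the orbits
    were distinct, the average would vanish at [x'] and be the order of the stabiliser of [x] at
    [x]; but it is a polynomial in [fK]. *)
Lemma orbit_separation x x' : mpoly_fun fK x = mpoly_fun fK x' ->
  exists2 g, g \in G & x' = x *m rhoK g.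
Proof.
move=> xx'; have [/exists_inP[g Gg /eqP ->]|nex] := boolP [exists g in G, x' == x *m rhoK g].
  by exists g.
have [h [h1 h0]] := interpolation
  ([seq x *m rhoK g | g <- enum G] ++ [seq x' *m rhoK g | g <- enum G]) x.
have [a aE] := reynolds_generated h.
have : point_eval x (reynolds G rhoK h) = point_eval x' (reynolds G rhoK h).
  by rewrite aE !point_eval_comp xx'.
rewrite !reynolds_eval [RHS]big1 => [|g Gg]; last first.
  apply: h0.
    by rewrite mem_cat; apply/orP; right; apply/mapP; exists g; rewrite ?mem_enum.
  apply: contra nex => /eqP E; apply/exists_inP; exists g^-1%g; rewrite ?groupV//.
  by rewrite -E repr_mxK// (subsetP GW).
rewrite (bigID (fun g => x *m rhoK g == x)) /= [X in _ + X]big1 => [|g /andP[Gg ne]]; last first.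
  apply: h0 => //; rewrite mem_cat; apply/orP; left.
  by apply/mapP; exists g; rewrite ?mem_enum.
rewrite addr0 (eq_bigr (fun _ => 1)) => [|g /andP[_ /eqP ->]//].
rewrite sumr_const => /eqP; rewrite pnatr_eq0 => /eqP/card0_eq/(_ 1%g).
by rewrite unfold_in group1 repr_mx1 mulmx1 eqxx.
Qed.

End BaseChange.

End InvariantRing.

(** * Invariants that change sign under a reflection, near a point of its wall *)

Module WallGeometry.
Import mpoly Invariants InvariantRing.

Section RingIdentities.
Variable A : comPzRingType.
Implicit Types a b c d e : A.

(** Used with [c = s a] and [d = s b]. Every term is a difference times something that still
    contains [b] or [d], so it vanishes where both of these do. *)
Lemma twisted_leibniz a b c d :
  a * (b * b) - c * (d * d) = (a - c) * (b * b) + c * ((b - d) * b) + c * (d * (b - d)).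
Proof. by ring. Qed.

Lemma twisted_factor a b c d e q :
  a * b * (c * c) + d * (a * q * c) + d * (e * (a * q)) =
  a * (b * (c * c) + d * q * c + d * e * q).
Proof. by ring. Qed.

Lemma mul_exchange a b c d : a * b * (c * d) = a * d * (c * b).
Proof. by ring. Qed.

End RingIdentities.

Section WallFunctions.
Variables (k : numFieldType) (gT : finGroupType) (W G : {group gT}) (n : nat).
Variables (rho : mx_representation k W n) (s : gT) (u : 'cV[k]_n) (v : 'rV[k]_n).
Hypotheses (GW : (G <| W)%g) (Ws : s \in W) (ss : (s * s = 1)%g).
Hypotheses (su : rho s = 1%:M + u *m v) (vu : v *m u = (-2)%:M).

Local Notation alpha := (linear_form u).
Local Notation invariant := (is_invariant G rho).

Let GsubW : G \subset W := normal_sub GW.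

Let repr_M g h : g \in W -> h \in W -> rho (g * h)%g = rho g *m rho h.
Proof. exact: repr_mxM. Qed.

Lemma invariant_conj F : invariant F -> invariant (msubst (rho s) F).
Proof.
move=> FG g Gg; have Wg := subsetP GsubW _ Gg.
have Ggs : (g ^ s)%g \in G by rewrite memJ_norm// (subsetP (normal_norm GW)).
rewrite msubst_msubst -(repr_M Wg Ws) conjgC (repr_M Ws (subsetP GsubW _ Ggs)).
by rewrite -msubst_msubst FG.
Qed.

Lemma alpha_neq0 : alpha != 0.
Proof.
apply/eqP => /linear_form_eq0 u0; move: vu; rewrite u0 mulmx0 => /matrixP/(_ 0 0)/eqP.
by rewrite !mxE eqxx mulr1n eq_sym oppr_eq0 pnatr_eq0.
Qed.

Lemma msubst_alpha : msubst (rho s) alpha = - alpha.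
Proof.
rewrite msubst_linear su mulmxDl mul1mx -mulmxA vu mul_mx_scalar.
rewrite -{1}[u]scale1r -scalerDl (_ : 1 + -2 = -1); last by ring.
rewrite /linear_form -sumrN; apply: eq_bigr => i _.
by rewrite mxE mulN1r scaleNr.
Qed.

Lemma msubst_invol F : msubst (rho s) (msubst (rho s) F) = F.
Proof. by rewrite msubst_msubst -repr_M// ss repr_mx1 msubst1. Qed.

(** Here [F - s F = 2 F], and the left side is a multiple of [alpha] by the divided difference. *)
Lemma anti_divisible F : msubst (rho s) F = - F -> exists F1, F = alpha * F1.
Proof.
move=> sF; have [Q QE] := divided_difference u v F.
exists (2^-1 *: Q); move: QE; rewrite -su sF opprK -scalerAr => <-.
by rewrite -mulr2n -scaler_nat scalerA mulVf ?scale1r// pnatr_eq0.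
Qed.

Variable x : 'rV[k]_n.
Hypotheses (xu : x *m u = 0) (xG : forall g, g \in G -> x *m rho g = x -> g = 1%g).

Lemma wall_fixed : x *m rho s = x.
Proof. by rewrite su mulmxDr mulmx1 mulmxA xu mul0mx addr0. Qed.

Lemma alpha_wall : point_eval x alpha = 0.
Proof. by rewrite point_eval_linear xu mxE. Qed.

Lemma orbit_bump : exists h, point_eval x h = 1 /\
  forall g, g \in G -> g != 1%g -> point_eval (x *m rho g) h = 0.
Proof.
have [h [hx h0]] := interpolation [seq x *m rho g | g <- enum G] x.
exists h; split=> // g Gg g1; apply: h0; last by apply: contra g1 => /eqP /(xG Gg) ->.
by apply/mapP; exists g; rewrite ?mem_enum.
Qed.

(* The Reynolds average of alpha h^2 agrees with alpha to first order at x, since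
   h^2 vanishes to second order at the other points of the G-orbit of x. *)
Lemma anti_invariant_exists : exists E E1,
  [/\ invariant E, msubst (rho s) E = - E, E = alpha * E1 & point_eval x E1 != 0].
Proof.
have [h [hx h0]] := orbit_bump.
pose E0 := reynolds G rho (alpha * (h * h)).
(* [Q g] is the divided difference along [s] of the [g]-th term of the average. For [g] in [G] other
   than 1 it vanishes at [x], since each term of the Leibniz rule keeps a factor whose value at [x]
   is that of [h] at [x g]. *)
have [g|Q QE] := @fin_all_exists _ (fun _ => {mpoly k[n]}) (fun g Q =>
    (msubst (rho g) (alpha * (h * h)) - msubst (rho s) (msubst (rho g) (alpha * (h * h)))
      = alpha * Q) /\
    (g \in G -> point_eval x Q = if g == 1%g then 2 else 0)).
  (* The choice of [Q] runs over the whole group type; outside [G] only the factorisation is asked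
     for. *)
  have [Gg|nGg] := boolP (g \in G); last first.
    have [Q QE] := divided_difference u v (msubst (rho g) (alpha * (h * h))).
    by exists Q; rewrite -su in QE.
  have [q1 q1E] := divided_difference u v (msubst (rho g) alpha).
  have [q2 q2E] := divided_difference u v (msubst (rho g) h).
  rewrite -su in q1E q2E; rewrite !msubstM.
  set L := msubst (rho g) alpha in q1E *; set K := msubst (rho g) h in q2E *.
  exists (q1 * (K * K) + msubst (rho s) L * q2 * K
    + msubst (rho s) L * msubst (rho s) K * q2); split.
    by rewrite twisted_leibniz q1E q2E twisted_factor.
  have evs q : point_eval x (msubst (rho s) q) = point_eval x q.
    by rewrite point_eval_msubst wall_fixed.
  have evK : point_eval x K = point_eval (x *m rho g) h by exact: point_eval_msubst.
  have evL : point_eval x L = point_eval (x *m rho g) alpha by exact: point_eval_msubst.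
  move=> _; rewrite 2!point_evalD 6!point_evalM (evs L) (evs K) evK evL.
  have [g1|g1] := eqVneq g 1%g; last by rewrite h0// !(mulr0, mul0r, addr0).
  (* For [g = 1] the difference is [alpha - s alpha = 2 alpha]; the other two terms carry [alpha],
     which is 0 at [x]. *)
  have q1x : q1 = 2%:MP.
    apply: (mulfI alpha_neq0); rewrite -q1E /L g1 repr_mx1 msubst1 msubst_alpha opprK.
    by rewrite -mulr2n mulrC mul_mpolyC scaler_nat.
  have -> : point_eval x q1 = 2 by rewrite q1x /point_eval mevalC.
  by rewrite g1 repr_mx1 mulmx1 hx alpha_wall !mulr1 !mul0r !addr0.
pose E1 := \sum_(g in G) Q g.
have EE : E0 - msubst (rho s) E0 = alpha * E1.
  rewrite /E0 /reynolds msubst_sum -sumrB mulr_sumr; apply: eq_bigr => g _.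
  by have [] := QE g.
have E0G : invariant E0 by exact: reynolds_invariant.
have sE0G := invariant_conj E0G.
exists (E0 - msubst (rho s) E0), E1; split=> //.
- by move=> g Gg; rewrite msubstB (E0G g Gg) (sE0G g Gg).
- by rewrite msubstB msubst_invol opprB.
rewrite point_eval_sum (bigD1 1%g)//= big1 ?addr0.
  by have [_ ->] := QE 1%g; rewrite ?eqxx ?pnatr_eq0.
by move=> g /andP[Gg g1]; have [_ ->] := QE g; rewrite ?(negbTE g1).
Qed.

(** The ratio [F / E = F1 / E1] is [G]-invariant and regular at [x]. The averages of [h F1] and
    [h E1] write it with invariant numerator and denominator, the denominator [B] being the same for
    all [F]. So [E] generates the anti-invariants near [x]. *)
Lemma anti_invariant_ratio E E1 : invariant E -> E = alpha * E1 -> point_eval x E1 != 0 ->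
  exists B, [/\ invariant B, point_eval x B != 0 & forall F, invariant F ->
    msubst (rho s) F = - F -> exists C, invariant C /\ F * B = E * C].
Proof.
move=> EG EE E1x; have [h [hx h0]] := orbit_bump.
exists (reynolds G rho (h * E1)); split; first exact: reynolds_invariant.
  rewrite reynolds_eval (bigD1 1%g)//= big1 ?addr0.
    by rewrite repr_mx1 mulmx1 point_evalM hx mul1r.
  by move=> g /andP[Gg g1]; rewrite point_evalM h0// mul0r.
move=> F FG /anti_divisible[F1 FE].
exists (reynolds G rho (h * F1)); split; first exact: reynolds_invariant.
by rewrite -!reynoldsM// EE FE mul_exchange.
Qed.

End WallFunctions.

(** * Differentials of relations and Nakayama's lemma *)

Section Conormal.
Variables (K : numFieldType) (n m : nat) (f : m.-tuple {mpoly K[n]}).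
Local Notation I := (relation_ideal f).

(** Restriction to the line through [y] in direction [v], as a polynomial in the parameter. Its
    linear coefficient is the directional derivative, and the Leibniz rule is the product rule for
    coefficients. *)
Definition line_restr (y v : 'rV[K]_m) : {mpoly K[m]} -> {poly K} :=
  mmap (@polyC K) (fun j => (y 0 j)%:P + v 0 j *: 'X).

Definition differential y v a : K := (line_restr y v a)`_1.

Lemma line_restrM y v a b : line_restr y v (a * b) = line_restr y v a * line_restr y v b.
Proof. exact: rmorphM. Qed.

Lemma line_restrD y v a b : line_restr y v (a + b) = line_restr y v a + line_restr y v b.
Proof. exact: mmapD. Qed.

Lemma line_restrC y v c : line_restr y v c%:MP = c%:P.
Proof. exact: mmapC. Qed.

Lemma line_restrX y v i : line_restr y v 'X_i = (y 0 i)%:P + v 0 i *: 'X.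
Proof. by rewrite /line_restr mmapX mmap1U. Qed.

Lemma line_restr0 y v a : (line_restr y v a)`_0 = point_eval y a.
Proof.
elim/mpoly_ring_ind: a => [c|i|a b IHa IHb|a b IHa IHb].
- by rewrite line_restrC coefC /point_eval mevalC.
- by rewrite line_restrX coefD coefC coefZ coefX mulr0 addr0 /point_eval mevalXU.
- by rewrite line_restrD coefD IHa IHb point_evalD.
- by rewrite line_restrM coefM big_ord1 IHa IHb point_evalM.
Qed.

Lemma line_restr_msubst (M : 'M[K]_m) y v a :
  line_restr y v (msubst M a) = line_restr (y *m M) (v *m M) a.
Proof.
elim/mpoly_ring_ind: a => [c|j|a b IHa IHb|a b IHa IHb].
- by rewrite msubstC !line_restrC.
- rewrite msubstX line_restrX /line_restr raddf_sum !mxE /= rmorph_sum /= scaler_suml.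
  rewrite -big_split; apply: eq_bigr => i _ /=.
  rewrite mmapZ mmapX mmap1U mulrDr -polyCM [M i j * _]mulrC; congr (_ + _).
  by rewrite mul_polyC scalerA mulrC.
- by rewrite msubstD !line_restrD IHa IHb.
- by rewrite msubstM !line_restrM IHa IHb.
Qed.

Lemma differentialM y v a b :
  differential y v (a * b) = point_eval y a * differential y v b + differential y v a * point_eval y b.
Proof.
rewrite /differential line_restrM coefM 2!big_ord_recr big_ord0 /= add0r.
by rewrite !line_restr0.
Qed.

Lemma differentialD y v a b : differential y v (a + b) = differential y v a + differential y v b.
Proof. by rewrite /differential line_restrD coefD. Qed.

Lemma differentialB y v a b : differential y v (a - b) = differential y v a - differential y v b.
Proof. by rewrite /differential /line_restr mmapB coefB. Qed.

Lemma differential0 y v : differential y v 0 = 0.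
Proof. by rewrite /differential -mpolyC0 line_restrC coefC. Qed.

Lemma differential_sum y v (T : Type) (l : seq T) (F : T -> {mpoly K[m]}) :
  differential y v (\sum_(i <- l) F i) = \sum_(i <- l) differential y v (F i).
Proof.
elim: l => [|i l IH]; first by rewrite !big_nil differential0.
by rewrite !big_cons differentialD IH.
Qed.

Lemma differentialX y v i : differential y v 'X_i = v 0 i.
Proof. by rewrite /differential line_restrX coefD coefC coefZ coefX mulr1 add0r. Qed.

Lemma differential_msubst (M : 'M[K]_m) y v a :
  differential y v (msubst M a) = differential (y *m M) (v *m M) a.
Proof. by rewrite /differential line_restr_msubst. Qed.

Lemma plus_mul_generators d (r : d.-tuple {mpoly K[m]}) a :
  generates I r -> plus_mul I a ->
  exists e : 'I_d -> {mpoly K[m]}, (forall l, (e l)@_0 = 0) /\ a = \sum_l e l * tnth r l.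
Proof.
move=> rI [l [lP ->]]; elim: l lP => [_|[b c] l IH lP].
  exists (fun _ => 0); split=> [i|]; first exact: mcoeff0.
  by rewrite big_nil big1// => i _; rewrite mul0r.
have [|e [e0 eE]] := IH; first by move=> bc bcl; apply: lP; rewrite inE bcl orbT.
have [/= b0 /rI[q cE]] := lP _ (mem_head _ _).
exists (fun i => b * q i + e i); split=> [i|].
  by rewrite mcoeffD e0 addr0 rmorphM /= b0 mul0r.
rewrite big_cons eE /= cE mulr_sumr -big_split; apply: eq_bigr => i _ /=.
by rewrite mulrDl mulrA.
Qed.

(* Nakayama: I is generated by M-invariant elements where delta does not vanish. *)
Lemma conormal_invariant d (r : d.-tuple {mpoly K[m]}) (M : 'M[K]_m) :
  generates I r -> M *m M = 1%:M -> (forall a, I a -> I (msubst M a)) ->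
  (forall a, I a -> plus_mul I (msubst M a - a)) ->
  exists delta : {mpoly K[m]}, delta@_0 != 0 /\
    forall y v a, y *m M = y -> (forall b, I b -> point_eval y b = 0) ->
      point_eval y delta != 0 -> I a -> differential y v a = differential y (v *m M) a.
Proof.
move=> rI MM MI Mtriv.
have Ir j : I (tnth r j).
  apply/rI; exists (fun i => (i == j)%:R); rewrite (bigD1 j)//= eqxx mul1r big1 ?addr0//.
  by move=> i /negbTE ->; rewrite mul0r.
have [j|e eE] := @fin_all_exists _ (fun _ => 'I_d -> {mpoly K[m]}) (fun j e =>
    (forall l, (e l)@_0 = 0) /\ msubst M (tnth r j) - tnth r j = \sum_l e l * tnth r l).
  by apply: plus_mul_generators => //; exact: Mtriv.
(* Since [M r_j = r_j + sum_l e_jl r_l], the symmetrised generators [r' = r + M r] are [N r] with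
   [N = 2 + e]. The entries of [e] have no constant term, so that of [det N] is [2 ^ d]. *)
pose N := \matrix_(j, l) ((j == l)%:R *+ 2 + e j l).
pose r' j := tnth r j + msubst M (tnth r j).
have NE j : \sum_l N j l * tnth r l = r' j.
  under eq_bigr do rewrite mxE mulrDl.
  rewrite big_split /= -(eE j).2 (bigD1 j)//= eqxx big1 ?addr0; last first.
    by move=> i /negbTE ij; rewrite eq_sym ij mul0rn mul0r.
  by rewrite /r' mulrnAl mul1r mulr2n addrACA subrr addr0.
(* Cramer's rule: [det N] times each generator is a combination of the [M]-invariant relations
   [r']. *)
have adjE j : \det N * tnth r j = \sum_l (\adj N) j l * r' l.
  under eq_bigr do rewrite -NE mulr_sumr.
  rewrite exchange_big /=; under eq_bigr => l _.
    under eq_bigr do rewrite mulrA; rewrite -mulr_suml.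
    rewrite (_ : \sum_i _ = (\adj N *m N) j l); last by rewrite mxE.
    rewrite mul_adj_mx mxE; over.
  rewrite (bigD1 j)//= eqxx mulr1n big1 ?addr0// => l /negbTE lj.
  by rewrite eq_sym lj mulr0n mul0r.
exists (\det N); split.
  have -> : (\det N)@_0 = \det (map_mx (mcoeff 0%MM) N) by rewrite det_map_mx.
  rewrite (_ : map_mx _ N = 2%:M) ?det_scalar ?expf_neq0 ?pnatr_eq0//.
  apply/matrixP => i j; rewrite !mxE mcoeffD (eE i).1 addr0 mcoeffMn.
  by case: (i == j); rewrite ?mcoeff1 ?mcoeff0 ?eqxx ?mul0rn.
(* At a zero [y] of [I], the differential of [c b] is [c(y)] times that of [b], so agreement along
   [v] and [v M] passes to multiples. *)
move=> y v a yM yI dy; have P b : I b -> forall c, differential y v b = differential y (v *m M) b ->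
    differential y v (c * b) = differential y (v *m M) (c * b).
  by move=> Ib c E; rewrite !differentialM E (yI _ Ib) !mulr0.
have Pr' l : differential y v (r' l) = differential y (v *m M) (r' l).
  have : msubst M (r' l) = r' l.
    by rewrite /r' msubstD msubst_msubst MM msubst1 addrC.
  by move=> {1}<-; rewrite differential_msubst yM.
have Ir' l : I (r' l).
  rewrite /relation_ideal comp_mpolyD.
  by have := Ir l; have := MI _ (Ir l); rewrite /relation_ideal => -> ->; rewrite addr0.
have Pr j : differential y v (tnth r j) = differential y (v *m M) (tnth r j).
  apply: (mulfI dy).
  have : differential y v (\det N * tnth r j) = differential y (v *m M) (\det N * tnth r j).
    by rewrite adjE !differential_sum; apply: eq_bigr => l _; exact: P.
  by rewrite !differentialM (yI _ (Ir j)) !mulr0 !addr0.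
move=> /rI[c ->]; rewrite !differential_sum; apply: eq_bigr => j _; exact: P.
Qed.

End Conormal.

End WallGeometry.

(** * The image of a reflection outside [G] acts on [V] as a reflection *)

Module QuotientReflections.
Import mpoly Invariants InvariantRing WallGeometry.

Lemma line_restr_horner (K : numFieldType) m (y v : 'rV[K]_m) a t :
  (line_restr y v a).[t] = point_eval (y + t *: v) a.
Proof.
elim/mpoly_ring_ind: a => [c|i|a b IHa IHb|a b IHa IHb].
- by rewrite line_restrC hornerC /point_eval mevalC.
- by rewrite line_restrX hornerD hornerC hornerZ hornerX /point_eval mevalXU !mxE mulrC.
- by rewrite line_restrD hornerD IHa IHb point_evalD.
- by rewrite line_restrM hornerM IHa IHb point_evalM.
Qed.

(** Along the line through [x], [a] becomes a nonzero polynomial [P] in one variable, so the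
    [size P] numbers [1, ..., size P] cannot all be roots. *)
Lemma nonzero_on_line (K : numFieldType) m (x : 'rV[K]_m) (a : {mpoly K[m]}) :
  a@_0 != 0 -> exists i : nat, point_eval (i.+1%:R *: x) a != 0.
Proof.
move=> a0; pose P := line_restr 0 x a.
have PE t : P.[t] = point_eval (t *: x) a by rewrite line_restr_horner add0r.
have P0 : P != 0.
  apply: contra_neq a0 => P0.
  by rewrite -point_eval_origin -(scale0r x) -PE P0 horner0.
have [/hasP[i _ Pi]|/hasPn H] := boolP (has (fun i : nat => ~~ root P i.+1%:R) (iota 0 (size P))).
  by exists i; move: Pi; rewrite /root PE.
have : (size [seq (i.+1%:R : K) | i <- iota 0 (size P)] < size P)%N.
  apply: max_poly_roots => //.
    by apply/allP => _ /mapP[i /H + ->]; rewrite negbK.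
  by rewrite map_inj_uniq ?iota_uniq// => i j /eqP; rewrite eqr_nat => /eqP[].
by rewrite size_map size_iota ltnn.
Qed.

Lemma splitting_coef0 (k K : fieldType) (phi : {rmorphism k -> K}) (gT : finGroupType)
    (G : {group gT}) n m (rho : gT -> 'M[k]_n) (f : m.-tuple {mpoly k[n]}) i :
  graded_splitting G rho f -> (tnth (map_mpolys phi f) i)@_0 = 0.
Proof.
move=> H; have [_ f0] := splitting_inv_plus H i.
by rewrite tnth_mktuple mcoeff_map_mpoly f0; exact: rmorph0.
Qed.

Section Quotient.
Variables (K : numFieldType) (gT : finGroupType) (W G : {group gT}) (n m : nat).
Variables (rho : mx_representation K W n) (f : m.-tuple {mpoly K[n]}).
Variables (rhoq : mx_representation K (W / G)%G m).
Hypothesis GW : (G <| W)%g.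
Hypothesis act : induced_action W rho rhoq f.
Hypothesis gen : forall F, is_invariant G rho F -> exists a, F = a \mPo f.
Hypothesis f0 : forall i, (tnth f i)@_0 = 0.

Lemma induced_comp w a : w \in W ->
  msubst (rhoq (coset G w)) a \mPo f = msubst (rho w) (a \mPo f).
Proof.
move=> Ww; elim/mpoly_ring_ind: a => [c|i|a b IHa IHb|a b IHa IHb].
- by rewrite msubstC !comp_mpolyC msubstC.
- rewrite msubstX comp_mpolyXU -tnth_nth act// raddf_sum /=; apply: eq_bigr => j _.
  by rewrite comp_mpolyZ comp_mpolyXU -tnth_nth.
- by rewrite msubstD !comp_mpolyD msubstD IHa IHb.
- by rewrite msubstM !rmorphM /= msubstM IHa IHb.
Qed.

Lemma comp_origin a : (a \mPo f)@_0 = a@_0.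
Proof.
rewrite -!point_eval_origin point_eval_comp; congr point_eval.
by apply/rowP => i; rewrite mxE -/(point_eval 0 _) point_eval_origin f0 mxE.
Qed.

Variables (s : gT) (u : 'cV[K]_n) (v : 'rV[K]_n).
Hypotheses (Ws : s \in W) (ss : (s * s = 1)%g).
Hypotheses (su : rho s = 1%:M + u *m v) (vu : v *m u = (-2)%:M).
Variable x : 'rV[K]_n.
Hypotheses (xu : x *m u = 0) (xG : forall g, g \in G -> x *m rho g = x -> g = 1%g).

Local Notation M := (rhoq (coset G s)).

Let MM : M *m M = 1%:M.
Proof.
rewrite -repr_mxM ?mem_quotient// -morphM ?ss ?morph1 ?repr_mx1//.
  exact: (subsetP (normal_norm GW)).
exact: (subsetP (normal_norm GW)).
Qed.

(** Each [X_j - M X_j] pulls back to an anti-invariant, so modulo [I] it is [e c_j / b].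
    Differentiating this at a fixed point [y] shows that every vector of the (-1)-eigenspace [V^-]
    is a multiple of the vector of the [c_j(y)]. *)
Lemma quotient_reflection_rank d (r : d.-tuple {mpoly K[m]}) :
  generates (relation_ideal f) r ->
  (forall a, relation_ideal f a -> plus_mul (relation_ideal f) (msubst M a - a)) ->
  (\rank (M - 1%:M)%R <= 1)%N.
Proof.
move=> rI Mtriv.
have MI a : relation_ideal f a -> relation_ideal f (msubst M a).
  by rewrite /relation_ideal => fa; rewrite induced_comp// fa /msubst comp_mpoly0.
have [delta [delta0 conormal]] := conormal_invariant rI MM MI Mtriv.
have delta_f0 : (delta \mPo f)@_0 != 0 by rewrite comp_origin.
(* [x] is scaled to a point where [delta] does not vanish; it stays on the wall and its stabiliser
   in [G] stays trivial. *)
case: (nonzero_on_line x delta_f0) => i.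
set t : K := i.+1%:R => delta_t.
have t0 : t != 0 by rewrite pnatr_eq0.
pose x' := t *: x.
have x'u : x' *m u = 0 by rewrite -scalemxAl xu scaler0.
have x'G g : g \in G -> x' *m rho g = x' -> g = 1%g.
  by move=> Gg; rewrite -scalemxAl => /(scalerI t0); exact: xG.
have x's : x' *m rho s = x' := wall_fixed su x'u.
pose y := mpoly_fun f x'.
have yM : y *m M = y by rewrite -(induced_actionE _ act)// x's.
have yI b : relation_ideal f b -> point_eval y b = 0.
  by move=> fb; rewrite -point_eval_comp fb point_eval0.
have y_delta : point_eval y delta != 0 by rewrite -point_eval_comp.
have [E [E1 [EG sE EE E1x]]] := anti_invariant_exists GW Ws ss su vu x'u x'G.
have [B [BG Bx ratio]] := anti_invariant_ratio GW su x'G EG EE E1x.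
have [e eE] := gen EG; have [b bE] := gen BG.
pose F j := tnth f j - msubst (rho s) (tnth f j).
have fG j : is_invariant G rho (tnth f j).
  move=> g Gg; have Wg := subsetP (normal_sub GW) _ Gg.
  rewrite act// (_ : coset G g = 1%g); last exact: coset_id.
  rewrite repr_mx1 (bigD1 j)//= mxE eqxx scale1r big1 ?addr0// => l lj.
  by rewrite mxE (negbTE lj) scale0r.
have FG j : is_invariant G rho (F j).
  have sfG := invariant_conj GW Ws (fG j).
  by move=> g Gg; rewrite msubstB (fG j g Gg) (sfG g Gg).
have sF j : msubst (rho s) (F j) = - F j.
  by rewrite /F msubstB (msubst_invol _ Ws ss) opprB.
have [j|c cE] := @fin_all_exists _ (fun _ => {mpoly K[m]}) (fun j c => F j * B = E * (c \mPo f)).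
  have [C [/gen[c ->] FC]] := ratio _ (FG j) (sF j).
  by exists c.
pose U j : {mpoly K[m]} := 'X_j - msubst M 'X_j.
have UF j : U j \mPo f = F j.
  by rewrite comp_mpolyB induced_comp// comp_mpolyXU -tnth_nth.
(* This is [F_j B = E C_j] read on [V]. Both [U j] and [e] vanish at [y], so the differential there
   only involves theirs, with coefficients [b(y)] and [c_j(y)]. *)
have aI j : relation_ideal f (U j * b - e * c j).
  by rewrite /relation_ideal comp_mpolyB !rmorphM /= UF -bE -eE cE subrr.
have Uy j : point_eval y (U j) = 0.
  rewrite -point_eval_comp UF /F point_evalB point_eval_msubst x's; exact: subrr.
have ey : point_eval y e = 0.
  by rewrite -point_eval_comp -eE EE point_evalM (alpha_wall x'u) mul0r.
have by0 : point_eval y b != 0 by rewrite -point_eval_comp -bE.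
have dU w j : w *m M = - w -> differential y w (U j) = 2 * w 0 j.
  move=> wM; rewrite /U differentialB differential_msubst yM wM !differentialX mxE; ring.
pose kappa w := differential y w e.
(* The relation has the same differential along [w] and [w M = - w]; the first terms add up to
   [4 b(y) w_j], and the scalar on the right does not depend on [j]. *)
have key w : w *m M = - w -> forall j,
    4 * point_eval y b * w 0 j = (kappa w - kappa (- w)) * point_eval y (c j).
  move=> wM j; have := conormal y w _ yM yI y_delta (aI j).
  have d' w' : differential y w' (U j * b - e * c j) =
      differential y w' (U j) * point_eval y b - kappa w' * point_eval y (c j).
    by rewrite differentialB !differentialM Uy ey !mul0r !add0r.
  have NwM : (- w) *m M = - (- w) by rewrite mulNmx wM.
  rewrite wM !d' !dU// [(- w) 0 j]mxE => H.
  have {}H : 2 * w 0 j * point_eval y b - 2 * (- w 0 j) * point_eval y b =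
     kappa w * point_eval y (c j) - kappa (- w) * point_eval y (c j).
    apply/eqP; rewrite -subr_eq0; apply/eqP.
    move/eqP: H; rewrite -subr_eq0 => /eqP <-.
    by rewrite !opprD !opprK addrACA.
  by rewrite mulrBl -H; ring.
have b4 : 4 * point_eval y b != 0 by rewrite mulf_neq0 ?pnatr_eq0.
(* [M] is an involution, so the rows of [M - 1] lie in [V^-], and [key] writes the matrix as a
   column times a row. *)
have -> : M - 1%:M = (\col_i (let w := row i (M - 1%:M) in
      (4 * point_eval y b)^-1 * (kappa w - kappa (- w)))) *m (\row_j point_eval y (c j)).
  apply/row_matrixP => l; apply/rowP => j; rewrite 2![RHS]mxE big_ord1 [X in _ = X * _]mxE [X in _ = _ * X]mxE /=.
  have wM : row l (M - 1%:M) *m M = - row l (M - 1%:M).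
    by rewrite -row_mul mulmxBl mul1mx MM -opprB; apply/rowP => z; rewrite !mxE.
  by rewrite -mulrA -(key _ wM) mulKf.
by apply: leq_trans (mxrankM_maxl _ _) _; exact: rank_leq_col.
Qed.

Variables (u' : 'cV[K]_m) (v' : 'rV[K]_m).
Hypotheses (su' : M = 1%:M + u' *m v') (vu' : v' *m u' = (-2)%:M).

Lemma pullback_anti : msubst (rho s) (linear_form u' \mPo f) = - (linear_form u' \mPo f).
Proof.
rewrite -induced_comp// msubst_linear su' mulmxDl mul1mx -mulmxA vu' mul_mx_scalar.
rewrite -{1}[u']scale1r -scalerDl (_ : 1 + -2 = -1); last by ring.
rewrite -comp_mpolyN; congr comp_mpoly; rewrite /linear_form -sumrN; apply: eq_bigr => i _.
by rewrite mxE mulN1r scaleNr.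
Qed.

(** Take an anti-invariant [E = alpha E1] with [E1] nonzero at [x], and [e] with [E = e o f].
    Dividing [e - M e] by the form of [q(s)] and pulling back gives [2 E1 = phi (q o f)], so [phi]
    cannot vanish at [x]. *)
Lemma pullback_transverse phi :
  linear_form u' \mPo f = linear_form u * phi -> point_eval x phi != 0.
Proof.
move=> phiE; have [E [E1 [EG sE EE E1x]]] := anti_invariant_exists GW Ws ss su vu xu xG.
have [e eE] := gen EG; have [q qE] := divided_difference u' v' e.
have : E - msubst (rho s) E = linear_form u * (phi * (q \mPo f)).
  by rewrite {1 2}eE -induced_comp// su' -comp_mpolyB qE rmorphM /= phiE mulrA.
rewrite sE opprK -mulr2n -scaler_nat EE scalerAr => /(mulfI (alpha_neq0 vu)) E1E.
apply: contraNneq E1x => phi0.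
have := congr1 (point_eval x) E1E; rewrite point_evalZ point_evalM phi0 mul0r => /eqP.
by rewrite mulf_eq0 pnatr_eq0.
Qed.

End Quotient.

End QuotientReflections.

(** * Real reflection groups *)

From mathcomp Require Import all_classical all_reals all_analysis.
Import numFieldNormedType.Exports.

Local Open Scope classical_set_scope.
Local Open Scope ring_scope.

Section RealReflections.
Variables (R : realType) (gT : finGroupType) (W : {group gT}) (n : nat).
Variable rho : mx_representation R W n.
Implicit Types (r s w : gT) (x c d : 'rV[R]_n).
Local Notation refl := (is_reflection rho).

(** A linear form, as a column, and a vector, as a row; the second equation says that [r] negates
    the vector. *)
Definition is_root r (p : 'cV[R]_n * 'rV[R]_n) :=
  rho r = 1%:M + p.1 *m p.2 /\ p.2 *m p.1 = (-2)%:M.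

(** [rho r - 1] has rank one, hence is [u v], and [v] has eigenvalue [1 + v u], a real root of
    unity. The eigenvalue 1 would make [r] a transvection, of infinite order; so it is -1. *)
Lemma root_exists r : refl r -> exists p, is_root r p.
Proof.
move=> /andP[Wr /eqP rk].
have rk1 : \rank (rho r - 1%:M) = 1%N.
  move: rk; rewrite /eigenspace mxrank_ker => rk.
  have := rank_leq_row (rho r - 1%:M); set k := \rank _ in rk * => kn.
  by have := congr1 (subn^~ (n - k)%N) rk; rewrite /= subSnn subKn.
have [u [v uv]] : exists (u : 'cV[R]_n) (v : 'rV[R]_n), rho r - 1%:M = u *m v.
  move: (col_base _) (row_base _) (mulmx_base (rho r - 1%:M)); rewrite rk1 => u v <-.
  by exists u, v.
have rE : rho r = 1%:M + u *m v by rewrite -uv addrC subrK.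
exists (u, v); split => //=.
rewrite [v *m u]mx11_scalar; congr _%:M; set k := (v *m u) 0 0.
have vr : v *m rho r = (1 + k) *: v.
  by rewrite rE mulmxDr mulmx1 mulmxA [v *m u]mx11_scalar mul_scalar_mx scalerDl scale1r.
have vri i : v *m rho (r ^+ i)%g = (1 + k) ^+ i *: v.
  elim: i => [|i IH]; first by rewrite expg0 repr_mx1 mulmx1 scale1r.
  by rewrite expgSr repr_mxM ?groupX// mulmxA IH -scalemxAl vr scalerA exprSr.
have v0 : v != 0.
  apply: contra_eq_neq rk1 => v0; by rewrite uv v0 mulmx0 mxrank0.
have u0 : u != 0.
  apply: contra_eq_neq rk1 => u0; by rewrite uv u0 mul0mx mxrank0.
have k1 : (1 + k) ^+ #[r]%g = 1.
  have := vri #[r]%g; rewrite expg_order repr_mx1 mulmx1 => /esym/eqP.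
  rewrite -subr_eq0 -{2}[v]scale1r -scalerBl scaler_eq0 (negbTE v0) orbF subr_eq0.
  by move/eqP.
have k2 : `|1 + k| = 1.
  by apply/eqP; rewrite -(@pexpr_eq1 _ _ #[r]%g) ?order_gt0 ?normr_ge0// -normrX k1 normr1.
have [k0|k0] := eqVneq k 0; last first.
  have /eqP := k2; rewrite eqr_norml => /andP[/orP[] /eqP H _].
    by move: k0; rewrite (_ : k = 0) ?eqxx//; lra.
  lra.
exfalso; have ri i : rho (r ^+ i)%g = 1%:M + i%:R *: (u *m v).
  elim: i => [|i IH]; first by rewrite expg0 repr_mx1 scale0r addr0.
  rewrite expgSr repr_mxM ?groupX// IH rE mulmxDr mulmx1 mulmxDl mul1mx.
  rewrite -scalemxAl -mulmxA (mulmxA v) [v *m u]mx11_scalar -/k k0.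
  by rewrite mul_scalar_mx scale0r mulmx0 scaler0 addr0 -addrA -[i.+1%:R]natr1 scalerDl scale1r.
have /esym/eqP := ri #[r]%g; rewrite expg_order repr_mx1 -subr_eq0 addrC addKr.
rewrite scaler_eq0 pnatr_eq0 -leqn0 leqNgt order_gt0 /=.
by rewrite -uv => /eqP uv0; move: rk1; rewrite uv0 mxrank0.
Qed.

(** A root is determined up to scaling only, so the sign of [lam r x] by itself has no meaning;
    sides of a hyperplane are always compared through the sign of a product of two values. *)
Definition root r := xget (0, 0) (is_root r).

Definition lam r x : R := (x *m (root r).1) 0 0.

Definition coroot r : 'rV[R]_n := (root r).2.

Lemma rootP r : refl r -> is_root r (root r).
Proof. by move=> /root_exists[p rp]; exact: (xgetI (0, 0) rp). Qed.

Lemma lamD r x y : lam r (x + y) = lam r x + lam r y.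
Proof. by rewrite /lam mulmxDl mxE. Qed.

Lemma lamZ r k x : lam r (k *: x) = k * lam r x.
Proof. by rewrite /lam -scalemxAl mxE. Qed.

Lemma lamN r x : lam r (- x) = - lam r x.
Proof. by rewrite -scaleN1r lamZ mulN1r. Qed.

Lemma lamB r x y : lam r (x - y) = lam r x - lam r y.
Proof. by rewrite lamD lamN. Qed.

Lemma lam0 r : lam r 0 = 0.
Proof. by rewrite /lam mul0mx mxE. Qed.

Lemma reflE r x : refl r -> x *m rho r = x + lam r x *: coroot r.
Proof.
move=> /rootP[-> _]; rewrite mulmxDr mulmx1 mulmxA [x *m _]mx11_scalar.
by rewrite mul_scalar_mx.
Qed.

Lemma lam_coroot r : refl r -> lam r (coroot r) = -2.
Proof. by move=> /rootP[_ +]; rewrite /lam /coroot => ->; rewrite mxE eqxx. Qed.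

Lemma lam_refl r x : refl r -> lam r (x *m rho r) = - lam r x.
Proof. by move=> rr; rewrite reflE// lamD lamZ lam_coroot//; lra. Qed.

Lemma coroot_neq0 r : refl r -> coroot r != 0.
Proof.
by move=> rr; apply/eqP => H; have := lam_coroot rr; rewrite H lam0; lra.
Qed.

Lemma fixed_lam r x : refl r -> (x *m rho r = x) <-> (lam r x = 0).
Proof.
move=> rr; rewrite reflE//; split => [/eqP|->]; last by rewrite scale0r addr0.
rewrite -subr_eq0 addrC addKr scaler_eq0 (negbTE (coroot_neq0 rr)) orbF.
by move/eqP.
Qed.

Lemma lam_neq0 r : refl r -> exists x, lam r x != 0.
Proof. by move=> rr; exists (coroot r); rewrite lam_coroot//; lra. Qed.

Lemma refl_invol r x : refl r -> x *m rho r *m rho r = x.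
Proof. by move=> rr; rewrite [LHS]reflE// lam_refl// reflE// scaleNr addrK. Qed.

Lemma regular_lam x : regular_pts rho x <-> forall r, refl r -> lam r x != 0.
Proof.
rewrite regularP; split=> H r rr.
  by apply/eqP => /(fixed_lam x rr); exact: H.
by rewrite /fixed_space /= => /(fixed_lam x rr)/eqP; apply/negP/H.
Qed.

Lemma refl_conj r w : refl r -> w \in W -> refl (r ^ w)%g.
Proof.
move=> /andP[Wr rk] Ww; rewrite /is_reflection groupJ//=.
suff -> : \rank (eigenspace (rho (r ^ w)%g) 1) = \rank (eigenspace (rho r) 1) by [].
rewrite /eigenspace.
have U : rho w \in unitmx by exact: repr_mx_unit.
have -> : rho (r ^ w)%g - 1%:M = invmx (rho w) *m (rho r - 1%:M) *m rho w.
  rewrite mulmxBr mulmxBl mulmx1 mulVmx//; congr (_ - _).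
  by rewrite conjgE !repr_mxM ?groupM ?groupV// repr_mxV// mulmxA.
rewrite !mxrank_ker mxrankMfree ?row_free_unit//.
by rewrite (eqmxMfull _ (_ : row_full (invmx (rho w)))) // row_full_unit unitmx_inv.
Qed.

(** Both sides are linear forms in [x] whose kernel is the hyperplane of [r]. *)
Lemma lam_conj r w : refl r -> w \in W ->
  exists2 k, k != 0 & forall x, lam (r ^ w)%g (x *m rho w) = k * lam r x.
Proof.
move=> rr Ww; have rw := refl_conj rr Ww; have /andP[Wr _] := rr.
have [y y0] := lam_neq0 rr.
have H x : lam r x = 0 <-> lam (r ^ w)%g (x *m rho w) = 0.
  rewrite -fixed_lam// -fixed_lam// -mulmxA -repr_mxM ?groupJ// -conjgC repr_mxM//.
  rewrite mulmxA; split => [->//|].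
  by move/(can_inj (repr_mxK rho Ww)).
have K x : lam (r ^ w)%g (x *m rho w) = (lam (r ^ w)%g (y *m rho w) / lam r y) * lam r x.
  have : lam (r ^ w)%g ((x - (lam r x / lam r y) *: y) *m rho w) = 0.
    by apply/H; rewrite lamB lamZ mulfVK// subrr.
  rewrite mulmxBl -scalemxAl lamB lamZ => /eqP; rewrite subr_eq0 => /eqP ->.
  by rewrite mulrAC [RHS]mulrAC [_ * lam r x]mulrC.
exists (lam (r ^ w)%g (y *m rho w) / lam r y) => //.
rewrite mulf_neq0 ?invr_eq0//; apply/eqP => /H; exact/eqP.
Qed.

End RealReflections.

Section RowVectorContinuity.
Variables (K : numFieldType) (T : topologicalType).

Lemma continuous_sum (I : Type) (l : seq I) (F : I -> T -> K) :
  (forall i, continuous (F i)) -> continuous (fun t => \sum_(i <- l) F i t).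
Proof.
by move=> cF; apply: continuous_big => // z; exact: add_continuous.
Qed.

Lemma cvg_rowvec (F : set_system T) (FF : Filter F) n (g : T -> 'rV[K]_n) (y : 'rV[K]_n) :
  (forall j, g t 0 j @[t --> F] --> y 0 j) -> g t @[t --> F] --> y.
Proof.
move=> cg A [P PA sub]; rewrite /nbhs /=.
have : \forall t \near F, forall j, P 0 j (g t 0 j).
  by apply: filter_forall => j; exact: (cg j _ (PA 0 j)).
by apply: filterS => t Pt; apply: sub => i j; rewrite (ord1 i).
Qed.

Lemma continuous_rowvec n (g : T -> 'rV[K]_n) :
  (forall j, continuous (fun t => g t 0 j)) -> continuous g.
Proof. by move=> cg t; apply: cvg_rowvec => j; exact: cg. Qed.

End RowVectorContinuity.

Lemma continuous_mulmxr (K : numFieldType) n p (A : 'M[K]_(n, p)) :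
  continuous (fun x : 'rV[K]_n => x *m A).
Proof.
apply: continuous_rowvec => j.
rewrite (_ : (fun x => _) = fun x : 'rV[K]_n => \sum_i x 0 i * A i j); last first.
  by apply/funext => x; rewrite mxE.
by apply: continuous_sum => i x; exact: (cvgM (@coord_continuous K 1 n 0 i x) (@cst_continuous _ _ (A i j) x)).
Qed.

(** * Signs and small perturbations *)

Section Signs.
Variable R : realType.
Implicit Types a b c p q : R.

Lemma mul_gt0_trans b a c : 0 < a * b -> 0 < b * c -> 0 < a * c.
Proof.
move=> ab bc; have b0 : 0 < b ^+ 2.
  by rewrite exprn_even_gt0//=; apply: contraTneq ab => ->; rewrite mulr0 ltxx.
rewrite -(pmulr_rgt0 _ b0) (_ : b ^+ 2 * (a * c) = (a * b) * (b * c)); last by ring.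
exact: mulr_gt0.
Qed.

Lemma mul_lt0_trans b a c : 0 < a * b -> b * c < 0 -> a * c < 0.
Proof.
by move=> ab; rewrite -oppr_gt0 -mulrN => bc; rewrite -oppr_gt0 -mulrN (mul_gt0_trans ab).
Qed.

Lemma sqr_gt0 a : a != 0 -> 0 < a * a.
Proof. by move=> a0; rewrite -expr2 exprn_even_gt0. Qed.

Lemma near_affine_gt0 p q : 0 < p -> \forall e \near 0^'+, 0 < p + e * q.
Proof.
move=> p0; near=> e.
have e0 : 0 < e by near: e; exact: nbhs_right_gt.
have ep : e < p / (`|q| + 1).
  by near: e; apply: nbhs_right_lt; rewrite divr_gt0// ltr_wpDl.
have : e * (`|q| + 1) < p by rewrite -ltr_pdivlMr// ltr_wpDl.
have := ler_norm (- q); rewrite normrN => qq.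
nra.
Unshelve. all: by end_near. Qed.

Lemma near_affine_neq0 p q : (p != 0) || (q != 0) ->
  \forall e \near 0^'+, p + e * q != 0.
Proof.
have [-> /= q0|p0 _] := eqVneq p 0.
  apply: filterS (nbhs_right_gt 0) => e e0.
  by rewrite add0r mulf_neq0// gt_eqF.
have [pn|pp] := ltrP p 0.
  apply: filterS (near_affine_gt0 (- q) (_ : 0 < - p)) => [e|]; last by rewrite oppr_gt0.
  by rewrite mulrN -opprD oppr_gt0 => /lt_eqF ->.
apply: filterS (near_affine_gt0 q (_ : 0 < p)) => [e /gt_eqF -> //|].
by rewrite lt_neqAle eq_sym p0.
Qed.

Let mul_line n (v w : 'rV[R]_n) e (u : 'cV[R]_n) :
  ((v + e *: w) *m u) 0 0 = (v *m u) 0 0 + e * (w *m u) 0 0.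
Proof. by rewrite mulmxDl -scalemxAl mxE [X in _ + X]mxE. Qed.

(** A vector off the previous hyperplanes is moved slightly, in a direction not contained in the new
    one. *)
Lemma generic_vector n (s : seq 'cV[R]_n) : (forall u, u \in s -> u != 0) ->
  exists v : 'rV[R]_n, forall u, u \in s -> (v *m u) 0 0 != 0.
Proof.
elim: s => [_|u s IH H]; first by exists 0.
have [|v vs] := IH; first by move=> u' u's; apply: H; rewrite inE u's orbT.
have [w wu] : exists w : 'rV[R]_n, (w *m u) 0 0 != 0.
  have /cV0Pn[i ui] := H u (mem_head _ _).
  by exists (delta_mx 0 i); rewrite -rowE mxE.
have : \forall e \near 0^'+, all (fun u' => ((v + e *: w) *m u') 0 0 != 0) (u :: s).
  have K u' : u' \in u :: s ->
      \forall e \near (0:R)^'+, ((v + e *: w) *m u') 0 0 != 0.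
    move=> u's.
    have : ((v *m u') 0 0 != 0) || ((w *m u') 0 0 != 0).
      move: u's; rewrite inE => /orP[/eqP->|/vs -> //]; by rewrite wu orbT.
    move/near_affine_neq0; apply: filterS => e.
    by rewrite mul_line.
  move: (u :: s) K => l; elim: l => [|u' l IHl] K.
    by apply: filterE.
  apply: filterS2 (K u' (mem_head _ _)) (IHl _) => [e /= -> //|u'' lu''].
  by apply: K; rewrite inE lu'' orbT.
move=> /filter_ex[e /allP He].
by exists (v + e *: w).
Qed.

Lemma generic_direction n (s : seq 'cV[R]_n) (c : 'rV[R]_n) :
  (forall u, u \in s -> u != 0) ->
  exists v : 'rV[R]_n, \forall e \near 0^'+,
    forall u, u \in s -> ((c + e *: v) *m u) 0 0 != 0.
Proof.
move=> s0; have [v vs] := generic_vector s0; exists v.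
elim: s vs {s0} => [|u s IH] vs; first exact: filterE.
have := IH (fun u' u's => vs u' (mem_behead (s := u :: s) u's)).
have := near_affine_neq0 (p := (c *m u) 0 0) (q := (v *m u) 0 0).
rewrite vs ?mem_head ?orbT// => /(_ isT).
apply: filterS2 => e eu es u'; rewrite inE => /orP[/eqP ->|/es //].
by rewrite mul_line.
Qed.

End Signs.

(** * Chambers as sign patterns *)

Section Chambers.
Variables (R : realType) (gT : finGroupType) (W : {group gT}) (n : nat).
Variable rho : mx_representation R W n.
Implicit Types (r s w : gT) (x y z c d : 'rV[R]_n).
Local Notation refl := (is_reflection rho).
Local Notation lm := (lam rho).
Local Notation regular := (regular_pts rho).

Definition same_side c d := forall r, refl r -> 0 < lm r c * lm r d.

Lemma same_sideC c d : same_side c d -> same_side d c.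
Proof. by move=> H r rr; rewrite mulrC H. Qed.

Lemma same_side_refl c : regular c -> same_side c c.
Proof. by move=> /regular_lam rc r rr; apply: sqr_gt0; exact: rc. Qed.

Lemma same_side_regular c d : same_side c d -> regular d.
Proof.
move=> cd; apply/regular_lam => r rr; apply/eqP => d0.
by have := cd r rr; rewrite d0 mulr0 ltxx.
Qed.

Lemma regular_repr c w : w \in W -> regular c -> regular (c *m rho w).
Proof.
move=> Ww /regular_lam rc; apply/regular_lam => r rr.
have [k k0] := lam_conj (refl_conj rr (groupVr Ww)) Ww.
by rewrite conjgKV => ->; rewrite mulf_neq0// rc// refl_conj// groupV.
Qed.

Lemma continuous_lam r : continuous (lm r).
Proof.
move=> x; exact: (continuous_comp (@continuous_mulmxr R n 1 (root rho r).1 x)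
  (@coord_continuous R 1 1 0 0 _)).
Qed.

(** A form without zeros on a connected set has constant sign there; conversely the segment between
    two points with equal signs stays regular. *)
Lemma chamber_same_side C c z : is_chamber rho C -> C c -> C z <-> same_side c z.
Proof.
move=> hC Cc; have rc := chamber_regular hC Cc.
have CE : C = connected_component regular c.
  by case: hC Cc => x rx -> xc; exact: same_connected_component.
split=> [Cz r rr|cz].
  have rz := chamber_regular hC Cz.
  rewrite ltNge; apply/negP => le0.
  have [D [cD sD conD] zD] : exists2 D, [/\ D c, D `<=` regular & connected D] & D z.
    exists C => //; split=> //; rewrite CE; first exact: connected_component_sub.
    exact: component_connected.
  have : is_interval (lm r @` D).
    apply/connected_intervalP; apply: connected_continuous_connected => //.
    by apply: continuous_subspaceT; exact: continuous_lam.
  have K : (lm r @` D) 0 -> False.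
    by move=> [y /sD /regular_lam /(_ r rr) /eqP].
  move=> itv; apply: K; move/regular_lam/(_ r rr): rc => c0.
  have imc : (lm r @` D) (lm r c) by exists c.
  have imz : (lm r @` D) (lm r z) by exists z.
  have [lc|lc] := leP (lm r c) 0.
    by apply: (itv _ _ imc imz); rewrite lc/=; move: c0; rewrite neq_lt => /orP[] ?; nra.
  by apply: (itv _ _ imz imc); rewrite (ltW lc) andbT; nra.
rewrite CE; apply: (connected_component_max (B := (fun t => c + t *: (z - c)) @` `[0, 1]%classic)).
- by exists 0; [rewrite /= in_itv /= lexx ler01|rewrite scale0r addr0].
- move=> y [t /=]; rewrite in_itv /= => /andP[t0 t1] <-; apply/regular_lam => r rr.
  apply/eqP; rewrite lamD lamZ lamB => H; have := cz r rr.
  have c2 : 0 < lm r c * lm r c by apply/sqr_gt0; move/regular_lam: rc; exact.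
  have H' : lm r c * (lm r c + t * (lm r z - lm r c)) = 0 by rewrite H mulr0.
  have t1c : 0 <= (1 - t) * (lm r c * lm r c) by rewrite mulr_ge0 ?subr_ge0// ltW.
  move: t0; rewrite le_eqVlt => /orP[/eqP t0|t0]; first by rewrite -t0 in H'; nra.
  by have := mulr_gt0 t0 (cz r rr); nra.
- apply: connected_continuous_connected; first exact/connected_intervalP/interval_is_interval.
  apply: continuous_subspaceT; apply: continuous_rowvec => j t.
  rewrite (_ : (fun t => _) = fun t => c 0 j + t * (z - c) 0 j); last first.
    by apply/funext => t'; rewrite 2!mxE.
  by apply: cvgD; [exact: cvg_cst|apply: cvgM; [exact: cvg_id|exact: cvg_cst]].
- by exists 1; [rewrite /= in_itv /= lexx ler01|rewrite scale1r addrC subrK].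
Qed.

End Chambers.

(** * Walls of a chamber and transitivity on chambers *)

Section Walls.
Variables (R : realType) (gT : finGroupType) (W : {group gT}) (n : nat).
Variable rho : mx_representation R W n.
Implicit Types (r s w : gT) (x y z c d : 'rV[R]_n) (ws : seq gT).
Local Notation refl := (is_reflection rho).
Local Notation lm := (lam rho).
Local Notation regular := (regular_pts rho).
Local Notation same_side := (same_side rho).

(** Equality of the hyperplanes; for faithful [rho] it gives [r = s], see [proportional_eq]. *)
Definition proportional r s := exists k, forall y, lm r y = k * lm s y.

(* x lies in the closure of the chamber of c, on the hyperplane of s and on no
   other one. *)
Definition wall_point c s x :=
  [/\ refl s, lm s x = 0 &
    forall r, refl r -> proportional r s \/ 0 < lm r c * lm r x].

Definition simple c : {set gT} := [set s | `[< exists x, wall_point c s x >]]%SET.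

Lemma simpleP c s : reflect (exists x, wall_point c s x) (s \in simple c).
Proof. by rewrite inE; exact: asboolP. Qed.

Lemma simple_refl c s : s \in simple c -> refl s.
Proof. by move=> /simpleP[x []]. Qed.

Lemma gen_simple_sub c : (<<simple c>> \subset W)%g.
Proof. by rewrite gen_subG; apply/fintype.subsetP => u /simple_refl/andP[]. Qed.

Lemma wall_point_same c d s x : same_side c d -> wall_point c s x -> wall_point d s x.
Proof.
move=> cd [rs sx H]; split=> // r rr; case: (H r rr) => [|cx]; first by left.
by right; apply: mul_gt0_trans cx; rewrite mulrC; exact: cd.
Qed.

Lemma wall_point_conj c s x w : w \in W -> wall_point c s x ->
  wall_point (c *m rho w) (s ^ w)%g (x *m rho w).
Proof.
move=> Ww [rs sx H]; have [k k0 kE] := lam_conj rs Ww.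
split; rewrite ?refl_conj ?kE ?sx ?mulr0// => r rr.
have rr' : refl (r ^ w^-1)%g by rewrite refl_conj ?groupV.
have [l l0] := lam_conj rr' Ww; rewrite conjgKV => lE.
case: (H _ rr') => [[m mE]|cx]; [left|right]; last first.
  by rewrite !lE mulrACA mulr_gt0// sqr_gt0.
exists (l * m / k) => y; have -> : y = y *m rho w^-1%g *m rho w.
  by rewrite repr_mxKV.
by rewrite lE kE mE !mulrA divfK.
Qed.

Lemma simple_conj c s w : w \in W -> s \in simple c -> (s ^ w)%g \in simple (c *m rho w).
Proof.
move=> Ww /simpleP[x cx]; apply/simpleP; exists (x *m rho w).
exact: wall_point_conj.
Qed.

(** Neither the hyperplane of [r] nor its translate by [w^-1] contains [x]. So [c] is on the same
    side as [x] for both, and applying [w], which fixes [x], puts [c w] on the side of [x] for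
    [r]. *)
Lemma wall_stab_sign c s x w r : wall_point c s x -> w \in W -> x *m rho w = x ->
  refl r -> ~ proportional r s -> 0 < lm r (c *m rho w) * lm r c.
Proof.
move=> [rs sx H] Ww xw rr nrs; case: (H r rr) => // cx.
have rr' : refl (r ^ w^-1)%g by rewrite refl_conj ?groupV.
have [l l0] := lam_conj rr' Ww; rewrite conjgKV => lE.
have lx : lm r x = l * lm (r ^ w^-1)%g x by rewrite -lE xw.
case: (H _ rr') => [[m mE]|cx'].
  by move: cx; rewrite lx mE sx !mulr0 ltxx.
apply: (@mul_gt0_trans _ (lm r x)); last by rewrite mulrC.
by rewrite lE lx mulrACA mulr_gt0// sqr_gt0.
Qed.

(** Walk straight to [d] from a generic point [c'] of the chamber of [c]: distinct hyperplanes are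
    then crossed at distinct times, and the first one crossed is a wall. *)
Lemma first_wall c d r0 : regular c -> regular d -> refl r0 -> lm r0 c * lm r0 d < 0 ->
  exists2 s, s \in simple c & lm s c * lm s d < 0.
Proof.
move=> rc rd rr0 cd0.
(* It vanishes at [c'] if the segment from [c'] to [d] meets both hyperplanes at the same time. As
   [d] is regular, it is identically 0 only for proportional forms. *)
pose form (p : gT * gT) := lm p.2 d *: (root rho p.1).1 - lm p.1 d *: (root rho p.2).1.
have formE p y : (y *m form p) 0 0 = lm p.2 d * lm p.1 y - lm p.1 d * lm p.2 y.
  by rewrite /form mulmxBr -!scalemxAr mxE [X in X + _]mxE [X in _ + X]mxE [X in _ - X]mxE.
pose forms := [seq u <- [seq form p | p <- enum {: gT * gT}] | u != 0].
have [|v near_v] := @generic_direction R n forms c.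
  by move=> u; rewrite mem_filter => /andP[].
have near_c : \forall e \near (0 : R)^'+, forall r, refl r -> 0 < lm r c * lm r (c + e *: v).
  apply: filter_forall => r; have [rr|] := boolP (refl r); last by move=> _; exact: filterE.
  have := near_affine_gt0 (lm r c * lm r v) (sqr_gt0 (_ : lm r c != 0)).
  move/regular_lam : rc => /(_ r rr) -> /(_ isT); apply: filterS => e + _.
  by rewrite lamD lamZ mulrDr mulrCA.
have [e [forms_e side_e]] := filter_ex (filterI near_v near_c).
pose c' := c + e *: v.
have cc' : same_side c c' by exact: side_e.
have form_c' p : (c' *m form p) 0 0 = 0 -> form p = 0.
  move=> H; apply/eqP; apply: contraT => p0.
  have := forms_e (form p); rewrite H eqxx; apply.
  by rewrite mem_filter p0 map_f// mem_enum.
pose sep r := refl r && (lm r c' * lm r d < 0).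
have sep0 : sep r0.
  rewrite /sep rr0 /=; apply: (@mul_lt0_trans _ (lm r0 c)) => //.
  by rewrite mulrC; exact: cc'.
(* The time at which the segment crosses the hyperplane of [r]; [s] minimises it. *)
pose t r := lm r c' / (lm r c' - lm r d).
case: (arg_minP t sep0) => s /andP[rs sepS] minS.
have A0 : lm s c' - lm s d != 0 by apply/eqP => H; nra.
have tE : t s * (lm s c' - lm s d) = lm s c' by rewrite /t divfK.
have t0 : 0 < t s by nra.
have t1 : t s < 1 by nra.
pose x := c' + t s *: (d - c').
have lx r : lm r x = lm r c' + t s * (lm r d - lm r c').
  by rewrite /x lamD lamZ lamB.
exists s; last first.
  exact: mul_lt0_trans (cc' s rs) sepS.
apply/simpleP; exists x; apply: (wall_point_same (same_sideC cc')).
split=> //; first by rewrite lx; lra.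
move=> r rr; have c'0 : lm r c' != 0 by move/regular_lam: (same_side_regular cc'); exact.
have d0 : lm r d != 0 by move/regular_lam: rd; exact.
have [c'd|c'd] := ltP (lm r c' * lm r d) 0; last first.
  right; rewrite lx.
  have cd : 0 < lm r c' * lm r d by rewrite lt_neqAle eq_sym mulf_neq0.
  have := sqr_gt0 c'0; move: (lm r c') (lm r d) (t s) cd t0 t1 => a b u cd u0 u1 a2.
  have : 0 < u * (a * b) by exact: mulr_gt0.
  have : 0 < (1 - u) * (a * a) by rewrite mulr_gt0// subr_gt0.
  nra.
have {}minS : t s <= t r by apply: minS; rewrite /sep rr.
have B0 : lm r c' - lm r d != 0 by apply/eqP => H; nra.
have trE : t r * (lm r c' - lm r d) = lm r c' by rewrite /t divfK.
move: minS; rewrite le_eqVlt => /orP[/eqP trs|trs]; [left|right].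
  have sd0 : lm s d != 0 by move/regular_lam: rd; exact.
  have form0 : form (r, s) = 0.
    apply: form_c'; rewrite formE /=.
    move: trE tE; rewrite -trs.
    move: (lm r c') (lm r d) (lm s c') (lm s d) (t s) t1 => a b a' b' u u1 e1 e2.
    have E : a * (1 - u) = - (u * b) by lra.
    have E' : a' * (1 - u) = - (u * b') by lra.
    have : (1 - u) * (b' * a - b * a') = 0.
      transitivity (b' * (a * (1 - u)) - b * (a' * (1 - u))); first by ring.
      by rewrite E E'; ring.
    move=> /eqP; rewrite mulf_eq0 subr_eq0 => /orP[/eqP u1'|/eqP //].
    by rewrite -u1' ltxx in u1.
  exists (lm r d / lm s d) => y.
  have := formE (r, s) y; rewrite form0 mulmx0 mxE /= => /esym/eqP.
  rewrite subr_eq0 => /eqP H; apply: (mulfI sd0).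
  by rewrite H mulrA mulrCA mulfV// mulr1.
rewrite lx; move: (lm r c') (lm r d) (t s) (t r) c'd trE trs => a b u u' ab aE uu.
have aab : 0 < a * (a - b) by nra.
have : u * (a * (a - b)) < u' * (a * (a - b)) by rewrite ltr_pM2r.
rewrite [u' * _]mulrCA aE; lra.
Qed.

(** Induction on the number of hyperplanes between [c] and [d]: reflecting [c] in a separating wall
    removes this wall and, by [wall_stab_sign], adds no hyperplane. *)
Lemma transitive_simple c d : regular c -> regular d ->
  exists2 w, w \in <<simple c>>%g & same_side (c *m rho w) d.
Proof.
pose sep c d := [pred r | refl r && (lm r c * lm r d < 0)].
have [N] := ubnP #|sep c d|; elim: N => // N IH in c d *.
rewrite ltnS => cardN rc rd.
have [/existsP[r0 /andP[rr0 sep0]]|nosep] := boolP [exists r, sep c d r]; last first.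
  exists 1%g => // r rr; rewrite repr_mx1 mulmx1.
  move/existsPn: nosep => /(_ r); rewrite /= rr /= -leNgt le_eqVlt eq_sym => /orP[|//].
  by rewrite mulf_eq0; move/regular_lam: rc => /(_ r rr)/negbTE ->;
    move/regular_lam: rd => /(_ r rr)/negbTE ->.
have [s sc sepS] := first_wall rc rd rr0 sep0.
have rs := simple_refl sc; have /andP[Ws _] := rs.
have rcs : regular (c *m rho s) by exact: regular_repr.
have ltN : (#|sep (c *m rho s) d| < N)%N.
  apply: leq_trans cardN; apply: proper_card; apply/properP; split; last first.
    by exists s; rewrite !inE /= rs//= lam_refl// mulNr oppr_lt0 -leNgt ltW.
  apply/fintype.subsetP => r; rewrite !inE /= => /andP[rr csd]; rewrite rr /=.
  have [[k kE]|nprop] := pselect (proportional r s).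
    by move: csd; rewrite !kE lam_refl//; nra.
  move/simpleP: sc => [x sx]; have [_ sx0 _] := sx.
  have xs : x *m rho s = x by apply/fixed_lam.
  have := wall_stab_sign sx Ws xs rr nprop; rewrite mulrC => H.
  exact: mul_lt0_trans H csd.
have [w ws wd] := IH _ _ ltN rcs rd.
exists (s * w)%g; last first.
  by rewrite repr_mxM ?mulmxA// (fintype.subsetP (gen_simple_sub _) _ ws).
rewrite groupM//; first exact: mem_gen.
(* The walls of [c s] are the conjugates by [s] of those of [c], and [s] is one of the latter, so
   the generated groups agree. *)
have : (w \in <<(simple c) :^ s>>)%g.
  apply: (fintype.subsetP _ w ws); rewrite genS//; apply/fintype.subsetP => u us.
  rewrite mem_conjg; have := simple_conj (groupVr Ws) us.
  by rewrite repr_mxK.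
by rewrite genJ conjGid//; exact: mem_gen.
Qed.

End Walls.

(** * Exchange condition and free action on chambers *)

Section SimplyTransitive.
Variables (R : realType) (gT : finGroupType) (W : {group gT}) (n : nat).
Variable rho : mx_representation R W n.
Implicit Types (r s w : gT) (x y z c d : 'rV[R]_n) (ws : seq gT).
Local Notation refl := (is_reflection rho).
Local Notation lm := (lam rho).
Local Notation regular := (regular_pts rho).
Local Notation same_side := (same_side rho).
Local Notation simple := (simple rho).
Local Notation proportional := (proportional rho).
Local Notation wall_point := (wall_point rho).

Lemma regular_neq0 c r : regular c -> refl r -> lm r c != 0.
Proof. by move=> /regular_lam; exact. Qed.

(** Next to a generic point of the hyperplane of [r] there is a chamber with wall [r]. The group of
    simple reflections carries it to the chamber of [c] and so conjugates [r] to a simple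
    reflection. *)
Lemma refl_simple_gen c r : regular c -> refl r -> r \in <<simple c>>%g.
Proof.
move=> rc rr; have /andP[Wr _] := rr.
(* The form of [r'] composed with the projection onto the hyperplane of [r] along its coroot; [x]
   below is the projection of [v]. *)
pose u r' := (root rho r').1 + (2^-1 * lm r' (coroot rho r)) *: (root rho r).1.
have uE r' y : (y *m u r') 0 0 = lm r' y + 2^-1 * lm r' (coroot rho r) * lm r y.
  by rewrite /u mulmxDr -scalemxAr mxE [X in _ + X]mxE.
have [|v vP] := @generic_vector R n [seq u' <- (root rho r).1 :: [seq u r' | r' <- enum {: gT}] | u' != 0].
  by move=> u'; rewrite mem_filter => /andP[].
have vr : lm r v != 0.
  apply: vP; rewrite mem_filter mem_head andbT; apply/eqP => r0.
  by have := lam_coroot rr; rewrite /lam r0 mulmx0 mxE; lra.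
have vu r' : (v *m u r') 0 0 = 0 -> u r' = 0.
  move=> H; apply/eqP; apply: contraT => u0.
  have := vP (u r'); rewrite H eqxx; apply.
  by rewrite mem_filter u0 inE map_f ?orbT// mem_enum.
pose x := v + (2^-1 * lm r v) *: coroot rho r.
have xE r' : lm r' x = (v *m u r') 0 0.
  by rewrite uE /x lamD lamZ; ring.
have xr : lm r x = 0 by rewrite xE uE lam_coroot//; field.
have prop r' : lm r' x = 0 -> proportional r' r.
  rewrite xE => /vu u0; exists (- (2^-1 * lm r' (coroot rho r))) => y.
  by have /eqP := uE r' y; rewrite u0 mulmx0 mxE eq_sym addr_eq0 mulNr => /eqP.
have : \forall e \near (0 : R)^'+, forall r', refl r' ->
   (proportional r' r \/ 0 < lm r' (x + e *: v) * lm r' x) /\ lm r' (x + e *: v) != 0.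
  apply: filter_forall => r'; have [rr'|_] := boolP (refl r'); last exact: filterE.
  have [x0|x0] := eqVneq (lm r' x) 0.
    have [k kE] := prop _ x0; apply: filterS (nbhs_right_gt 0) => e e0 _.
    split; first by left; exists k.
    rewrite kE lamD xr lamZ add0r !mulf_neq0 ?(gt_eqF e0)//.
    by have [y] := lam_neq0 rr'; rewrite kE mulf_eq0 negb_or => /andP[].
  apply: filterS (near_affine_gt0 (lm r' v * lm r' x) (sqr_gt0 x0)) => e H _.
  have H' : 0 < lm r' (x + e *: v) * lm r' x by rewrite lamD lamZ mulrDl -mulrA.
  by split; [right|apply: contraTneq H' => ->; rewrite mul0r ltxx].
move=> /filter_ex[e He]; set d := x + e *: v in He.
have rd : regular d by apply/regular_lam => r' /He[].
have dx : wall_point d r x by split=> // r' /He[].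
have [w wc wd] := transitive_simple rc rd.
have Ww := fintype.subsetP (gen_simple_sub _ _) _ wc.
have := wall_point_conj (groupVr Ww) (wall_point_same (same_sideC wd) dx).
rewrite repr_mxK// => cx.
rewrite -(groupJr _ (groupVr wc)) mem_gen//.
by apply/simpleP; exists (x *m rho w^-1%g).
Qed.

Lemma reflection_group_simple c : reflection_group rho -> regular c -> <<simple c>>%g = W.
Proof.
move=> WE rc; apply/eqP; rewrite finset.eqEsubset gen_simple_sub /=.
rewrite -{1}WE gen_subG; apply/fintype.subsetP => r; rewrite inE.
exact: refl_simple_gen.
Qed.

Hypothesis rho_faithful : mx_faithful rho.

Lemma faithful_eq g h : g \in W -> h \in W ->
  (forall x, x *m rho g = x *m rho h) -> g = h.
Proof.
move=> Wg Wh gh; apply: (mx_faithful_inj rho_faithful) => //.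
by apply/row_matrixP => i; rewrite !rowE.
Qed.

(** If the hyperplanes agree, the [i]-th power of [r s] adds [i * lam r x] times a fixed vector [u]
    to [x]; finite order forces this to be 0. *)
Lemma proportional_eq r s : refl r -> refl s -> proportional r s -> r = s.
Proof.
move=> rr rs [k kE]; have /andP[Wr _] := rr; have /andP[Ws _] := rs.
have k0 : k != 0 by have [y] := lam_neq0 rr; rewrite kE mulf_eq0 negb_or => /andP[].
pose u := coroot rho r - k^-1 *: coroot rho s.
have ru : lm r u = 0.
  by rewrite /u lamB lamZ lam_coroot// kE lam_coroot// mulrA mulVf// mul1r subrr.
have rsE x : x *m rho r = x *m rho s + lm r x *: u.
  rewrite (reflE x rr) (reflE x rs) -addrA; congr (_ + _).
  by rewrite /u scalerBr scalerA kE mulrAC mulfV// mul1r addrCA subrr addr0.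
have su : u *m rho s = u.
  apply/(fixed_lam u rs); apply: (mulfI k0); by rewrite -kE ru mulr0.
have Wrs : (r * s)%g \in W by rewrite groupM.
have iE i x : x *m rho ((r * s) ^+ i)%g = x + (i%:R * lm r x) *: u.
  elim: i => [|i IH]; first by rewrite expg0 repr_mx1 mulmx1 mul0r scale0r addr0.
  rewrite expgSr repr_mxM ?groupX// mulmxA IH repr_mxM// mulmxA rsE mulmxDl refl_invol//.
  by rewrite -scalemxAl su lamD lamZ ru mulr0 addr0 -addrA -scalerDl -[i.+1%:R]natr1 mulrDl mul1r.
apply: faithful_eq => // x; rewrite rsE.
have := iE #[(r * s)%g]%g x; rewrite expg_order repr_mx1 mulmx1 => /esym/eqP.
rewrite -subr_eq0 addrC addKr scaler_eq0 mulf_eq0 pnatr_eq0 -leqn0 leqNgt order_gt0 /=.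
by move=> /orP[|] /eqP ->; rewrite ?scale0r ?scaler0 addr0.
Qed.

Lemma refl_mulg r : refl r -> (r * r = 1)%g.
Proof.
move=> rr; have /andP[Wr _] := rr.
apply: faithful_eq; rewrite ?groupM// => x.
by rewrite repr_mxM// mulmxA refl_invol// repr_mx1 mulmx1.
Qed.

Definition word_prod ws : gT := foldr mulg 1%g ws.

(** A word read from its end is a gallery starting at [c]. Each letter, conjugated by the product of
    the letters after it, is the reflection in the hyperplane crossed at that step. *)
Fixpoint crossed ws : seq gT :=
  if ws is s :: ws' then (s ^ word_prod ws')%g :: crossed ws' else [::].

Lemma word_prod_in c ws : {subset ws <= simple c} -> word_prod ws \in W.
Proof.
elim: ws => [|s ws IH] sub /=; first exact: group1.
rewrite groupM ?IH//; last by move=> u us; apply: sub; rewrite inE us orbT.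
by have /simple_refl/andP[] := sub s (mem_head _ _).
Qed.

(* r separates c and c w iff the gallery given by a word of w crosses the
   hyperplane of r an odd number of times. *)
Lemma crossed_odd c ws r : regular c -> {subset ws <= simple c} -> refl r ->
  (lm r c * lm r (c *m rho (word_prod ws)) < 0) = odd (count_mem r (crossed ws)).
Proof.
move=> rc; elim: ws => [|s ws IH] sub rr.
  by rewrite /= repr_mx1 mulmx1 ltNge ltW// sqr_gt0//; move/regular_lam: rc; exact.
have sub' : {subset ws <= simple c} by move=> u us; apply: sub; rewrite inE us orbT.
have := IH sub' rr; rewrite [crossed _]/= [word_prod (_ :: _)]/= [count_mem _ _]/= oddD => <-.
have Wg := word_prod_in sub'; set g := word_prod ws in Wg *.
have sc := sub s (mem_head _ _); have rs := simple_refl sc; have /andP[Ws _] := rs.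
rewrite repr_mxM// mulmxA.
have cg0 : lm r (c *m rho g) != 0 by apply: regular_neq0 rr; exact: regular_repr.
have c0 : lm r c != 0 by exact: regular_neq0 rc rr.
(* Between [c g] and [c s g] lies only the hyperplane of [s ^ g], so the sign changes there and
   nowhere else. *)
have [rE|nrs] := eqVneq (s ^ g)%g r.
  have [k _] := lam_conj rs Wg; rewrite rE => kE.
  rewrite /= eqxx /= kE lam_refl// mulrN -kE mulrN oppr_lt0 -leNgt le_eqVlt eq_sym.
  by rewrite mulf_eq0 (negbTE c0) (negbTE cg0).
rewrite /= (negbTE nrs) /=.
have rr' : refl (r ^ g^-1)%g by rewrite refl_conj ?groupV.
have [k k0 kE] := lam_conj rr' Wg; rewrite conjgKV in kE.
have /simpleP[x sx] := sc; have [_ sx0 _] := sx.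
have xs : x *m rho s = x by apply/fixed_lam.
have nprop : ~ proportional (r ^ g^-1)%g s.
  move=> /(proportional_eq rr' rs) E; move/eqP: nrs; apply.
  by rewrite -E conjgKV.
have := wall_stab_sign sx Ws xs rr' nprop.
rewrite -(pmulr_rgt0 _ (sqr_gt0 k0)) mulrACA -!kE => H.
rewrite [lm r c * _]mulrC [lm r c * lm r (c *m rho g)]mulrC.
by apply/idP/idP; apply: mul_lt0_trans; rewrite // mulrC.
Qed.

(** Multiplying by the conjugate of a letter deletes that letter: [s * g * s ^ g = g] for an
    involution [s]. *)
Lemma crossed_exchange c t ws : {subset ws <= simple c} -> t \in crossed ws ->
  exists ws', [/\ {subset ws' <= simple c}, size ws = (size ws').+1 &
    (word_prod ws * t = word_prod ws')%g].
Proof.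
elim: ws => // s ws IH sub.
have sub' : {subset ws <= simple c} by move=> u us; apply: sub; rewrite inE us orbT.
have sc := sub s (mem_head _ _); have rs := simple_refl sc.
rewrite /= inE => /orP[/eqP ->|/(IH sub')[ws' [sub'' sz E]]].
  exists ws; split=> //.
  by rewrite -mulgA -conjgC mulgA refl_mulg// mul1g.
exists (s :: ws'); split => [u||]; last by rewrite /= -mulgA E.
  by rewrite inE => /orP[/eqP ->//|/sub''].
by rewrite /= sz.
Qed.

(** No hyperplane separates the ends, so the one crossed by the first letter is crossed an even
    number of times, hence also by the remaining word; the exchange condition then removes two
    letters. *)
Lemma word_prod_free c ws : regular c -> {subset ws <= simple c} ->
  same_side c (c *m rho (word_prod ws)) -> word_prod ws = 1%g.
Proof.
move=> rc; have [N] := ubnP (size ws); elim: N => // N IH in ws *.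
rewrite ltnS => szN sub cw; case: ws => // s ws in szN sub cw *.
have sub' : {subset ws <= simple c} by move=> u us; apply: sub; rewrite inE us orbT.
have Wg := word_prod_in sub'.
have rs := simple_refl (sub s (mem_head _ _)).
have rt : refl (s ^ word_prod ws)%g by exact: refl_conj.
have := crossed_odd rc sub rt; rewrite ltNge ltW /=; last exact: cw.
rewrite eqxx oddD /= => /esym/negbFE odd_t.
have : (s ^ word_prod ws)%g \in crossed ws.
  by rewrite -has_pred1 has_count; apply: odd_gt0.
move=> /(crossed_exchange sub')[ws' [sub'' sz E]].
have E' : word_prod (s :: ws) = word_prod ws'.
  by rewrite -E /= -conjgC.
transitivity (word_prod ws'); first exact: E'.
apply: IH => //; last by rewrite -E'.
by apply: leq_trans szN; rewrite /= sz.
Qed.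

Lemma word_prodP (A : {set gT}) w : w \in <<A>>%g ->
  exists2 ws, {subset ws <= A} & w = word_prod ws.
Proof.
move=> /gen_prodgP[m [u usc ->]]; exists [seq u i | i <- index_enum 'I_m].
  by move=> v /mapP[i _ ->].
elim: (index_enum _) => [|i l IH]; first by rewrite big_nil.
by rewrite big_cons IH.
Qed.

Hypothesis W_reflection : reflection_group rho.

Lemma regular_free c w : regular c -> w \in W -> same_side c (c *m rho w) -> w = 1%g.
Proof.
move=> rc Ww; have : w \in <<simple c>>%g by rewrite reflection_group_simple.
by move=> /word_prodP[ws sub ->]; exact: word_prod_free.
Qed.

(** One of [w] and [w s] keeps [c] on its side of the hyperplane of [s], and neither moves it across
    another one; the action being free, that element is 1. *)
Lemma wall_point_stab c s x w : regular c -> wall_point c s x -> w \in W ->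
  x *m rho w = x -> w = 1%g \/ w = s.
Proof.
move=> rc sx Ww xw; have [rs sx0 _] := sx; have /andP[Ws _] := rs.
have xs : x *m rho s = x by apply/fixed_lam.
have key v : v \in W -> x *m rho v = x -> 0 < lm s (c *m rho v) * lm s c -> v = 1%g.
  move=> Wv xv sv; apply: (regular_free rc) => // r rr; rewrite mulrC.
  have [->//|nrs] := eqVneq r s.
  apply: (wall_stab_sign sx) => // /(proportional_eq rr rs) E.
  by rewrite E eqxx in nrs.
have [|le0] := ltP 0 (lm s (c *m rho w) * lm s c); first by left; exact: key.
right; have : (w * s = 1)%g.
  apply: key; rewrite ?groupM// repr_mxM// mulmxA ?xw// lam_refl// mulNr oppr_gt0.
  rewrite lt_neqAle le0 andbT mulf_neq0//; last exact: regular_neq0 rc rs.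
  by apply: regular_neq0 rs; exact: regular_repr.
by move=> /(congr1 (mulg^~ s)); rewrite mul1g -mulgA refl_mulg// mulg1.
Qed.

End SimplyTransitive.

(** * Real and imaginary parts; regular complex points *)

Section ComplexVectors.
Variable R : realType.
Local Notation C := (Cx R).

Definition reC (z : C) : R := complex.Re z.
Definition imC (z : C) : R := complex.Im z.

Lemma reCD x y : reC (x + y) = reC x + reC y.
Proof. by case: x; case: y. Qed.

Lemma imCD x y : imC (x + y) = imC x + imC y.
Proof. by case: x; case: y. Qed.

Lemma reCN x : reC (- x) = - reC x. Proof. by case: x. Qed.

Lemma imCN x : imC (- x) = - imC x. Proof. by case: x. Qed.

Lemma reC_real (a : R) : reC (toCx R a) = a. Proof. by []. Qed.

Lemma imC_real (a : R) : imC (toCx R a) = 0. Proof. by []. Qed.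

Lemma reCM x y : reC (x * y) = reC x * reC y - imC x * imC y.
Proof. by case: x; case: y. Qed.

Lemma imCM x y : imC (x * y) = reC x * imC y + imC x * reC y.
Proof. by case: x; case: y. Qed.

Lemma reCMr x (a : R) : reC (x * toCx R a) = reC x * a.
Proof. by rewrite reCM imC_real mulr0 subr0. Qed.

Lemma imCMr x (a : R) : imC (x * toCx R a) = imC x * a.
Proof. by rewrite imCM imC_real mulr0 add0r. Qed.

Lemma eqC x y : reC x = reC y -> imC x = imC y -> x = y.
Proof. by case: x => a b; case: y => c d /= -> ->. Qed.

Lemma reC_sum (I : Type) (l : seq I) (F : I -> C) : reC (\sum_(i <- l) F i) = \sum_(i <- l) reC (F i).
Proof. by elim: l => [|i l IH]; rewrite ?big_nil// !big_cons reCD IH. Qed.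

Lemma imC_sum (I : Type) (l : seq I) (F : I -> C) : imC (\sum_(i <- l) F i) = \sum_(i <- l) imC (F i).
Proof. by elim: l => [|i l IH]; rewrite ?big_nil// !big_cons imCD IH. Qed.

Lemma norm_reC_lt (z : C) (e : R) : `|z| < toCx R e -> `|reC z| < e.
Proof.
move=> ze; have := le_lt_trans (normc_ge_Re z) ze.
by rewrite [toCx R e]/(e%:C)%C ltcR.
Qed.

Lemma norm_imC_lt (z : C) (e : R) : `|z| < toCx R e -> `|imC z| < e.
Proof.
have -> : imC z = reC (- 'i%C * z) by case: z => a b; rewrite /imC /reC /=; ring.
move=> ze; apply: norm_reC_lt; rewrite normrM normrN.
by rewrite (_ : `|'i%C| = 1) ?mul1r// normc_def /= expr0n expr1n add0r sqrtr1.
Qed.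

Lemma continuous_reC : continuous reC.
Proof.
move=> z; have FF : ProperFilter (nbhs z) := nbhs_pfilter z.
apply/(cvgrPdist_lt (FF := FF)) => e e0.
have e0' : 0 < toCx R e by rewrite [toCx R e]/(e%:C)%C ltcR.
near=> y; rewrite -reCN -reCD; apply: norm_reC_lt.
by near: y; exact: (@cvgr_dist_lt _ _ _ _ FF idfun _ (@cvg_id _ _) _ e0').
Unshelve. all: by end_near. Qed.

Lemma continuous_imC : continuous imC.
Proof.
move=> z; have FF : ProperFilter (nbhs z) := nbhs_pfilter z.
apply/(cvgrPdist_lt (FF := FF)) => e e0.
have e0' : 0 < toCx R e by rewrite [toCx R e]/(e%:C)%C ltcR.
near=> y; rewrite -imCN -imCD; apply: norm_imC_lt.
by near: y; exact: (@cvgr_dist_lt _ _ _ _ FF idfun _ (@cvg_id _ _) _ e0').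
Unshelve. all: by end_near. Qed.

Lemma continuous_toCx : continuous (toCx R : R -> C).
Proof.
move=> x; have FF : ProperFilter (nbhs x) := nbhs_pfilter x.
apply/(cvgrPdist_lt (FF := FF)) => e e0.
(* The radius [e] is an element of [Cx R]; being positive there, it is real. *)
have eE : e = toCx R (reC e).
  by apply: eqC; rewrite // imC_real; move: e0; rewrite ltcE => /andP[/eqP].
have e0' : 0 < reC e by move: e0; rewrite {1}eE [toCx R _]/(_%:C)%C ltcR.
near=> y; rewrite -rmorphB eE normc_def /= expr0n addr0 sqrtr_sqr ltcR.
by near: y; exact: (@cvgr_dist_lt _ _ _ _ FF idfun _ (@cvg_id _ _) _ e0').
Unshelve. all: by end_near. Qed.

Definition reV n (z : 'rV[C]_n) : 'rV[R]_n := \row_j reC (z 0 j).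
Definition imV n (z : 'rV[C]_n) : 'rV[R]_n := \row_j imC (z 0 j).

Lemma eqV n (z z' : 'rV[C]_n) : reV z = reV z' -> imV z = imV z' -> z = z'.
Proof.
move=> /rowP re /rowP im; apply/rowP => j.
by have := re j; have := im j; rewrite !mxE => ? ?; exact: eqC.
Qed.

Lemma reV_mul n p (z : 'rV[C]_n) (A : 'M[R]_(n, p)) : reV (z *m map_mx (toCx R) A) = reV z *m A.
Proof.
apply/rowP => j; rewrite !mxE reC_sum; apply: eq_bigr => i _.
by rewrite !mxE reCMr.
Qed.

Lemma imV_mul n p (z : 'rV[C]_n) (A : 'M[R]_(n, p)) : imV (z *m map_mx (toCx R) A) = imV z *m A.
Proof.
apply/rowP => j; rewrite !mxE imC_sum; apply: eq_bigr => i _.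
by rewrite !mxE imCMr.
Qed.

Lemma reVD n (x y : 'rV[C]_n) : reV (x + y) = reV x + reV y.
Proof. by apply/rowP => j; rewrite !mxE reCD. Qed.

Lemma imVD n (x y : 'rV[C]_n) : imV (x + y) = imV x + imV y.
Proof. by apply/rowP => j; rewrite !mxE imCD. Qed.

Lemma reV_cvec n (x : 'rV[R]_n) : reV (cvec x) = x.
Proof. by apply/rowP => j; rewrite !mxE. Qed.

Lemma imV_cvec n (x : 'rV[R]_n) : imV (cvec x) = 0.
Proof. by apply/rowP => j; rewrite !mxE. Qed.

Lemma reVZ n (k : C) (x : 'rV[R]_n) : reV (k *: cvec x) = reC k *: x.
Proof. by apply/rowP => j; rewrite !mxE reCMr. Qed.

Lemma imVZ n (k : C) (x : 'rV[R]_n) : imV (k *: cvec x) = imC k *: x.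
Proof. by apply/rowP => j; rewrite !mxE imCMr. Qed.

Lemma continuous_reV n : continuous (@reV n).
Proof.
apply: continuous_rowvec => j z; rewrite (_ : (fun t => _) = reC \o (fun z : 'rV[C]_n => z 0 j)).
  exact: (continuous_comp (@coord_continuous C 1 n 0 j z) (@continuous_reC _)).
by apply/funext => y; rewrite mxE.
Qed.

Lemma continuous_imV n : continuous (@imV n).
Proof.
apply: continuous_rowvec => j z; rewrite (_ : (fun t => _) = imC \o (fun z : 'rV[C]_n => z 0 j)).
  exact: (continuous_comp (@coord_continuous C 1 n 0 j z) (@continuous_imC _)).
by apply/funext => y; rewrite mxE.
Qed.

Lemma continuous_cvec n : continuous (@cvec R n).
Proof.
apply: continuous_rowvec => j x; rewrite (_ : (fun t => _) = toCx R \o (fun x : 'rV[R]_n => x 0 j)).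
  exact: (continuous_comp (@coord_continuous R 1 n 0 j x) (@continuous_toCx _)).
by apply/funext => y; rewrite mxE.
Qed.

End ComplexVectors.

Section ComplexRegular.
Variables (R : realType) (gT : finGroupType) (W : {group gT}) (n : nat).
Variable rho : mx_representation R W n.
Implicit Types (r s w : gT) (x y c d : 'rV[R]_n) (z : 'rV[Cx R]_n).
Local Notation refl := (is_reflection rho).
Local Notation lm := (lam rho).
Local Notation same_side := (same_side rho).

Lemma crepr_regularP z : regular_pts (crepr rho) z <->
  forall r, refl r -> lm r (reV z) != 0 \/ lm r (imV z) != 0.
Proof.
have fixE r : refl r -> fixed_space (crepr rho) r z <-> lm r (reV z) = 0 /\ lm r (imV z) = 0.
  move=> rr; rewrite -!fixed_lam// /fixed_space /=; split=> [zr|[re im]].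
    by rewrite -reV_mul -imV_mul zr.
  by apply: eqV; rewrite ?reV_mul ?imV_mul.
rewrite regularP; split=> H r.
  move=> rr; have := H r; rewrite is_reflection_crepr => /(_ rr) nz.
  have [e0|] := eqVneq (lm r (reV z)) 0; last by left.
  right; apply/eqP => e1; exact/nz/fixE.
rewrite is_reflection_crepr => rr /(fixE _ rr)[e0 e1].
by case: (H r rr); rewrite ?e0 ?e1 eqxx.
Qed.

Hypotheses (rho_faithful : mx_faithful rho) (W_reflection : reflection_group rho).

(** [w] fixes [Re z] and [Im z], hence also [Re z + e Im z], a regular real point for small [e > 0],
    and it permutes the real chambers freely. *)
Lemma complex_free z w : regular_pts (crepr rho) z -> w \in W ->
  z *m crepr rho w = z -> w = 1%g.
Proof.
move=> /crepr_regularP rz Ww zw.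
have aw : reV z *m rho w = reV z by rewrite -reV_mul zw.
have bw : imV z *m rho w = imV z by rewrite -imV_mul zw.
have : \forall e \near (0 : R)^'+, forall r, refl r -> lm r (reV z + e *: imV z) != 0.
  apply: filter_forall => r; have [rr|_] := boolP (refl r); last exact: filterE.
  have := near_affine_neq0 (p := lm r (reV z)) (q := lm r (imV z)).
  have -> : (lm r (reV z) != 0) || (lm r (imV z) != 0) by apply/orP; exact: rz.
  by move=> /(_ isT); apply: filterS => e H _; rewrite lamD lamZ.
move=> /filter_ex[e /(regular_lam rho) re].
apply: (regular_free rho_faithful W_reflection re Ww).
by rewrite mulmxDl -scalemxAl aw bw; exact: same_side_refl.
Qed.

End ComplexRegular.

Import Invariants InvariantRing WallGeometry QuotientReflections.

(** * The reflection group [W / G] on [V] *)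

Section GoodQuotient.
Variables (R : realType) (gT : finGroupType) (W G : {group gT}) (n m : nat).
Variables (rho : mx_representation R W n) (f : m.-tuple (mpoly.mpoly n R)).
Variables (rhoq : mx_representation R (W / G)%G m).
Hypotheses (rho_faithful : mx_faithful rho) (W_reflection : reflection_group rho).
Hypotheses (G_normal : normal G W) (f_splitting : graded_splitting G rho f).
Hypothesis f_act : induced_action W rho rhoq f.
Local Notation refl := (is_reflection rho).
Local Notation reflq := (is_reflection rhoq).
Local Notation cl := (coset G).
Implicit Types (x c : 'rV[R]_n) (z : 'rV[Cx R]_n) (s w g : gT).

Let GW : G \subset W := normal_sub G_normal.

Let WG_coset (c : coset_of G) : c \in (W / G)%g -> exists2 w, w \in W & c = cl w.
Proof. by move=> /morphimP[w _ Ww ->]; exists w. Qed.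

Lemma cmap_cvec x : cmap f (cvec x) = cvec (rmap f x).
Proof. exact: mpoly_fun_map. Qed.

Lemma rmap_act x w : w \in W -> rmap f (x *m rho w) = rmap f x *m rhoq (cl w).
Proof. by move=> Ww; exact: induced_actionE f_act Ww. Qed.

(** [z w] and [z] have the same image, so they lie in one [G]-orbit. *)
Lemma cmap_fixed z w : w \in W -> cmap f z *m crepr rhoq (cl w) = cmap f z ->
  exists2 g, g \in G & z *m crepr rho (w * g)%g = z.
Proof.
move=> Ww; rewrite -(cmap_act f_act z Ww) => zw.
have [g Gg E] := orbit_separation GW (invariants_generated f_splitting) zw.
exists g => //; rewrite (repr_mxM (crepr rho) Ww (fintype.subsetP GW _ Gg)) mulmxA.
exact: esym E.
Qed.

Lemma rmap_fixed x w : w \in W -> rmap f x *m rhoq (cl w) = rmap f x ->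
  exists2 g, g \in G & x *m rho (w * g)%g = x.
Proof.
move=> Ww xw; have [|g Gg] := @cmap_fixed (cvec x) w Ww.
  by rewrite cmap_cvec /cvec -map_mxM xw.
by rewrite /cvec -map_mxM => /map_mx_inj; exists g.
Qed.

(** A reflection [q(w)] fixing [p(z)] has a lift [w g] that fixes [z] and is therefore 1; then
    [q(w) = 1], which is no reflection. *)
Lemma cmap_regular z : regular_pts (crepr rho) z -> regular_pts (crepr rhoq) (cmap f z).
Proof.
move=> rz; apply/regularP => c /[dup] rc /andP[/WG_coset[w Ww cw] _] fc.
have [|g Gg zwg] := @cmap_fixed z w Ww; first by rewrite -cw.
have /eqP : (w * g)%g = 1%g.
  by apply: (complex_free rho_faithful W_reflection rz) zwg; rewrite groupM// (fintype.subsetP GW _ Gg).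
rewrite -eq_invg_mul => /eqP wg.
have c1 : c = 1%g by rewrite cw coset_id// -groupV wg.
move: rc; rewrite is_reflection_crepr c1 => rc.
by have [y] := lam_neq0 rc; rewrite (proj1 (fixed_lam y rc)) ?eqxx// repr_mx1 mulmx1.
Qed.

Variables (Ct : set 'rV[R]_n) (x0 : 'rV[R]_n).
Hypotheses (Ct_chamber : is_chamber rho Ct) (Ct_x0 : Ct x0).

Let rx0 : regular_pts rho x0 := chamber_regular Ct_chamber Ct_x0.

Lemma rhoq_faithful : mx_faithful rhoq.
Proof.
apply/fintype.subsetP => c; rewrite inE => /andP[Wc /eqP]; rewrite mul1mx => c1.
have [w Ww cw] := WG_coset Wc.
have [|g Gg xwg] := @rmap_fixed x0 w Ww; first by rewrite -cw c1 mulmx1.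
have /eqP : (w * g)%g = 1%g.
  apply: (regular_free rho_faithful W_reflection rx0); rewrite ?groupM ?(fintype.subsetP GW _ Gg)//.
  by rewrite xwg; exact: same_side_refl.
rewrite -eq_invg_mul => /eqP wg.
by rewrite cw coset_id ?inE// -groupV wg.
Qed.

Lemma wall_G_free s x g : wall_point rho x0 s x -> s \notin G -> g \in G ->
  x *m rho g = x -> g = 1%g.
Proof.
move=> sx sG Gg xg.
have := wall_point_stab rho_faithful W_reflection rx0 sx (fintype.subsetP GW _ Gg) xg.
by case=> // E; rewrite -E Gg in sG.
Qed.

Hypothesis f_good : good (map_mpolys (toCx R) f) (W / G)%G (crepr rhoq).

Section Wall.
Variables (s : gT) (x : 'rV[R]_n).
Hypotheses (rs : refl s) (sG : s \notin G) (sx : lam rho s x = 0).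
Hypothesis xG : forall g, g \in G -> x *m rho g = x -> g = 1%g.

Let Ws : s \in W. Proof. by case/andP: rs. Qed.

Let ss : (s * s = 1)%g. Proof. exact: (refl_mulg rho_faithful rs). Qed.

Let root_s : is_root rho s (root rho s). Proof. exact: rootP. Qed.

(** Rank at most 1 comes from the computation over the complex numbers, rank at least 1 from
    faithfulness of [rhoq], as [s] is not in [G]. *)
Lemma quotient_reflection : reflq (cl s).
Proof.
have Wcs : cl s \in (W / G)%g by exact: mem_quotient.
have [[d md [[r rI] _]] triv] := f_good.
have [su vu] := root_s.
have rk : (\rank (rhoq (cl s) - 1%:M)%R <= 1)%N.
  rewrite -(mxrank_map (toCx R)) map_mxB map_mx1.
  apply: (@quotient_reflection_rank (Cx R) gT W G n m (crepr rho)
    (map_mpolys (toCx R) f) (crepr rhoq) G_normal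
    (map_induced_action (toCx R) f_act)
    (invariants_generated_map GW (invariants_generated f_splitting))
    (fun i => splitting_coef0 (toCx R) i f_splitting) s
    (map_mx (toCx R) (root rho s).1) (map_mx (toCx R) (root rho s).2) Ws ss _ _
    (cvec x) _ _ d r rI).
  - by rewrite /= /map_repr_mx su map_mxD map_mx1 map_mxM.
  - by rewrite -map_mxM vu map_scalar_mx /= rmorphN rmorph_nat.
  - rewrite /cvec -map_mxM [x *m _]mx11_scalar -/(lam rho s x) sx.
    by apply/matrixP => a b; rewrite !mxE mul0rn rmorph0.
  - move=> g Gg; rewrite /= /map_repr_mx /cvec -map_mxM => /map_mx_inj; exact: xG.
  - by move=> a; exact: triv.
rewrite /is_reflection Wcs /= /eigenspace mxrank_ker.
have rk0 : (\rank (rhoq (cl s) - 1%:M)%R != 0)%N.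
  rewrite mxrank_eq0 subr_eq0; apply: contra sG => /eqP c1.
  have : cl s = 1%g.
    by apply: (mx_faithful_inj rhoq_faithful); rewrite ?group1// repr_mx1.
  by move/(coset_idr (fintype.subsetP (normal_norm G_normal) _ Ws)).
have rk1 : \rank (rhoq (cl s) - 1%:M)%R = 1%N by apply/eqP; rewrite eqn_leq rk lt0n.
have m0 : (0 < m)%N by rewrite -rk1 rank_leq_row.
by rewrite rk1 subn1 prednK.
Qed.

(* The linear form of the reflection s of V pulls back to the form of s on the
   original space times Phi, and Phi does not vanish at the wall. *)
Lemma transverse_factor : exists Phi : 'rV[Cx R]_n -> Cx R, [/\ continuous Phi,
    imC (Phi (cvec x)) = 0, reC (Phi (cvec x)) != 0 &
    forall (h l : 'rV[R]_n) (k : Cx R), lam rho s h = 0 ->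
      let z := cvec h + k *: cvec l in
      lam rhoq (cl s) (reV (cmap f z)) = lam rho s l * reC (k * Phi z) /\
      lam rhoq (cl s) (imV (cmap f z)) = lam rho s l * imC (k * Phi z)].
Proof.
have [su vu] := root_s; have [su' vu'] := rootP quotient_reflection.
set u := (root rho s).1 in su vu; set u' := (root rhoq (cl s)).1 in su' vu'.
have anti := pullback_anti f_act Ws su' vu'.
have [phi phiE] := anti_divisible su anti.
have xu : x *m u = 0.
  by rewrite [x *m u]mx11_scalar -/(lam rho s x) sx; apply/matrixP => a b; rewrite !mxE mul0rn.
have phix : point_eval x phi != 0.
  exact: (pullback_transverse G_normal f_act (invariants_generated f_splitting)
    Ws ss su vu xu xG su' phiE).
exists (fun z => point_eval z (mpoly.map_mpoly (toCx R) phi)); split.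
- have c1 := @continuous_mpoly_fun (Cx R) n 1 [tuple mpoly.map_mpoly (toCx R) phi].
  rewrite (_ : (fun z => _) = (fun y : 'rV_1 => y 0 0) \o
    mpoly_fun [tuple mpoly.map_mpoly (toCx R) phi]); last first.
    by apply/funext => y /=; rewrite mxE.
  by move=> z; exact: (continuous_comp (c1 z) (@coord_continuous (Cx R) 1 1 0 0 _)).
- by rewrite point_eval_map.
- by rewrite point_eval_map.
move=> h l k sh z.
have E : (cmap f z *m map_mx (toCx R) u') 0 0 =
    k * toCx R (lam rho s l) * point_eval z (mpoly.map_mpoly (toCx R) phi).
  rewrite -point_eval_linear -map_linear_form -point_eval_comp -map_mpoly_comp phiE.
  rewrite map_mpoly_mul point_evalM map_linear_form point_eval_linear; congr (_ * _).
  rewrite /z mulmxDl -scalemxAl /cvec -!map_mxM mxE [X in X + _]mxE [X in _ + X]mxE.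
  by rewrite [X in _ + _ * X]mxE -/(lam rho s h) sh rmorph0 add0r.
split.
  transitivity (reC ((cmap f z *m map_mx (toCx R) u') 0 0)).
    by rewrite /lam -reV_mul mxE.
  by rewrite E mulrAC reCMr mulrC.
transitivity (imC ((cmap f z *m map_mx (toCx R) u') 0 0)).
  by rewrite /lam -imV_mul mxE.
by rewrite E mulrAC imCMr mulrC.
Qed.

End Wall.

(** The simple reflections generate [W], and each maps to 1 or to a reflection. *)
Lemma quotient_reflection_group : reflection_group rhoq.
Proof.
apply/eqP; rewrite finset.eqEsubset gen_subG; apply/andP; split.
  by apply/fintype.subsetP => c; rewrite inE => /andP[].
rewrite /= /quotient -{1}(reflection_group_simple W_reflection rx0) morphim_gen; last first.
  apply: (fintype.subset_trans _ (normal_norm G_normal)).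
  by apply/fintype.subsetP => s /simple_refl/andP[].
rewrite gen_subG; apply/fintype.subsetP => c /morphimP[s _ sx0 ->].
have [sG|sG] := boolP (s \in G); first by rewrite /= coset_id ?group1.
rewrite mem_gen// inE; have /simpleP[x sx] := sx0.
have [rs sx00 _] := sx; apply: (quotient_reflection rs sG sx00) => g.
exact: wall_G_free sx sG.
Qed.

End GoodQuotient.

Section PathLimits.
Variable R : realType.

Lemma within_at_left (T : topologicalType) (g : R -> T) :
  {within `[0, 1], continuous g} -> g t @[t --> (1:R)^'-] --> g 1.
Proof.
move=> /subspace_continuousP cg A nA.
have /cg/(_ A nA) : `[0, 1]%classic (1 : R) by rewrite /= in_itv /= ler01 lexx.
rewrite /= /nbhs /= /within /= => H.
have H1 : \forall t \near (1 : R), t < 1 -> 0 < t -> A (g t).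
  apply: (@filterS _ _ (nbhs_filter (1 : R)) _ _ _ H) => t /= Ht t1 t0.
  by apply: Ht; rewrite in_itv /= !ltW.
have H2 : \forall t \near (1 : R)^'-, 0 < t -> A (g t) := H1.
by apply: filterS2 H2 (nbhs_left_gt (ltr01 : (0 : R) < 1)) => t Ht t0; exact: Ht.
Qed.

End PathLimits.

(** * Fundamental groups of orbit spaces *)

Section StarRegions.
Variables (R : realType) (gT : finGroupType) (W : {group gT}) (n : nat).
Variable rho : mx_representation R W n.
Implicit Types (r s w : gT) (x y c d b : 'rV[R]_n) (z : 'rV[Cx R]_n).
Local Notation refl := (is_reflection rho).
Local Notation lm := (lam rho).
Local Notation regular := (regular_pts rho).
Local Notation same_side := (same_side rho).
Local Notation M := (regular_pts (crepr rho)).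

Lemma crepr_regular_repr z w : w \in W -> M z -> M (z *m crepr rho w).
Proof.
move=> Ww /crepr_regularP Mz; apply/crepr_regularP => r rr; rewrite reV_mul imV_mul.
have rr' : refl (r ^ w^-1)%g by rewrite refl_conj ?groupV.
have [l l0] := lam_conj rr' Ww; rewrite conjgKV => lE.
by rewrite !lE !mulf_eq0 !negb_or l0 /=; exact: Mz.
Qed.

Definition star b z :=
  forall r, refl r -> lm r (reV z) != 0 \/ 0 < lm r (imV z) * lm r b.

Lemma star_regular b z : star b z -> M z.
Proof.
move=> bz; apply/crepr_regularP => r rr; case: (bz r rr) => [|H]; first by left.
by right; apply: contraTneq H => ->; rewrite mul0r ltxx.
Qed.

Lemma star_real b c : regular c -> star b (cvec c).
Proof. by move=> rc r rr; left; rewrite reV_cvec; exact: regular_neq0. Qed.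

Lemma star_repr b z w : w \in W -> star b z -> star (b *m rho w) (z *m crepr rho w).
Proof.
move=> Ww bz r rr; have rr' : refl (r ^ w^-1)%g by rewrite refl_conj ?groupV.
have [l l0] := lam_conj rr' Ww; rewrite conjgKV => lE.
rewrite reV_mul imV_mul !lE mulf_eq0 negb_or l0 /= mulrACA.
by case: (bz _ rr') => H; [left|right; rewrite mulr_gt0// sqr_gt0].
Qed.

Lemma near_star b z : star b z -> \forall z' \near z, star b z'.
Proof.
move=> bz; apply: (filter_forall (nbhs_filter z)) => r.
have [rr|_] := boolP (refl r); last by apply: (@filterE _ _ (nbhs_filter z)).
have cre : {for z, continuous (fun z => lm r (reV z))}.
  exact: (continuous_comp (@continuous_reV R n z) (@continuous_lam _ _ _ _ rho r _)).
have cim : {for z, continuous (fun z => lm r (imV z))}.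
  exact: (continuous_comp (@continuous_imV R n z) (@continuous_lam _ _ _ _ rho r _)).
case: (bz r rr) => H.
  have nb : nbhs (lm r (reV z)) [set t | t != 0].
    by apply: open_nbhs_nbhs; split => //; exact: open_neq.
  by apply: (@filterS _ _ (nbhs_filter z) _ _ _ (cre _ nb)) => z' /= ? _; left.
have cm : {for z, continuous (fun z => lm r (imV z) * lm r b)}.
  exact: (cvgM cim (@cst_continuous _ _ (lm r b) z)).
have nb : nbhs (lm r (imV z) * lm r b) [set t | 0 < t].
  by apply: open_nbhs_nbhs; split => //; exact: open_gt.
by apply: (@filterS _ _ (nbhs_filter z) _ _ _ (cm _ nb)) => z' /= ? _; right.
Qed.

(** [b] is [Im z] pushed slightly towards [c]. Where a form vanishes at [Im z], regularity of [z]
    makes it nonzero at [Re z]. *)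
Lemma star_cover c z : regular c -> M z -> exists2 b, regular b & star b z.
Proof.
move=> rc /crepr_regularP Mz.
have : \forall e \near (0 : R)^'+, forall r, refl r -> lm r (imV z + e *: c) != 0 /\
    (lm r (imV z) != 0 -> 0 < lm r (imV z) * lm r (imV z + e *: c)).
  apply: filter_forall => r; have [rr|_] := boolP (refl r); last exact: filterE.
  have c0 := regular_neq0 rc rr.
  have := near_affine_neq0 (p := lm r (imV z)) (q := lm r c); rewrite c0 orbT => /(_ isT).
  have [z0|z0] := eqVneq (lm r (imV z)) 0.
    apply: filterS => e H _; split; last by rewrite ?z0 ?eqxx.
    by rewrite lamD lamZ.
  have := near_affine_gt0 (lm r (imV z) * lm r c) (sqr_gt0 z0).
  apply: filterS2 => e H H' _; split; first by rewrite lamD lamZ.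
  by move=> _; rewrite lamD lamZ mulrDr mulrCA.
move=> /filter_ex[e He]; exists (imV z + e *: c).
  by apply/regular_lam => r /He[].
by move=> r rr; case: (Mz r rr) => H; [left|right; have [_] := He r rr; exact].
Qed.

(* The real part of z lies in the closure of the chamber of c. *)
Definition adherent z c :=
  forall r, refl r -> lm r (reV z) = 0 \/ 0 < lm r (reV z) * lm r c.

Lemma adherent_exists c z : regular c -> exists2 w, w \in W & adherent z (c *m rho w).
Proof.
move=> rc.
have : \forall e \near (0 : R)^'+, forall r, refl r -> lm r (reV z + e *: c) != 0 /\
    (lm r (reV z) != 0 -> 0 < lm r (reV z) * lm r (reV z + e *: c)).
  apply: filter_forall => r; have [rr|_] := boolP (refl r); last exact: filterE.
  have c0 := regular_neq0 rc rr.
  have := near_affine_neq0 (p := lm r (reV z)) (q := lm r c); rewrite c0 orbT => /(_ isT).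
  have [z0|z0] := eqVneq (lm r (reV z)) 0.
    apply: filterS => e H _; split; last by rewrite ?z0 ?eqxx.
    by rewrite lamD lamZ.
  have := near_affine_gt0 (lm r (reV z) * lm r c) (sqr_gt0 z0).
  apply: filterS2 => e H H' _; split; first by rewrite lamD lamZ.
  by move=> _; rewrite lamD lamZ mulrDr mulrCA.
move=> /filter_ex[e He].
have rd : regular (reV z + e *: c) by apply/regular_lam => r /He[].
have [w /(fintype.subsetP (gen_simple_sub _ _)) Ww cw] := transitive_simple rc rd.
exists w => // r rr; have [z0|z0] := eqVneq (lm r (reV z)) 0; first by left.
by right; apply: mul_gt0_trans ((He r rr).2 z0) _; rewrite mulrC; exact: cw.
Qed.

Definition segment z z' (t : R) := toCx R (1 - t) *: z + toCx R t *: z'.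

Lemma segment_re z z' t : reV (segment z z' t) = (1 - t) *: reV z + t *: reV z'.
Proof. by apply/rowP => j; rewrite !mxE reCD !reCM !imC_real !reC_real !mul0r !subr0. Qed.

Lemma segment_im z z' t : imV (segment z z' t) = (1 - t) *: imV z + t *: imV z'.
Proof. by apply/rowP => j; rewrite !mxE imCD !imCM !imC_real !reC_real !mul0r !addr0. Qed.

Lemma segment0 z z' : segment z z' 0 = z.
Proof. by rewrite /segment subr0 rmorph1 rmorph0 scale1r scale0r addr0. Qed.

Lemma segment1 z z' : segment z z' 1 = z'.
Proof. by rewrite /segment subrr rmorph1 rmorph0 scale1r scale0r add0r. Qed.

Definition center b : 'rV[Cx R]_n := ('i%C : Cx R) *: cvec b.

Lemma star_segment b z t : regular b -> star b z -> 0 <= t <= 1 ->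
  star b (segment (center b) z t).
Proof.
move=> rb bz /andP[t0 t1] r rr; have b0 := regular_neq0 rb rr.
rewrite segment_re segment_im /center reVZ imVZ /= scale0r scaler0 add0r scale1r.
have [->|tn0] := eqVneq t 0.
  by right; rewrite subr0 scale1r scale0r addr0 sqr_gt0.
have tp : 0 < t by rewrite lt_neqAle eq_sym tn0.
rewrite lamZ lamD !lamZ; case: (bz r rr) => H; [left|right]; first by rewrite mulf_neq0.
rewrite mulrDl ltr_wpDl// -mulrA; last exact: mulr_gt0.
by rewrite mulr_ge0 ?subr_ge0// ltW// sqr_gt0.
Qed.

(** For [t < 1] the real part combines [c], with positive weight, and a point in the closure of its
    chamber, so it is regular. *)
Lemma star_adherent b z c t : star b z -> adherent z c -> regular c -> 0 <= t <= 1 ->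
  star b (segment (cvec c) z t).
Proof.
move=> bz zc rc /andP[t0 t1] r rr; have c0 := regular_neq0 rc rr.
rewrite segment_re segment_im reV_cvec imV_cvec scaler0 add0r lamD !lamZ.
have [->|tn1] := eqVneq t 1.
  by rewrite subrr mul0r add0r !mul1r; exact: bz.
have tp : 0 < 1 - t by rewrite subr_gt0 lt_neqAle tn1.
left; case: (zc r rr) => [->|H]; first by rewrite mulr0 addr0 mulf_neq0// gt_eqF.
apply/eqP => E.
have : lm r c * ((1 - t) * lm r c + t * lm r (reV z)) = 0 by rewrite E mulr0.
have : 0 < (1 - t) * (lm r c * lm r c) by rewrite mulr_gt0// sqr_gt0.
have : 0 <= t * (lm r (reV z) * lm r c) by rewrite mulr_ge0// ltW.
nra.
Qed.

End StarRegions.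

(** * Paths in the orbit space and contraction of a star *)

Section OrbitPaths.
Variables (R : realType) (gT : finGroupType) (W : {group gT}) (n : nat).
Variable rho : mx_representation R W n.
Implicit Types (r s w : gT) (x y c d b : 'rV[R]_n) (z : 'rV[Cx R]_n).
Local Notation refl := (is_reflection rho).
Local Notation regular := (regular_pts rho).
Local Notation M := (regular_pts (crepr rho)).
Local Notation star := (star rho).
Local Notation X := (orbit_space (crepr rho)).

Variable base : set_type M.

(** Total on vectors, so that it composes with paths of vectors; a point that is not regular is sent
    to the class of [base]. *)
Definition orb z : X := orbit_class (insubd base z).

Lemma val_orb z : M z -> \val (insubd base z) = z.
Proof. by move=> Mz; rewrite val_insubd mem_set. Qed.

Lemma orb_val (y : set_type M) : orb (\val y) = orbit_class y.
Proof. by rewrite /orb valKd. Qed.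

Lemma orb_surj (q : X) : exists2 z, M z & orb z = q.
Proof.
exists (\val (repr q)); first exact: set_valP.
by rewrite orb_val; exact: reprK.
Qed.

Lemma orb_repr z w : M z -> w \in W -> orb (z *m crepr rho w) = orb z.
Proof.
move=> Mz Ww; apply/esym/Defs.orbitP/exists_inP; exists w => //.
have Mw := crepr_regular_repr Ww Mz.
by rewrite !val_orb.
Qed.

Lemma orbP z z' : M z -> M z' -> orb z = orb z' -> exists2 w, w \in W & z *m crepr rho w = z'.
Proof.
move=> Mz Mz'; rewrite /orb => /Defs.orbitP/exists_inP[w Ww /eqP E]; exists w => //.
by move: E; rewrite !val_orb.
Qed.

Lemma within_rowvec (U : topologicalType) (K : numFieldType) p (A : set U) (g : U -> 'rV[K]_p) :
  (forall j, {within A, continuous (fun u => g u 0 j)}) -> {within A, continuous g}.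
Proof. by move=> cg; apply: (@continuous_rowvec K (subspace A)). Qed.

Lemma within_coord (U : topologicalType) (K : numFieldType) p (A : set U) (g : U -> 'rV[K]_p) j :
  {within A, continuous g} -> {within A, continuous (fun u => g u 0 j)}.
Proof.
move=> cg u; apply: (@continuous_comp (subspace A) _ _ g (fun x : 'rV[K]_p => x 0 j)); first exact: cg.
exact: coord_continuous.
Qed.

Lemma within_toCx (U : topologicalType) (A : set U) (a : U -> R) :
  {within A, continuous a} -> {within A, continuous (toCx R \o a)}.
Proof.
move=> ca u; apply: (@continuous_comp (subspace A) _ _ a (toCx R)); first exact: ca.
exact: continuous_toCx.
Qed.

Lemma within_lincomb (U : topologicalType) p (A : set U) (a a' : U -> Cx R) (g g' : U -> 'rV[Cx R]_p) :
  {within A, continuous a} -> {within A, continuous a'} ->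
  {within A, continuous g} -> {within A, continuous g'} ->
  {within A, continuous (fun u => a u *: g u + a' u *: g' u)}.
Proof.
move=> ca ca' cg cg'; apply: within_rowvec => j.
rewrite (_ : (fun u => _) = fun u => a u * g u 0 j + a' u * g' u 0 j); last first.
  by apply/funext => u; rewrite !mxE.
have cgj := within_coord (j := j) cg; have cgj' := within_coord (j := j) cg'.
by move=> u; exact: (cvgD (cvgM (ca u) (cgj u)) (cvgM (ca' u) (cgj' u))).
Qed.

Lemma within_orb (U : topologicalType) (A : set U) (k : U -> 'rV[Cx R]_n) :
  {within A, continuous k} -> (forall u, A u -> M (k u)) ->
  {within A, continuous (orb \o k)}.
Proof.
move=> ck kM u.
have cv : continuous (((\val : set_type M -> _) \o (insubd base \o k)) : subspace A -> _).
  by apply: within_ext ck => v Av /=; rewrite val_orb//; exact: kM.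
have ci : continuous ((insubd base \o k : subspace A -> set_type M)).
  by apply: continuous_comp_initial; exact: cv.
exact: (continuous_comp (ci u) (@pi_continuous _ _ _)).
Qed.

Definition star_path b z z' p :=
  is_path z z' p /\ forall t : R, 0 <= t <= 1 -> star b (p t).

Lemma segment_path z z' : is_path z z' (segment z z').
Proof.
split; rewrite ?segment0 ?segment1//.
have c1 : continuous (fun t : R => 1 - t).
  by move=> t; apply: cvgB; [exact: cvg_cst|exact: cvg_id].
have c2 : continuous (id : R -> R) by move=> t; exact: cvg_id.
have cz (z0 : 'rV[Cx R]_n) : {within `[0, 1], continuous ((fun=> z0) : R -> 'rV[Cx R]_n)}.
  by apply: continuous_subspaceT => t; exact: cvg_cst.
exact: (within_lincomb (within_toCx (continuous_subspaceT c1))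
  (within_toCx (continuous_subspaceT c2)) (cz z) (cz z')).
Qed.

Lemma is_path_orb z z' p : is_path z z' p -> (forall t : R, 0 <= t <= 1 -> M (p t)) ->
  is_path (orb z) (orb z') (orb \o p).
Proof.
move=> [cp p0 p1] pM; split; rewrite /= ?p0 ?p1//; exact: within_orb.
Qed.

Lemma star_path_orb b z z' p : star_path b z z' p -> is_path (orb z) (orb z') (orb \o p).
Proof. by move=> [pp sp]; apply: is_path_orb pp _ => t /sp /star_regular. Qed.

Lemma star_path_cat b z z' z'' p q : star_path b z z' p -> star_path b z' z'' q ->
  star_path b z z'' (path_cat p q).
Proof.
move=> [pp sp] [pq sq]; split; first exact: is_path_cat pp pq.
move=> t /andP[t0 t1]; rewrite /path_cat; case: ifPn => t2.
  by apply: sp; apply/andP; split; lra.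
by apply: sq; apply/andP; split; rewrite -ltNge in t2; lra.
Qed.

Lemma star_path_rev b z z' p : star_path b z z' p -> star_path b z' z (path_rev p).
Proof.
move=> [pp sp]; split; first exact: is_path_rev.
by move=> t /andP[t0 t1]; apply: sp; apply/andP; split; lra.
Qed.

Lemma star_path_repr b z z' p w : w \in W -> star_path b z z' p ->
  star_path (b *m rho w) (z *m crepr rho w) (z' *m crepr rho w) (fun t => p t *m crepr rho w).
Proof.
move=> Ww [[cp p0 p1] sp]; split; last by move=> t /sp; exact: star_repr.
split; [|by rewrite p0|by rewrite p1].
apply: (within_comp (B := setT) (g := fun z => z *m crepr rho w) cp) => //.
by apply: continuous_subspaceT; exact: continuous_mulmxr.
Qed.

Lemma star_path_center b z : regular b -> star b z -> star_path b (center b) z (segment (center b) z).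
Proof.
move=> rb bz; split; first exact: segment_path.
by move=> t; exact: star_segment.
Qed.

Lemma star_connected b z z' : regular b -> star b z -> star b z' -> exists p, star_path b z z' p.
Proof.
move=> rb bz bz'; exists (path_cat (path_rev (segment (center b) z)) (segment (center b) z')).
apply: (star_path_cat (z' := center b)); last exact: star_path_center.
by apply: star_path_rev; exact: star_path_center.
Qed.

(* Contract towards the centre of the star: p is deformed through
   (1 - s tau t) p (phi s t) + s tau t * centre into a path that depends only on
   the end points of p. *)
Lemma star_homotopic b z z' p q : regular b -> star_path b z z' p -> star_path b z z' q ->
  homotopic (orb z) (orb z') (orb \o p) (orb \o q).
Proof.
move=> rb.
pose clamp (t : R) : R := Num.max 0 (Num.min 1 t).
have clamp01 t : 0 <= clamp t <= 1 by rewrite le_max lexx ge_max ler01 ge_min lexx.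
have cclamp : continuous clamp.
  move=> t; apply: continuous_max; first exact: cvg_cst.
  by apply: continuous_min; [exact: cvg_cst|exact: cvg_id].
have clamp_le0 t : t <= 0 -> clamp t = 0.
  by move=> t0; rewrite /clamp min_r ?max_l//; lra.
have clamp_ge1 t : 1 <= t -> clamp t = 1.
  by move=> t1; rewrite /clamp min_l// max_r.
have clamp_id t : 0 <= t <= 1 -> clamp t = t.
  by move=> /andP[t0 t1]; rewrite /clamp min_r// max_r.
(* At [s = 1] the deformed path goes from [z] to the centre in the first third, waits there while
   [p] runs, and goes to [z'] in the last third, so nothing of [p] is left. The clamps keep the
   parameters in [[0, 1]] on the whole plane. *)
pose tau (t : R) : R := clamp (Num.min (3 * t) (3 - 3 * t)).
pose phi1 (t : R) : R := clamp (3 * t - 1).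
pose phi (st : R * R) : R := clamp ((1 - st.1) * st.2 + st.1 * phi1 st.2).
pose theta (st : R * R) : R := clamp (st.1 * tau st.2).
have caff (a e : R) : continuous (fun t : R => a * t + e).
  move=> t; apply: cvgD; last exact: cvg_cst.
  by apply: cvgM; [exact: cvg_cst|exact: cvg_id].
have ccl (T : topologicalType) (g : T -> R) : continuous g -> continuous (clamp \o g).
  by move=> cg u; exact: (continuous_comp (cg u) (cclamp _)).
have ctau : continuous tau.
  have c : continuous (fun t : R => Num.min (3 * t) (3 - 3 * t)).
    move=> t; apply: continuous_min; first by apply: cvgM; [exact: cvg_cst|exact: cvg_id].
    by apply: cvgB; [exact: cvg_cst|apply: cvgM; [exact: cvg_cst|exact: cvg_id]].
  exact: (ccl _ _ c).
have cphi1 : continuous phi1 := ccl _ _ (caff 3 (-1)).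
have c1 : continuous (fst : R * R -> R) by move=> st; exact: cvg_fst.
have c2 : continuous (snd : R * R -> R) by move=> st; exact: cvg_snd.
have cphi : continuous phi.
  have c : continuous (fun st : R * R => (1 - st.1) * st.2 + st.1 * phi1 st.2).
    move=> st; apply: cvgD; apply: cvgM; [|exact: c2|exact: c1|].
      by apply: cvgB; [exact: cvg_cst|exact: c1].
    exact: (continuous_comp (c2 st) (cphi1 _)).
  exact: (ccl _ _ c).
have ctheta : continuous theta.
  have c : continuous (fun st : R * R => st.1 * tau st.2).
    by move=> st; apply: cvgM; [exact: c1|exact: (continuous_comp (c2 st) (ctau _))].
  exact: (ccl _ _ c).
have key p' : star_path b z z' p' -> homotopic (orb z) (orb z') (orb \o p')
    (orb \o (fun t => segment (center b) (p' (phi (1, t))) (1 - theta (1, t)))).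
  move=> [[cp p0 p1] sp].
  exists (orb \o (fun st => segment (center b) (p' (phi st)) (1 - theta st))).
  split=> [|t t01|t t01|s s01|s s01] //=.
  - apply: within_orb; last first.
      move=> st _; apply: (@star_regular _ _ _ _ _ b); apply: star_segment => //.
        by apply: sp; exact: clamp01.
      by have /andP[t0 t1] := clamp01 (st.1 * tau st.2); apply/andP; split; rewrite /theta; lra.
    have cth : continuous (fun st : R * R => 1 - theta st).
      by move=> st; apply: cvgB; [exact: cvg_cst|exact: ctheta].
    have cth' : continuous (fun st : R * R => 1 - (1 - theta st)).
      by move=> st; apply: cvgB; [exact: cvg_cst|exact: cth].
    have cc : {within `[0, 1] `*` `[0, 1], continuous ((fun=> center b) : R * R -> 'rV[Cx R]_n)}.
      by apply: continuous_subspaceT => st; exact: cvg_cst.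
    have cpp : {within `[0, 1] `*` `[0, 1], continuous (p' \o phi)}.
      refine (@within_comp _ _ _ _ _ phi _ _ _ cp).
        exact: continuous_subspaceT.
      by move=> st _; rewrite /= in_itv /=; exact: clamp01.
    exact: (within_lincomb (within_toCx (continuous_subspaceT cth'))
      (within_toCx (continuous_subspaceT cth)) cc cpp).
  - by rewrite /phi /theta /= !mul0r subr0 mul1r addr0 (clamp_le0 0)// subr0 clamp_id// segment1.
  - rewrite /phi /theta /tau /phi1 /= !mulr0 add0r sub0r subr0 min_l; last by lra.
    by rewrite (clamp_le0 0)// (clamp_le0 (-1)); [rewrite mulr0 !(clamp_le0 0)// subr0 segment1 p0|lra].
  - rewrite /phi /theta /tau /phi1 /= !mulr1 subrr min_r; last by lra.
    rewrite (clamp_le0 0)// mulr0 (clamp_le0 0)// subr0 segment1 (clamp_ge1 (3 - 1)); last by lra.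
    by rewrite mulr1 subrK clamp_ge1// p1.
move=> sp sq; apply: homotopic_trans (key p sp) _; apply: homotopic_sym.
rewrite (_ : (fun t => segment (center b) (p _) _) =
  (fun t => segment (center b) (q (phi (1, t))) (1 - theta (1, t)))); first exact: key.
have [[_ p0 p1] _] := sp; have [[_ q0 q1] _] := sq.
apply/funext => t; rewrite /phi /theta /= subrr mul0r add0r !mul1r.
have [t1|t1] := leP t (3^-1).
  by rewrite /phi1 (clamp_le0 (3 * t - 1)) ?(clamp_le0 0) ?p0 ?q0//; lra.
have [t2|t2] := leP (2 / 3) t.
  by rewrite /phi1 (clamp_ge1 (3 * t - 1)) ?(clamp_ge1 1) ?p1 ?q1//; lra.
rewrite /tau (clamp_ge1 (Num.min _ _)) ?(clamp_ge1 1)// ?subrr ?segment0//.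
by rewrite le_min; apply/andP; split; lra.
Qed.

End OrbitPaths.

(** * Subdivision of paths *)

Section PathTools.
Variable R : realType.

(** Replaces a subdivision of [[0, 1]]: the local step at the supremum of the times satisfying [P]
    either reaches 1 or goes beyond the supremum. *)
Lemma real_induction (P : R -> Prop) : P 0 ->
  (forall t0, 0 <= t0 <= 1 -> exists2 d, 0 < d & forall t1 t2, 0 <= t1 -> t1 <= t2 -> t2 <= 1 ->
    `|t0 - t1| < d -> `|t0 - t2| < d -> P t1 -> P t2) ->
  P 1.
Proof.
move=> P0 step; pose A := [set t : R | 0 <= t <= 1 /\ P t].
have A0 : A 0 by split; rewrite // lexx ler01.
have supA : has_sup A by split; [exists 0|exists 1 => t [/andP[]]].
have c0 : 0 <= sup A by apply: ub_le_sup => //; case: supA.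
have c1 : sup A <= 1 by apply: ge_sup; [exists 0|move=> t [/andP[]]].
have [d d0 stepc] := step (sup A) (introT andP (conj c0 c1)).
have [t1 [/andP[t10 t11] Pt1] t1c] := sup_adherent d0 supA.
have t1s : t1 <= sup A by apply: ub_le_sup; [case: supA|split; rewrite ?t10].
have [le1|lt1] := leP 1 (sup A + d / 2).
  apply: (stepc t1 1) => //; rewrite ?ltr_distl; apply/andP; split; lra.
have A2 : A (sup A + d / 2).
  split; first by apply/andP; split; lra.
  by apply: (stepc t1) => //; rewrite ?ltr_distl; try (apply/andP; split); lra.
have : sup A + d / 2 <= sup A by apply: ub_le_sup => //; case: supA.
lra.
Qed.

Lemma homotopic_ext (X : topologicalType) (x y : X) (f g : R -> X) :
  is_path x y f -> (forall t, 0 <= t <= 1 -> g t = f t) -> homotopic x y f g.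
Proof.
move=> [cf f0 f1] gf.
by apply: (@homotopic_reparam R X x y f f id id 0 1) => // t; exact: cvg_id.
Qed.

Lemma path_restr_cat (X : topologicalType) (f : R -> X) t1 t2 :
  {within `[0, 1], continuous f} -> 0 <= t1 -> t1 <= t2 -> t2 <= 1 ->
  homotopic (f 0) (f t2) (fun t => f (t2 * t))
    (path_cat (fun t => f (t1 * t)) (fun t => f (t1 + (t2 - t1) * t))).
Proof.
move=> cf t10 t12 t21.
have caff (a e : R) : continuous (fun t : R => a * t + e).
  move=> t; apply: cvgD; last exact: cvg_cst.
  by apply: cvgM; [exact: cvg_cst|exact: cvg_id].
have cmin : continuous ((fun t : R => 2 * t + 0) \min cst 1).
  by move=> t; apply: continuous_min; [exact: caff|exact: cvg_cst].
have cmax : continuous ((fun t : R => 2 * t + -1) \max cst 0).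
  by move=> t; apply: continuous_max; [exact: caff|exact: cvg_cst].
apply: (@homotopic_reparam R X _ _ f _ (fun t => t2 * t + 0)
  (fun t => t1 * Num.min (2 * t + 0) 1 + (t2 - t1) * Num.max (2 * t + -1) 0) 0 t2) => //.
- move=> t; apply: cvgD; apply: cvgM;
    [exact: cvg_cst|exact: cmin|exact: cvg_cst|exact: cmax].
- by move=> t /andP[t0 t1']; apply/andP; split; nra.
- move=> t /andP[t0 t1']; case: (leP (2 * t + 0) 1) => ?; case: (leP (2 * t + -1) 0) => ?;
    by apply/andP; split; nra.
- by rewrite mulr0 addr0.
- by rewrite min_l ?max_r; lra.
- by rewrite mulr1 addr0.
- by rewrite min_r ?max_l; lra.
- by move=> t _; rewrite addr0.
move=> t /andP[t0 t1']; rewrite /path_cat; case: ifPn => th.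
  by rewrite min_l ?max_r; [congr f; ring|lra|lra].
by rewrite -ltNge in th; rewrite min_r ?max_l; [congr f; ring|lra|lra].
Qed.

End PathTools.

(** * Local lifts and generation of the loops of the orbit space *)

Section Generation.
Variables (R : realType) (gT : finGroupType) (W : {group gT}) (n : nat).
Variable rho : mx_representation R W n.
Implicit Types (r s w : gT) (x y c d b : 'rV[R]_n) (z : 'rV[Cx R]_n).
Local Notation refl := (is_reflection rho).
Local Notation regular := (regular_pts rho).
Local Notation M := (regular_pts (crepr rho)).
Local Notation star := (star rho).
Local Notation X := (orbit_space (crepr rho)).
Variable base : set_type M.
Local Notation orb := (orb base).
Hypotheses (rho_faithful : mx_faithful rho) (W_reflection : reflection_group rho).

(** The orbit map is open: the preimage of the image of an open set is the union of its
    translates. *)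
Lemma near_orb z (A : set 'rV[Cx R]_n) : M z -> nbhs z A ->
  nbhs (orb z) [set q | exists z', [/\ M z', A z' & orb z' = q]].
Proof.
move=> Mz nA; pose O := (A : set 'rV[Cx R]_n)°.
have Oz : O z by exact: nA.
apply: (@filterS _ _ (nbhs_filter (orb z)) [set q | exists z', [/\ M z', O z' & orb z' = q]]).
  by move=> q [z' [Mz' Oz' <-]]; exists z'; split=> //; exact: interior_subset.
apply: open_nbhs_nbhs; split; last by exists z.
rewrite /open /= /quotient_open.
rewrite (_ : _ @^-1` _ = \bigcup_(w in [set w | w \in W])
    ((fun y : set_type M => \val y *m crepr rho w) @^-1` O)).
  apply: bigcup_open => w Ww; apply: open_comp; last exact: open_interior.
  move=> y _.
  apply: (@continuous_comp _ _ _ (set_val : set_type M -> 'rV[Cx R]_n)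
    (fun z => z *m crepr rho w)); first exact: initial_continuous.
  exact: continuous_mulmxr.
apply/seteqP; split=> y /=.
  move=> [z' [Mz' Oz' E]]; have {}E : orb (\val y) = orb z' by rewrite orb_val E.
  have [w Ww yw] := orbP (set_valP y) Mz' E.
  have Oyw : O (\val y *m crepr rho w) by rewrite yw.
  exact: (ex_intro2 _ _ w Ww Oyw).
move=> [w /= Ww Oyw]; exists (\val y *m crepr rho w).
have My : M (\val y) by exact: set_valP.
split; [exact: crepr_regular_repr|exact: Oyw|].
by rewrite (orb_repr base My Ww) orb_val.
Qed.

Let near_lt (h : 'rV[Cx R]_n -> R) z mu : {for z, continuous h} -> h z < mu ->
  nbhs z [set z1 | h z1 < mu].
Proof.
move=> ch hz; have nb : nbhs (h z) [set t | t < mu].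
  by apply: open_nbhs_nbhs; split => //; exact: open_lt.
exact: (ch _ nb).
Qed.

Let near_gt (h : 'rV[Cx R]_n -> R) z mu : {for z, continuous h} -> mu < h z ->
  nbhs z [set z1 | mu < h z1].
Proof.
move=> ch hz; have nb : nbhs (h z) [set t | mu < t].
  by apply: open_nbhs_nbhs; split => //; exact: open_gt.
exact: (ch _ nb).
Qed.

Let reVB z z' j : (reV z - reV z') 0 j = reC (z 0 j) - reC (z' 0 j).
Proof. by rewrite mxE [X in X + _]mxE [X in _ + X]mxE [X in _ - X]mxE. Qed.

Let imVB z z' j : (imV z - imV z') 0 j = imC (z 0 j) - imC (z' 0 j).
Proof. by rewrite mxE [X in X + _]mxE [X in _ + X]mxE [X in _ - X]mxE. Qed.

(** For [w] other than 1, freeness gives a real or imaginary coordinate that separates [z] from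
    [z w]; cutting at the midpoint of the two values gives a neighbourhood disjoint from its
    translate. These are intersected over the finite group. *)
Lemma near_free z : M z -> exists2 N : set 'rV[Cx R]_n, nbhs z N &
  forall z1 w, w \in W -> N z1 -> N (z1 *m crepr rho w) -> w = 1%g.
Proof.
move=> Mz.
pose disj w (N : set 'rV[Cx R]_n) := w \in W -> w != 1%g ->
  forall z1, N z1 -> N (z1 *m crepr rho w) -> False.
have sep w : exists N : set 'rV[Cx R]_n, nbhs z N /\ disj w N.
  have [Ww|nW] := boolP (w \in W); last first.
    by exists setT; split; [exact: filterT|move=> Ww; rewrite Ww in nW].
  have [->|w1] := eqVneq w 1%g; first by exists setT; split; [exact: filterT|move=> _; rewrite eqxx].
  have key (h : 'rV[Cx R]_n -> R) : continuous h -> h z != h (z *m crepr rho w) ->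
      exists N : set 'rV[Cx R]_n, nbhs z N /\ disj w N.
    move=> ch; pose mu := (h z + h (z *m crepr rho w)) / 2.
    have chw : {for z, continuous (fun z => h (z *m crepr rho w))}.
      exact: (continuous_comp (@continuous_mulmxr (Cx R) n n (crepr rho w) z) (ch _)).
    rewrite neq_lt => /orP[hlt|hgt].
      exists [set z1 | h z1 < mu /\ mu < h (z1 *m crepr rho w)]; split; last first.
        by move=> _ _ z1 [_ H1] [H2 _]; have := lt_trans H1 H2; rewrite ltxx.
      apply: (@filterI _ _ (nbhs_filter z)); first by apply: (near_lt (ch z)); rewrite /mu; lra.
      by apply: (near_gt chw); rewrite /mu; lra.
    exists [set z1 | mu < h z1 /\ h (z1 *m crepr rho w) < mu]; split; last first.
      by move=> _ _ z1 [_ H1] [H2 _]; have := lt_trans H1 H2; rewrite ltxx.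
    apply: (@filterI _ _ (nbhs_filter z)); first by apply: (near_gt (ch z)); rewrite /mu; lra.
    by apply: (near_lt chw); rewrite /mu; lra.
  have zw : z *m crepr rho w <> z.
    by move=> /(complex_free rho_faithful W_reflection Mz Ww) E; rewrite E eqxx in w1.
  have [re|/rV0Pn[j]] := eqVneq (reV z - reV (z *m crepr rho w)) 0; last first.
    rewrite reVB subr_eq0 => H; apply: (key (fun z => reC (z 0 j)) _ H).
    move=> y; exact: (continuous_comp (@coord_continuous (Cx R) 1 n 0 j y) (@continuous_reC _ _)).
  have [im|/rV0Pn[j]] := eqVneq (imV z - imV (z *m crepr rho w)) 0; last first.
    rewrite imVB subr_eq0 => H; apply: (key (fun z => imC (z 0 j)) _ H).
    move=> y; exact: (continuous_comp (@coord_continuous (Cx R) 1 n 0 j y) (@continuous_imC _ _)).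
  by exfalso; apply: zw; apply: eqV; apply/esym/eqP; rewrite -subr_eq0; apply/eqP.
have [N NP] := choice sep.
exists [set z1 | forall w, N w z1].
  by apply: (filter_forall (nbhs_filter z)) => w; exact: (NP w).1.
move=> z1 w Ww Nz1 Nzw; apply/eqP; apply: contraT => w1.
by case: (NP w) => _ /(_ Ww w1 z1 (Nz1 w) (Nzw w)).
Qed.

End Generation.

Section LoopGeneration.
Variables (R : realType) (gT : finGroupType) (W : {group gT}) (n : nat).
Variable rho : mx_representation R W n.
Implicit Types (r s w : gT) (x y d b : 'rV[R]_n) (z : 'rV[Cx R]_n).
Local Notation refl := (is_reflection rho).
Local Notation regular := (regular_pts rho).
Local Notation M := (regular_pts (crepr rho)).
Local Notation star := (star rho).
Local Notation star_path := (star_path rho).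
Local Notation X := (orbit_space (crepr rho)).
Variable base : set_type M.
Local Notation orb := (orb base).
Hypotheses (rho_faithful : mx_faithful rho) (W_reflection : reflection_group rho).
Variables (c : 'rV[R]_n) (rc : regular c).

(** The orbit map is open, and injective on a small [O] inside one star, so its inverse [g] there is
    continuous. *)
Lemma local_lift (f : R -> X) (t0 : R) : {within `[0, 1], continuous f} -> 0 <= t0 <= 1 ->
  exists b (e : R) (g : R -> 'rV[Cx R]_n), [/\ regular b, 0 < e,
    forall t, 0 <= t <= 1 -> `|t0 - t| < e -> star b (g t) /\ orb (g t) = f t &
    {within [set t | 0 <= t <= 1 /\ `|t0 - t| < e], continuous g}].
Proof.
move=> /subspace_continuousP cf t001; have [z Mz fz] := orb_surj base (f t0).
have [b rb bz] := star_cover rc Mz.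
have [N nN Nfree] := near_free rho_faithful W_reflection Mz.
pose O := ([set z' | star b z' /\ N z'] : set 'rV[Cx R]_n)°.
have Oz : O z by apply: (@filterI _ _ (nbhs_filter z)) => //; exact: near_star.
have OS z' : O z' -> star b z' /\ N z' by exact: interior_subset.
have oO : open O by exact: open_interior.
have oimg A z' : M z' -> open A -> A z' ->
    nbhs (orb z') [set q | exists z'', [/\ M z'', A z'' & orb z'' = q]].
  by move=> Mz' oA Az'; apply: near_orb => //; exact: open_nbhs_nbhs.
have nV : nbhs (f t0) [set q | exists z'', [/\ M z'', O z'' & orb z'' = q]].
  by rewrite -fz; exact: oimg.
have in01 (t : R) : 0 <= t <= 1 -> `[0, 1]%classic t by rewrite /= in_itv.
have /nbhs_ballP[d d0 dP] := cf t0 (in01 _ t001) _ nV.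
pose g t := xget z [set z' | [/\ M z', O z' & orb z' = f t]].
have gP t : 0 <= t <= 1 -> `|t0 - t| < d -> [/\ M (g t), O (g t) & orb (g t) = f t].
  move=> t01 td; have [z' Hz'] := dP t td (in01 _ t01).
  exact: (@xgetI _ z [set z' | [/\ M z', O z' & orb z' = f t]] z' Hz').
exists b, d, g; split => //.
  by move=> t t01 td; have [_ /OS[? _] ?] := gP t t01 td.
apply/subspace_continuousP => t [t01 td] A nA.
have [Mg Og gf] := gP t t01 td.
pose B := (A : set 'rV[Cx R]_n)° `&` O.
have oB : open B by apply: openI => //; exact: open_interior.
have Bg : B (g t) by split.
have nVB : nbhs (f t) [set q | exists z'', [/\ M z'', B z'' & orb z'' = q]].
  by rewrite -gf; exact: oimg.
have H := cf t (in01 _ t01) _ nVB.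
apply: (@filterS _ _ (nbhs_filter t) _ _ _ H) => t' Ht' [t'01 t'd].
have [z'' [Mz'' [Az'' Oz''] fz'']] := Ht' (in01 _ t'01).
have [Mg' Og' gf'] := gP t' t'01 t'd.
have [w Ww wE] := orbP Mz'' Mg' (etrans fz'' (esym gf')).
have w1 : w = 1%g by apply: (Nfree z''); rewrite // ?wE; [exact: (OS _ Oz'').2|exact: (OS _ Og').2].
have gz : g t' = z'' by move: wE; rewrite w1 repr_mx1 mulmx1.
by change (A (g t')); rewrite gz; exact: interior_subset.
Qed.

(** [L] will be the class of loops that lift through [p] up to homotopy. In [L_gen] the point [b] is
    arbitrary, so half-turns on both sides of a wall are included. *)
Variables (S : {set gT}) (L : (R -> X) -> Prop).
Hypothesis S_gen : <<S>>%g = W.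
Let x0 := orb (cvec c).
Hypothesis L_path : forall f, L f -> is_path x0 x0 f.
Hypothesis L_cst : L (cst x0).
Hypothesis L_cat : forall f g, L f -> L g -> L (path_cat f g).
Hypothesis L_homotopic : forall f g, L f -> is_path x0 x0 g -> homotopic x0 x0 f g -> L g.
Hypothesis L_gen : forall s b p, s \in S -> regular b ->
  star_path b (cvec c) (cvec (c *m rho s)) p -> L (orb \o p).

Let Mreal d : regular d -> M (cvec d).
Proof. exact: regular_cvec. Qed.

Let orb_real w : w \in W -> orb (cvec (c *m rho w)) = x0.
Proof.
move=> Ww; rewrite /x0 -(orb_repr base (Mreal rc) Ww); congr orb.
by rewrite /cvec map_mxM.
Qed.

Let rcw w : w \in W -> regular (c *m rho w).
Proof. by move=> Ww; exact: regular_repr. Qed.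

Let star_real_path w b : w \in W -> star b (cvec (c *m rho w)).
Proof. by move=> Ww; apply: star_real; exact: rcw. Qed.

Let cvec_act d w : cvec (d *m rho w) = cvec d *m crepr rho w.
Proof. exact: map_mxM. Qed.

Let orb_path b w w' p : w \in W -> w' \in W ->
  star_path b (cvec (c *m rho w)) (cvec (c *m rho w')) p -> is_path x0 x0 (orb \o p).
Proof. by move=> Ww Ww' /(star_path_orb base); rewrite !orb_real. Qed.

Let star_path_cst b z : star b z -> star_path b z z (cst z).
Proof. by move=> bz; split=> [|t _ //]; exact: is_path_cst. Qed.

Let orb_cat (p q : R -> 'rV[Cx R]_n) : orb \o path_cat p q = path_cat (orb \o p) (orb \o q).
Proof. by apply/funext => t; rewrite /path_cat /=; case: ifP. Qed.

Let S_sub s : s \in S -> s \in W.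
Proof. by move=> Ss; rewrite -S_gen mem_gen. Qed.

Let star_path_homotopic_L b w w' p q : regular b -> w \in W -> w' \in W ->
  star_path b (cvec (c *m rho w)) (cvec (c *m rho w')) p ->
  star_path b (cvec (c *m rho w)) (cvec (c *m rho w')) q -> L (orb \o p) -> L (orb \o q).
Proof.
move=> rb Ww Ww' sp sq Lp; apply: (L_homotopic Lp (orb_path Ww Ww' sq)).
by have := star_homotopic base rb sp sq; rewrite !orb_real.
Qed.

(** As [star b] contains every [c w], the path can be led along a gallery. The step from [c w1] to
    [c s w1] is the translate by [w1] of one from [c] to [c s] in the star of [b w1^-1]. *)
Lemma star_path_L b w w' p : regular b -> w \in W -> w' \in W ->
  star_path b (cvec (c *m rho w)) (cvec (c *m rho w')) p -> L (orb \o p).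
Proof.
move=> rb Ww Ww'.
have : (w' * w^-1)%g \in <<S>>%g by rewrite S_gen groupM ?groupV.
move=> /word_prodP[ws wsS wE].
have {wE}w'E : w' = (word_prod ws * w)%g by rewrite -wE mulgKV.
elim: ws wsS w' Ww' w'E p => [|s ws IH] wsS w' Ww' w'E p sp.
  move: sp; rewrite w'E mul1g => sp.
  apply: (star_path_homotopic_L rb Ww Ww (star_path_cst (star_real_path b Ww)) sp).
  rewrite (_ : orb \o _ = cst x0)//; apply/funext => t /=; exact: orb_real.
have Ss := wsS s (mem_head _ _).
have wsS' : {subset ws <= S} by move=> u us; apply: wsS; rewrite inE us orbT.
pose w1 := (word_prod ws * w)%g.
have w'1 : w' = (s * w1)%g by rewrite w'E /= mulgA.
have Ww1 : w1 \in W by rewrite -(groupMl _ (S_sub Ss)) -w'1.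
have [q1 sq1] := star_connected rb (star_real_path b Ww) (star_real_path b Ww1).
have [q2 sq2] := star_connected rb (star_real_path b Ww1) (star_real_path b Ww').
apply: (star_path_homotopic_L rb Ww Ww' (star_path_cat sq1 sq2) sp).
rewrite orb_cat; apply: L_cat; first exact: (IH wsS' w1 Ww1 erefl).
have Wv := groupVr Ww1.
have := star_path_repr Wv sq2.
rewrite w'1 -!cvec_act repr_mxK// (repr_mxM rho (S_sub Ss) Ww1) mulmxA repr_mxK// => sq2'.
have Lq := L_gen Ss (regular_repr Wv rb) sq2'.
apply: (L_homotopic Lq (orb_path Ww1 Ww' sq2)).
apply: (homotopic_ext (L_path Lq)) => t t01 /=.
by rewrite orb_repr//; apply: star_regular (sq2.2 t t01).
Qed.

Lemma loops_generated f : is_path x0 x0 f -> L f.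
Proof.
move=> [cf f0 f1].
pose tail w z := orb \o segment (cvec (c *m rho w)) z.
have star_tail b w z : w \in W -> star b z -> adherent rho z (c *m rho w) ->
    star_path b (cvec (c *m rho w)) z (segment (cvec (c *m rho w)) z).
  move=> Ww bz zc; split; first exact: segment_path.
  by move=> t t01; apply: star_adherent => //; exact: rcw.
(* Up to time [T], [f] is a loop in [L] followed by a segment from a real point [c w] to a point [z]
   above [f T]. Allowing every [z] and every adherent chamber lets both change from one step to the
   next. *)
pose P (T : R) := forall z w, M z -> orb z = f T -> w \in W -> adherent rho z (c *m rho w) ->
  exists2 l, L l & homotopic x0 (f T) (fun t => f (T * t)) (path_cat l (tail w z)).
have P1 : P 1.
  apply: real_induction => [z w Mz fz Ww zw|t0 t001].
    have [u Wu uz] := orbP (Mreal rc) Mz (etrans (esym f0) (esym fz)).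
    have {}uz : z = cvec (c *m rho u) by rewrite cvec_act uz.
    have [p sp] := star_connected rc (star_real_path c Wu) (star_real_path c Ww).
    exists (orb \o p); first exact: (star_path_L rc Wu Ww sp).
    have cz : star c z by rewrite uz; exact: star_real_path.
    rewrite -uz in sp; have sq := star_path_cat sp (star_tail _ _ _ Ww cz zw).
    have := star_homotopic base rc (star_path_cst cz) sq.
    rewrite fz f0 orb_cat; congr homotopic; apply/funext => t /=.
    by rewrite mul0r fz.
  have [b [d [g [rb d0 gP cg]]]] := local_lift cf t001.
  exists d => // t1 t2 t10 t12 t21 dt1 dt2 Pt1 z w Mz fz Ww zw.
  have t2_01 : 0 <= t2 <= 1 by rewrite t21 (le_trans t10).
  have t1_01 : 0 <= t1 <= 1 by rewrite t10 (le_trans t12).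
  have [bg2 fg2] := gP t2 t2_01 dt2.
  have [u Wu uz] := orbP (star_regular bg2) Mz (etrans fg2 (esym fz)).
  (* The local lift is translated by [u] so that it ends at the prescribed [z]. *)
  pose b' := b *m rho u; have rb' : regular b' by exact: regular_repr.
  pose z1 := g t1 *m crepr rho u.
  have [bg1 fg1] := gP t1 t1_01 dt1.
  have bz1 : star b' z1 by exact: star_repr.
  have Mz1 := star_regular bz1.
  have fz1 : orb z1 = f t1 by rewrite /z1 orb_repr//; exact: star_regular bg1.
  have [w1 Ww1 zw1] := adherent_exists z1 rc.
  have [l1 Ll1 hl1] := Pt1 z1 w1 Mz1 fz1 Ww1 zw1.
  have bz : star b' z by rewrite -uz; exact: star_repr.
  pose h t := g (t1 + (t2 - t1) * t) *m crepr rho u.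
  have in_d t : 0 <= t <= 1 -> 0 <= t1 + (t2 - t1) * t <= 1 /\ `|t0 - (t1 + (t2 - t1) * t)| < d.
    move=> /andP[ta tb]; split; first by apply/andP; split; nra.
    by move: dt1 dt2; rewrite !ltr_norml => /andP[? ?] /andP[? ?]; apply/andP; split; nra.
  have sh : star_path b' z1 z h.
    split; last first.
      by move=> t /in_d[ta tb]; apply: star_repr => //; exact: (gP _ ta tb).1.
    split; [|by rewrite /h mulr0 addr0|by rewrite /h mulr1 subrKC].
    have ch : {within `[0, 1], continuous (g \o (fun t => t1 + (t2 - t1) * t))}.
      refine (@within_comp _ _ _ _ _ (fun t => t1 + (t2 - t1) * t) _ _ _ cg).
        apply: continuous_subspaceT => t; apply: cvgD; first exact: cvg_cst.
        by apply: cvgM; [exact: cvg_cst|exact: cvg_id].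
      by move=> t; rewrite /= in_itv /=; exact: in_d.
    apply: (within_comp (B := setT) (g := fun z => z *m crepr rho u) ch) => //.
    by apply: continuous_subspaceT; exact: continuous_mulmxr.
  have [p sp] := star_connected rb' (star_real_path b' Ww1) (star_real_path b' Ww).
  have Lp := star_path_L rb' Ww1 Ww sp.
  exists (path_cat l1 (orb \o p)); first exact: L_cat.
  have st1 := star_tail _ _ _ Ww1 bz1 zw1; have st := star_tail _ _ _ Ww bz zw.
  have ph := star_path_orb base sh; have pt1 := star_path_orb base st1.
  have pt := star_path_orb base st; have pp := star_path_orb base sp.
  rewrite !orb_real// in ph pt1 pt pp; rewrite fz1 fz in ph; rewrite fz1 in pt1; rewrite fz in pt.
  (* In the star of [b'], the old tail followed by the lift [h] is homotopic to a path [p] between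
     real points followed by the new tail; [p] is then absorbed into the loop. *)
  have H0 : homotopic x0 (f t2) (fun t => f (t2 * t))
      (path_cat (fun t => f (t1 * t)) (fun t => f (t1 + (t2 - t1) * t))).
    by rewrite -f0; exact: path_restr_cat.
  have H1 : homotopic (f t1) (f t2) (fun t => f (t1 + (t2 - t1) * t)) (orb \o h).
    apply: homotopic_sym; apply: (homotopic_ext ph) => t t01 /=.
    have [ta tb] := in_d t t01; have [bgt <-] := gP _ ta tb.
    by rewrite /h orb_repr//; exact: star_regular bgt.
  have H2 := homotopic_cat hl1 H1.
  have H3 := homotopic_sym (homotopic_catA (L_path Ll1) pt1 ph).
  have H4 := star_homotopic base rb' (star_path_cat st1 sh) (star_path_cat sp st).
  rewrite !orb_cat orb_real// fz in H4.
  have H5 := homotopic_cat (homotopic_refl (L_path Ll1)) H4.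
  have H6 := homotopic_catA (L_path Ll1) pp pt.
  exact: homotopic_trans H0 (homotopic_trans H2 (homotopic_trans H3 (homotopic_trans H5 H6))).
(* At time 1 the choice [z = c], [w = 1] makes the tail constant. *)
have ad1 : adherent rho (cvec c) (c *m rho 1%g).
  by move=> r rr; right; rewrite reV_cvec repr_mx1 mulmx1 sqr_gt0//; exact: regular_neq0.
have [l Ll hl] := P1 (cvec c) 1%g (Mreal rc) (esym f1) (group1 W) ad1.
have pf : is_path x0 x0 f by split.
apply: (L_homotopic Ll pf); apply: homotopic_sym.
have tE : tail 1%g (cvec c) = cst x0.
  apply/funext => t; rewrite /tail /= repr_mx1 mulmx1; congr orb.
  by rewrite /segment -scalerDl -rmorphD subrK rmorph1 scale1r.
have := homotopic_trans hl; rewrite tE f1 => /(_ _ (homotopic_cat1r (L_path Ll))).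
by congr homotopic; apply/funext => t; rewrite mul1r.
Qed.

End LoopGeneration.

(** * Half-turns at a wall *)

Section HalfMonodromy.
Variables (R : realType) (gT : finGroupType) (W : {group gT}) (n : nat).
Variable rho : mx_representation R W n.
Implicit Types (r s w : gT) (x y c d b h l : 'rV[R]_n) (z : 'rV[Cx R]_n).
Local Notation refl := (is_reflection rho).
Local Notation lm := (lam rho).
Local Notation regular := (regular_pts rho).
Local Notation same_side := (same_side rho).
Local Notation star := (star rho).

Lemma path_limit_side c r (gamma : R -> 'rV[R]_n) :
  {within `[0, 1], continuous gamma} -> (forall t, 0 <= t < 1 -> same_side c (gamma t)) ->
  refl r -> lm r (gamma 1) != 0 -> 0 < lm r c * lm r (gamma 1).
Proof.
move=> /within_at_left cg gC rr g0; rewrite lt_neqAle eq_sym.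
have c0 : lm r c != 0.
  apply/eqP => E; have := gC 0; rewrite lexx ltr01 => /(_ isT r rr).
  by rewrite E mul0r ltxx.
rewrite mulf_neq0//= leNgt; apply/negP => lt0.
have cl : lm r c * lm r (gamma t) @[t --> (1 : R)^'-] --> lm r c * lm r (gamma 1).
  apply: cvgM; first exact: cvg_cst.
  exact: (cvg_comp _ _ cg (@continuous_lam _ _ _ _ rho r (gamma 1))).
have nb : nbhs (lm r c * lm r (gamma 1)) [set t | t < 0].
  by apply: open_nbhs_nbhs; split => //; exact: open_lt.
have [t [[t0 tn] t1]] := filter_ex (filterI
  (filterI (nbhs_left_gt (ltr01 : (0 : R) < 1)) (cl _ nb)) (nbhs_left_lt (1 : R))).
have := gC t; rewrite (ltW t0) t1 => /(_ isT r rr).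
by rewrite ltNge ltW.
Qed.

Hypothesis rho_faithful : mx_faithful rho.

Lemma refl_neq1 r : refl r -> r != 1%g.
Proof.
move=> rr; apply/eqP => r1; have [y] := lam_neq0 rr.
by rewrite (proj1 (fixed_lam y rr)) ?eqxx// r1 repr_mx1 mulmx1.
Qed.

Lemma refl_cycle s w : refl s -> w \in <[s]>%g -> w = 1%g \/ w = s.
Proof.
move=> rs /cycleP[i ->]; have ss := refl_mulg rho_faithful rs.
elim: i => [|i [E|E]]; first by left; rewrite expg0.
  by right; rewrite expgS E mulg1.
by left; rewrite expgS E.
Qed.

Lemma path_wall_point c s (gamma : R -> 'rV[R]_n) :
  {within `[0, 1], continuous gamma} -> (forall t, 0 <= t < 1 -> same_side c (gamma t)) ->
  refl s -> lm s (gamma 1) = 0 -> (forall r, refl r -> lm r (gamma 1) = 0 -> r = s) ->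
  wall_point rho c s (gamma 1).
Proof.
move=> cg gC rs s0 uniq_s; split=> // r rr.
have [r0|r0] := eqVneq (lm r (gamma 1)) 0; last by right; exact: path_limit_side.
by left; rewrite (uniq_s r rr r0); exists 1 => y; rewrite mul1r.
Qed.

Lemma half_monodromy_cases s (gamma : R -> 'rV[R]_n) t h l u : 0 <= u <= 1 ->
  [\/ exists2 v, 0 <= v <= 1 & half_monodromy rho s gamma t h l u = cvec (gamma (v * t)),
      exists2 v, 0 <= v <= 1 & half_monodromy rho s gamma t h l u = half_turn h l v |
      exists2 v, 0 <= v <= 1 &
        half_monodromy rho s gamma t h l u = cvec (gamma (v * t)) *m crepr rho s].
Proof.
move=> /andP[u0 u1]; rewrite /half_monodromy /path_cat /path_rev.
case: ifPn => u2; last first.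
  apply: Or33; exists (1 - (2 * u - 1)) => //.
  by rewrite -ltNge in u2; apply/andP; split; lra.
case: ifPn => u4.
  by apply: Or31; exists (2 * (2 * u)) => //; apply/andP; split; lra.
apply: Or32; exists (2 * (2 * u) - 1) => //.
by rewrite -ltNge in u4; apply/andP; split; lra.
Qed.

Lemma half_turn_re h l v : reV (half_turn h l v) = h + cos (pi * v) *: l.
Proof. by rewrite /half_turn reVD reV_cvec reVZ. Qed.

Lemma half_turn_im h l v : imV (half_turn h l v) = sin (pi * v) *: l.
Proof. by rewrite /half_turn imVD imV_cvec add0r imVZ. Qed.

Lemma half_turn_path h l : is_path (cvec (h + l)) (cvec (h - l)) (half_turn h l).
Proof.
split; last 2 first.
- apply: eqV; rewrite ?half_turn_re ?half_turn_im ?reV_cvec ?imV_cvec mulr0.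
    by rewrite cos0 scale1r.
  by rewrite sin0 scale0r.
- apply: eqV; rewrite ?half_turn_re ?half_turn_im ?reV_cvec ?imV_cvec mulr1.
    by rewrite cospi scaleN1r.
  by rewrite sinpi scale0r.
pose zeta (v : R) : Cx R := (cos (pi * v) +i* sin (pi * v))%C.
have czeta : continuous zeta.
  have -> : zeta = fun v => toCx R (cos (pi * v)) + 'i%C * toCx R (sin (pi * v)).
    by apply/funext => v; apply: eqC; rewrite ?reCD ?imCD ?reCM ?imCM /reC /imC /=; ring.
  have cpi : continuous (fun v : R => pi * v).
    by move=> v; apply: cvgM; [exact: cvg_cst|exact: cvg_id].
  have cc : continuous (fun v : R => toCx R (cos (pi * v))).
    move=> v; apply: (continuous_comp (f := fun v => cos (pi * v)) (g := toCx R)).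
      exact: (continuous_comp (cpi v) (@continuous_cos _ _)).
    exact: continuous_toCx.
  have cs : continuous (fun v : R => toCx R (sin (pi * v))).
    move=> v; apply: (continuous_comp (f := fun v => sin (pi * v)) (g := toCx R)).
      exact: (continuous_comp (cpi v) (@continuous_sin _ _)).
    exact: continuous_toCx.
  by move=> v; exact: (cvgD (cc v) (cvgM (@cst_continuous _ _ ('i%C : Cx R) v) (cs v))).
rewrite (_ : half_turn h l = fun v => cst 1 v *: cst (cvec h) v + zeta v *: cst (cvec l) v).
  by apply: within_lincomb; apply: continuous_subspaceT => v;
    [exact: cvg_cst|exact: czeta|exact: cvg_cst|exact: cvg_cst].
by apply/funext => v; rewrite /half_turn scale1r.
Qed.

Section Leg.
Variables (gamma : R -> 'rV[R]_n) (s : gT) (t : R) (h l : 'rV[R]_n).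
Hypotheses (cgamma : {within `[0, 1], continuous gamma}) (t01 : 0 <= t < 1).
Hypotheses (Ws : s \in W) (ghl : gamma t = h + l) (hs : h *m rho s = h) (ls : l *m rho s = - l).

Lemma half_monodromy_path :
  is_path (cvec (gamma 0)) (cvec (gamma 0 *m rho s)) (half_monodromy rho s gamma t h l).
Proof.
have pleg : is_path (cvec (gamma 0)) (cvec (gamma t)) (fun u => cvec (gamma (u * t))).
  split; [|by rewrite mul0r|by rewrite mul1r].
  have cg : {within `[0, 1], continuous (gamma \o (fun u => u * t))}.
    refine (@within_comp _ _ _ _ _ (fun u : R => u * t) _ _ _ cgamma).
      by apply: continuous_subspaceT => u; apply: cvgM; [exact: cvg_id|exact: cvg_cst].
    move=> u; rewrite /= !in_itv /= => /andP[u0 u1]; case/andP: t01 => t0 t1.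
    by apply/andP; split; nra.
  refine (@within_comp _ _ _ _ setT (gamma \o (fun u => u * t)) (@cvec R n) cg _ _) => //.
  by apply: continuous_subspaceT; exact: continuous_cvec.
have gs : cvec (gamma t *m rho s) = cvec (h - l).
  by rewrite ghl mulmxDl hs ls.
apply: (@is_path_cat _ _ _ (cvec (gamma t *m rho s))).
  by rewrite gs; apply: is_path_cat pleg _; rewrite ghl; exact: half_turn_path.
have [cr r0 r1] := is_path_rev pleg; split; last 2 first.
- by rewrite r0 /cvec map_mxM.
- by rewrite r1 /cvec map_mxM.
refine (@within_comp _ _ _ _ setT _ (fun z => z *m crepr rho s) cr _ _) => //.
by apply: continuous_subspaceT; exact: continuous_mulmxr.
Qed.

(** On the half-turn, the form of [s] has zero real part only where the cosine vanishes, and there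
    its imaginary part has the sign of its value at [b]. For another hyperplane, [h + l] and [h - l]
    are on one side, hence so is the real part, which lies between them. *)
Lemma half_monodromy_star c x b : wall_point rho c s x ->
  (forall t, 0 <= t < 1 -> same_side c (gamma t)) -> 0 < lm s c * lm s b ->
  star_path rho b (cvec (gamma 0)) (cvec (gamma 0 *m rho s)) (half_monodromy rho s gamma t h l).
Proof.
move=> sx gC cb; split; first exact: half_monodromy_path.
have legR v : 0 <= v <= 1 -> regular (gamma (v * t)).
  move=> /andP[v0 v1]; apply: (@same_side_regular _ _ _ _ _ c); apply: gC.
  by case/andP: t01 => t0 t1; apply/andP; split; nra.
move=> u /(half_monodromy_cases s gamma t h l)[] [v v01 ->].
- by apply: star_real; exact: legR.
- have [rs sx0 Hx] := sx; have xs : x *m rho s = x by apply/fixed_lam.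
  have gt := gC t t01; have sx' := wall_point_same gt sx.
  have sh : lm s h = 0 by apply/(fixed_lam h rs).
  have sl : lm s l = lm s (gamma t) by rewrite ghl lamD sh add0r.
  have sl0 : lm s l != 0.
    by rewrite sl; apply: regular_neq0 rs; exact: same_side_regular gt.
  move=> r rr; rewrite half_turn_re half_turn_im.
  have [[k kE]|nprop] := pselect (proportional rho r s).
    have k0 : k != 0 by have [y] := lam_neq0 rr; rewrite kE mulf_eq0 negb_or => /andP[].
    rewrite !kE lamD !lamZ sh add0r.
    have [cos0|cosn0] := eqVneq (cos (pi * v)) 0; last by left; rewrite !mulf_neq0.
    right; have sin_ge0 : 0 <= sin (pi * v).
      case/andP: v01 => v0 v1; apply: sin_ge0_pi; have := pi_ge0 R.
      by move=> p0; rewrite mulr_ge0//= ler_piMr.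
    have sinn0 : sin (pi * v) != 0.
      apply/eqP => sin0; have := cos2Dsin2 (pi * v).
      by rewrite cos0 sin0 expr0n addr0 => /eqP; rewrite eq_sym oner_eq0.
    have sin0 : 0 < sin (pi * v) by rewrite lt_neqAle eq_sym sinn0.
    rewrite mulrACA mulr_gt0 ?sqr_gt0// -mulrA mulr_gt0// sl.
    apply: mul_gt0_trans cb; rewrite mulrC; exact: gt.
  left; have H1 := wall_stab_sign sx' Ws xs rr nprop.
  have gn0 : lm r (gamma t) != 0 by apply: regular_neq0 rr; exact: same_side_regular gt.
  rewrite ghl mulmxDl hs ls !lamD lamN in H1; rewrite ghl lamD in gn0; rewrite lamD lamZ.
  have := sqr_gt0 gn0; have := cos_le1 (pi * v); have := cos_geN1 (pi * v).
  move: (cos _) (lm r h) (lm r l) H1 => q a e H1 q1 q2 a2; apply/eqP => E.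
  have E2 : (a + e) * (a + q * e) = 0 by rewrite E mulr0.
  have [q0|q0] := leP q 0.
    have P1 : 0 <= (1 + q) * ((a + e) * (a + e)) by apply: mulr_ge0; [lra|exact: ltW].
    have P2 : 0 < (1 - q) * ((a - e) * (a + e)) by apply: mulr_gt0; [lra|].
    nra.
  have P1 : 0 < (1 + q) * ((a + e) * (a + e)) by apply: mulr_gt0; [lra|].
  have P2 : 0 <= (1 - q) * ((a - e) * (a + e)) by apply: mulr_ge0; [lra|exact: ltW].
  nra.
- rewrite /cvec -map_mxM; apply: star_real; apply: regular_repr => //; exact: legR.
Qed.

End Leg.

Lemma near_half_turn (gamma : R -> 'rV[R]_n) s (N : set 'rV[Cx R]_n) :
  {within `[0, 1], continuous gamma} -> gamma 1 *m rho s = gamma 1 ->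
  nbhs (cvec (gamma 1)) N ->
  \forall t \near 1^'-, forall h l v, gamma t = h + l -> h *m rho s = h -> l *m rho s = - l ->
    N (half_turn h l v).
Proof.
move=> /within_at_left cg gs /nbhs_ballP[e e0 eN].
have eE : e = toCx R (reC e).
  by apply: eqC; rewrite // imC_real; move: e0; rewrite /= ltcE => /andP[/eqP].
have e0' : 0 < reC e by move: e0; rewrite /= {1}eE [toCx R _]/(_%:C)%C ltcR.
(* These are [2 h] and [2 l], with limits [2 gamma 1] and 0; errors below [e] leave [e / 2] for each
   of [h] and [l], uniformly in [v]. *)
pose Hf t := gamma t + gamma t *m rho s; pose Lf t := gamma t - gamma t *m rho s.
have cgs : gamma t *m rho s @[t --> (1 : R)^'-] --> gamma 1 *m rho s.
  exact: (cvg_comp _ _ cg (@continuous_mulmxr R n n (rho s) (gamma 1))).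
have ccoord j (F : R -> 'rV[R]_n) (y : 'rV[R]_n) : F t @[t --> (1 : R)^'-] --> y ->
    F t 0 j @[t --> (1 : R)^'-] --> y 0 j.
  by move=> cF; exact: (cvg_comp _ _ cF (@coord_continuous R 1 n 0 j y)).
have near_j : \forall t \near (1 : R)^'-, forall j,
    `|(gamma 1 + gamma 1 *m rho s) 0 j - Hf t 0 j| < reC e /\ `|Lf t 0 j| < reC e.
  apply: filter_forall => j.
  have c1 : (gamma t 0 j + (gamma t *m rho s) 0 j) @[t --> (1 : R)^'-] -->
      gamma 1 0 j + (gamma 1 *m rho s) 0 j.
    by apply: cvgD; exact: ccoord.
  have c2 : (gamma t 0 j - (gamma t *m rho s) 0 j) @[t --> (1 : R)^'-] -->
      gamma 1 0 j - (gamma 1 *m rho s) 0 j.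
    by apply: cvgB; exact: ccoord.
  move/cvgrPdist_lt/(_ _ e0') : c1 => n1; move/cvgrPdist_lt/(_ _ e0') : c2 => n2.
  apply: filterS2 n1 n2 => t' H1 H2; split; first by rewrite /Hf !mxE in H1 *.
  by move: H2; rewrite gs subrr sub0r normrN /Lf !mxE.
apply: filterS near_j => t Ht h l v ghl hs ls; apply: eN; split => // i j; rewrite (ord1 i) {i}.
have [] := Ht j; rewrite /Hf /Lf gs ghl mulmxDl hs ls.
have -> : (gamma 1 + gamma 1) 0 j - (h + l + (h - l)) 0 j = 2 * (gamma 1 0 j - h 0 j).
  by rewrite !mxE; ring.
have -> : (h + l - (h - l)) 0 j = 2 * l 0 j by rewrite !mxE; ring.
rewrite !normrM (ger0_norm (_ : 0 <= (2 : R)))// => H1 H2.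
rewrite /ball /= eE /half_turn !mxE opprD addrA -rmorphB.
have normR (a : R) : `|toCx R a| = toCx R `|a|.
  by rewrite normc_def /= expr0n addr0 sqrtr_sqr.
apply: le_lt_trans (ler_normB _ _) _; rewrite normrM !normR.
have -> : `|(cos (pi * v) +i* sin (pi * v))%C : Cx R| = 1.
  by rewrite normc_def /= cos2Dsin2 sqrtr1.
by rewrite mul1r -rmorphD [X in X < _]/(_%:C)%C [X in _ < X]/(_%:C)%C ltcR; lra.
Qed.

End HalfMonodromy.

(** * Image of the standard generators *)

Section BraidImage.
Variables (R : realType) (gT : finGroupType) (W G : {group gT}) (n m : nat).
Variables (rho : mx_representation R W n) (f : m.-tuple (mpoly.mpoly n R)).
Variables (rhoq : mx_representation R (W / G)%G m).
Hypotheses (rho_faithful : mx_faithful rho) (W_reflection : reflection_group rho).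
Hypotheses (G_normal : normal G W) (f_splitting : graded_splitting G rho f).
Hypothesis f_act : induced_action W rho rhoq f.
Hypothesis f_good : good (map_mpolys (toCx R) f) (W / G)%G (crepr rhoq).
Variables (Ct : set 'rV[R]_n) (C : set 'rV[R]_m) (x0 : 'rV[R]_n).
Hypotheses (Ct_chamber : is_chamber rho Ct) (Ct_x0 : Ct x0).
Hypotheses (C_chamber : is_chamber rhoq C) (Ct_C : rmap f @` Ct `<=` C).
Local Notation refl := (is_reflection rho).
Local Notation reflq := (is_reflection rhoq).
Local Notation cl := (coset G).
Local Notation y0 := (rmap f x0).
Implicit Types (x c h l : 'rV[R]_n) (z : 'rV[Cx R]_n) (s w g : gT).

Let rx0 : regular_pts rho x0 := chamber_regular Ct_chamber Ct_x0.

Let Cy0 : C y0. Proof. by apply: Ct_C; exists x0. Qed.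

Let ry0 : regular_pts rhoq y0 := chamber_regular C_chamber Cy0.

Let sub_GW := fintype.subsetP (normal_sub G_normal).

Let rhoqF : mx_faithful rhoq :=
  rhoq_faithful rho_faithful W_reflection G_normal f_splitting f_act Ct_chamber Ct_x0.

Let rhoqR : reflection_group rhoq :=
  quotient_reflection_group rho_faithful W_reflection G_normal f_splitting f_act
    Ct_chamber Ct_x0 f_good.

Let same_Ct c : Ct c -> same_side rho x0 c.
Proof. by move=> Cc; apply/(chamber_same_side _ Ct_chamber). Qed.

Let same_C c : Ct c -> same_side rhoq y0 (rmap f c).
Proof.
by move=> Cc; apply/(chamber_same_side _ C_chamber) => //; apply: Ct_C; exists c.
Qed.

Let continuous_cmap : continuous (cmap f).
Proof. exact: continuous_mpoly_fun. Qed.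

Section Monodromy.
Variables (gamma : R -> 'rV[R]_n) (s : gT) (b : 'rV[R]_m).
Hypotheses (cgamma : {within `[0, 1], continuous gamma}).
Hypothesis gCt : forall t, 0 <= t < 1 -> Ct (gamma t).
Hypotheses (rs : refl s) (stab_s : rstab rho (gamma 1) = <[s]>%g).
Hypothesis b_side : s \notin G -> 0 < lam rhoq (cl s) y0 * lam rhoq (cl s) b.

Let Ws : s \in W. Proof. by case/andP: rs. Qed.

Let stabP w : w \in W -> gamma 1 *m rho w = gamma 1 -> w = 1%g \/ w = s.
Proof.
move=> Ww xw; apply: (refl_cycle rho_faithful rs); rewrite -stab_s.
by rewrite inE Ww /= xw.
Qed.

Let xs : gamma 1 *m rho s = gamma 1.
Proof.
have : s \in rstab rho (gamma 1) by rewrite stab_s cycle_id.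
by rewrite inE => /andP[_ /eqP].
Qed.

Let sx : lam rho s (gamma 1) = 0. Proof. exact/(fixed_lam _ rs). Qed.

Let wall_x : wall_point rho x0 s (gamma 1).
Proof.
apply: path_wall_point => // [t t01|r rr r0]; first by apply: same_Ct; exact: gCt.
have /andP[Wr _] := rr.
by have [r1|//] := stabP Wr (proj2 (fixed_lam _ rr) r0); have := refl_neq1 rr; rewrite r1 eqxx.
Qed.

Let gC t : 0 <= t < 1 -> same_side rhoq y0 (rmap f (gamma t)).
Proof. by move=> t01; apply: same_C; exact: gCt. Qed.

Let crgamma : {within `[0, 1], continuous (rmap f \o gamma)}.
Proof.
refine (@within_comp _ _ _ _ setT gamma (rmap f) cgamma _ _) => //.
by apply: continuous_subspaceT; exact: continuous_mpoly_fun.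
Qed.

(** If [p(gamma 1)] were on the hyperplane of [r = q(w)], some [w g] would fix [gamma 1], hence be 1
    or [s], and [r] would be 1 or [q(s)]. *)
Let image_side r : reflq r -> r != cl s ->
  0 < lam rhoq r y0 * lam rhoq r (rmap f (gamma 1)).
Proof.
move=> rr rcs; apply: (path_limit_side crgamma gC rr); apply/eqP => r0.
have := proj2 (fixed_lam _ rr) r0; have /andP[Wr _] := rr.
have /morphimP[w _ Ww rw] := Wr; rewrite rw => xw.
have [g Gg] := rmap_fixed G_normal f_splitting f_act Ww xw.
have Wg := sub_GW Gg.
have clwg : cl (w * g)%g = r.
  have NG := fintype.subsetP (normal_norm G_normal).
  by rewrite rw morphM ?NG//= (coset_id Gg) mulg1.
move=> /stabP; rewrite groupM// => /(_ isT)[] E; move: clwg; rewrite E => rE.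
  by have := refl_neq1 rr; rewrite -rE morph1 eqxx.
by rewrite rE eqxx in rcs.
Qed.

Let near_image_side : nbhs (cvec (gamma 1)) [set z | forall r, reflq r -> r != cl s ->
  0 < lam rhoq r y0 * lam rhoq r (reV (cmap f z))].
Proof.
apply: (filter_forall (nbhs_filter (cvec (gamma 1)))) => r.
have [rr|nr] := boolP (reflq r); last by apply: (@filterE _ _ (nbhs_filter _)).
have [rcs|rcs] := boolP (r != cl s); last by apply: (@filterE _ _ (nbhs_filter _)).
have ch : {for cvec (gamma 1), continuous (fun z => lam rhoq r y0 * lam rhoq r (reV (cmap f z)))}.
  apply: (cvgM (@cst_continuous _ _ (lam rhoq r y0) _)).
  have c1 := continuous_comp (@continuous_cmap (cvec (gamma 1))) (@continuous_reV R m _).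
  exact: (continuous_comp c1 (@continuous_lam _ _ _ _ rhoq r _)).
have nb : nbhs (lam rhoq r y0 * lam rhoq r (reV (cmap f (cvec (gamma 1))))) [set t | 0 < t].
  apply: open_nbhs_nbhs; split; first exact: open_gt.
  by rewrite /= cmap_cvec reV_cvec; exact: image_side.
apply: (@filterS _ _ (nbhs_filter _) _ _ _ (ch _ nb)) => z /= H _ _; exact: H.
Qed.

(** Near [gamma 1] the real part of the image avoids all hyperplanes but that of [q(s)], and for [s]
    in [G] this covers all of them. Otherwise the form of [q(s)] along the half-turn is [lam s l]
    times [e^(i pi v) Phi], where the real part of [Phi] keeps its sign. *)
Let near_star_turn : \forall t \near (1 : R)^'-, 0 <= t < 1 -> forall h l v, gamma t = h + l ->
  h *m rho s = h -> l *m rho s = - l -> 0 <= v <= 1 -> star rhoq b (cmap f (half_turn h l v)).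
Proof.
have [sG|sG] := boolP (s \in G).
  apply: filterS (near_half_turn cgamma xs near_image_side) => t Ht _ h l v ghl hs ls _ r rr.
  have rcs : r != cl s by rewrite (coset_id sG); exact: (refl_neq1 rr).
  have := Ht h l v ghl hs ls r rr rcs => H; left.
  by apply: contraTneq H => ->; rewrite mulr0 ltxx.
have xG g : g \in G -> gamma 1 *m rho g = gamma 1 -> g = 1%g.
  by move=> Gg /(stabP (sub_GW Gg))[//|E]; rewrite -E Gg in sG.
have [Phi [cPhi Phi_im Phi_re PhiE]] := transverse_factor rho_faithful W_reflection G_normal
  f_splitting f_act Ct_chamber Ct_x0 f_good rs sG sx xG.
have rcs : reflq (cl s) := quotient_reflection rho_faithful W_reflection G_normal
  f_splitting f_act Ct_chamber Ct_x0 f_good rs sG sx xG.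
have nPhi : nbhs (cvec (gamma 1)) [set z | 0 < reC (Phi z) * reC (Phi (cvec (gamma 1)))].
  have ch : {for cvec (gamma 1), continuous (fun z => reC (Phi z) * reC (Phi (cvec (gamma 1))))}.
    apply: (cvgM _ (@cst_continuous _ _ (reC (Phi (cvec (gamma 1)))) _)).
    exact: (continuous_comp (cPhi _) (@continuous_reC R _)).
  have nb : nbhs (reC (Phi (cvec (gamma 1))) * reC (Phi (cvec (gamma 1)))) [set t | 0 < t].
    by apply: open_nbhs_nbhs; split; [exact: open_gt|rewrite /= sqr_gt0].
  exact: (ch _ nb).
have := near_half_turn cgamma xs (@filterI _ _ (nbhs_filter _) _ _ near_image_side nPhi).
apply: filterS => t Ht t01 h l v ghl hs ls /andP[v0 v1] r rr.
have [Hside HPhi] := Ht h l v ghl hs ls.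
have [rE|rcs'] := eqVneq r (cl s); last first.
  by left; apply: contraTneq (Hside r rr rcs') => ->; rewrite mulr0 ltxx.
rewrite {r rr}rE.
have sh : lam rho s h = 0 by apply/(fixed_lam h rs).
have [re_E im_E] := PhiE h l (cos (pi * v) +i* sin (pi * v))%C sh.
rewrite -/(half_turn h l v) in re_E im_E; rewrite re_E im_E.
rewrite reCM imCM [reC (_ +i* _)%C]/= [imC (_ +i* _)%C]/=.
have [re1_E _] := PhiE h l 1 sh; rewrite mul1r scale1r -/(cvec _) in re1_E.
have [_ HPhi1] := Ht h l 0 ghl hs ls.
have turn0 : half_turn h l 0 = cvec h + cvec l.
  by rewrite /half_turn mulr0 cos0 sin0 [X in X *: _](_ : _ = 1) ?scale1r//; exact: eqC.
rewrite /= turn0 in HPhi1.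
have hlE : cvec h + cvec l = cvec (gamma t).
  by rewrite ghl /cvec map_mxD.
rewrite hlE cmap_cvec reV_cvec in re1_E; rewrite hlE in HPhi1.
have H0 := gC t01 rcs; rewrite re1_E in H0.
(* At [v = 0] the image is [p(gamma t)], on the side of [y0] and so of [b]; the sign of the real
   part of [Phi] carries this over to every [v]. *)
have sign : 0 < lam rho s l * reC (Phi (half_turn h l v)) * lam rhoq (cl s) b.
  have H2 := b_side sG.
  have H3 : 0 < reC (Phi (cvec (gamma t))) * reC (Phi (half_turn h l v)).
    by apply: mul_gt0_trans HPhi1 _; rewrite mulrC.
  have H4 : 0 < lam rho s l * reC (Phi (cvec (gamma t))) * lam rhoq (cl s) b.
    by apply: mul_gt0_trans H2; rewrite mulrC.
  have : 0 < (lam rho s l * lam rhoq (cl s) b) * reC (Phi (cvec (gamma t))) by rewrite mulrAC.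
  by move=> /mul_gt0_trans /(_ H3); rewrite mulrAC.
move: sign HPhi; rewrite /=.
set P := reC (Phi (half_turn h l v)); set Q := imC (Phi (half_turn h l v)).
set L := lam rho s l; set B := lam rhoq (cl s) b => sign HPhi.
have L0 : L != 0 by apply: contraTneq sign => ->; rewrite !mul0r ltxx.
have P0 : P != 0 by apply: contraTneq sign => ->; rewrite mulr0 mul0r ltxx.
have [re0|ren0] := eqVneq (cos (pi * v) * P - sin (pi * v) * Q) 0; last first.
  by left; rewrite mulf_neq0.
right.
have sin_ge0 : 0 <= sin (pi * v).
  by apply: sin_ge0_pi; have p0 := pi_ge0 R; rewrite mulr_ge0//= ler_piMr.
have cs2 := cos2Dsin2 (pi * v).
have sinn0 : sin (pi * v) != 0.
  apply/eqP => s0; move: re0 cs2; rewrite s0 mul0r subr0 expr0n addr0 => /eqP.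
  rewrite mulf_eq0 (negbTE P0) orbF => /eqP ->.
  by rewrite expr0n => /eqP; rewrite eq_sym oner_eq0.
have sin0 : 0 < sin (pi * v) by rewrite lt_neqAle eq_sym sinn0.
(* When the real part vanishes, [cos P = sin Q], and the product becomes [P ^ 2 + Q ^ 2] times the
   sine. *)
have PI : 0 < P * (cos (pi * v) * Q + sin (pi * v) * P).
  rewrite (_ : _ * _ = Q * (cos (pi * v) * P) + sin (pi * v) * (P * P)); last by ring.
  have -> : cos (pi * v) * P = sin (pi * v) * Q by apply/eqP; rewrite -subr_eq0; exact/eqP.
  rewrite mulrCA -mulrDr mulr_gt0// ltr_wpDl ?sqr_gt0//.
  by rewrite -expr2 sqr_ge0.
have : 0 < (L * B) * P by rewrite mulrAC.
by move=> /mul_gt0_trans /(_ PI); rewrite mulrAC.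
Qed.

Lemma image_monodromy : \forall t \near (1 : R)^'-, forall h l, gamma t = h + l ->
  h *m rho s = h -> l *m rho s = - l ->
  [/\ is_path (cvec (gamma 0)) (cvec (gamma 0 *m rho s)) (half_monodromy rho s gamma t h l),
      (forall u, 0 <= u <= 1 -> regular_pts (crepr rho) (half_monodromy rho s gamma t h l u)) &
      star_path rhoq b (cvec (rmap f (gamma 0))) (cvec (rmap f (gamma 0) *m rhoq (cl s)))
        (cmap f \o half_monodromy rho s gamma t h l)].
Proof.
have near01 : \forall t \near (1 : R)^'-, 0 <= t < 1.
  apply: filterS2 (nbhs_left_gt (ltr01 : (0 : R) < 1)) (nbhs_left_lt (1 : R)) => t t0 t1.
  by rewrite (ltW t0).
apply: filterS2 near_star_turn near01 => t turn t01 h l ghl hs ls.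
have gx0 t' : 0 <= t' < 1 -> same_side rho x0 (gamma t').
  by move=> t'01; apply: same_Ct; exact: gCt.
have x0x0 : 0 < lam rho s x0 * lam rho s x0 by rewrite sqr_gt0// regular_neq0.
have [pm sm] := half_monodromy_star cgamma t01 Ws ghl hs ls wall_x gx0 x0x0.
split => //; first by move=> u /sm /star_regular.
split.
  have -> : cvec (rmap f (gamma 0)) = cmap f (cvec (gamma 0)) by rewrite cmap_cvec.
  have -> : cvec (rmap f (gamma 0) *m rhoq (cl s)) = cmap f (cvec (gamma 0 *m rho s)).
    by rewrite cmap_cvec (rmap_act f_act).
  have [cm m0 m1] := pm; split; [|by rewrite /= m0|by rewrite /= m1].
  refine (@within_comp _ _ _ _ setT _ (cmap f) cm _ _) => //.
  by apply: continuous_subspaceT.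
have legR v : 0 <= v <= 1 -> regular_pts rhoq (rmap f (gamma (v * t))).
  move=> /andP[v0 v1]; apply: (same_side_regular (c := y0)); apply: gC.
  by case/andP: t01 => t0 t1; apply/andP; split; nra.
move=> u u01 /=.
case: (half_monodromy_cases rho s gamma t h l u01) => -[v v01 ->].
- by rewrite cmap_cvec; apply: star_real; exact: legR.
- exact: turn.
- rewrite (cmap_act f_act)// cmap_cvec /cvec -map_mxM; apply: star_real.
  by apply: regular_repr; [exact: mem_quotient|exact: legR].
Qed.

End Monodromy.

Lemma stab_quotient_reflection s x : refl s -> s \notin G -> rstab rho x = <[s]>%g ->
  reflq (cl s).
Proof.
move=> rs sG xs.
have xP w : w \in W -> x *m rho w = x -> w = 1%g \/ w = s.
  move=> Ww xw; apply: (refl_cycle rho_faithful rs); rewrite -xs.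
  by rewrite inE Ww /= xw.
have sx : lam rho s x = 0.
  apply/(fixed_lam _ rs); have : s \in rstab rho x by rewrite xs cycle_id.
  by rewrite inE => /andP[_ /eqP].
apply: (quotient_reflection rho_faithful W_reflection G_normal
  f_splitting f_act Ct_chamber Ct_x0 f_good rs sG sx) => g Gg.
by move=> /(xP g (sub_GW Gg))[//|E]; rewrite -E Gg in sG.
Qed.

Let pM z (rz : regular_pts (crepr rho) z) : regular_pts (crepr rhoq) (cmap f z) :=
  cmap_regular rho_faithful W_reflection G_normal f_splitting f_act rz.

Let b0 := base_point Ct_chamber Ct_x0.
Let bq := regular_map pM b0.
Local Notation up := (orb b0).
Local Notation down := (orb bq).

Let val_bq : \val bq = cvec y0. Proof. exact: cmap_cvec. Qed.

Let up_base : up (cvec x0) = orbit_class b0. Proof. exact: (orb_val b0 b0). Qed.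

Let down_base : down (cvec y0) = orbit_class bq. Proof. by rewrite -val_bq orb_val. Qed.

Let orbit_map_class y : orbit_map pM (orbit_class y) = down (cmap f (\val y)).
Proof. by rewrite (orbit_mapE f_act) -(orb_val bq). Qed.

Let orbit_map_up z : regular_pts (crepr rho) z -> orbit_map pM (up z) = down (cmap f z).
Proof. by move=> rz; rewrite orbit_map_class val_orb. Qed.

Let braid_map_class (fl : loop R (orbit_class b0)) : exists2 gl : loop R (orbit_class bq),
  braid_map f_act pM b0 (pi1_class fl) = pi1_class gl & sval gl = orbit_map pM \o sval fl.
Proof.
exists (loop_map (continuous_orbit_map f_act (pM := pM)) (orbit_mapE f_act pM b0) fl) => //.
exact: pi1_mapE.
Qed.

Lemma image_generator s (ct : braid_group b0) : refl s -> standard_generator Ct s ct ->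
  exists p (gl : loop R (orbit_class bq)), [/\ braid_map f_act pM b0 ct = pi1_class gl,
    star_path rhoq y0 (cvec y0) (cvec (y0 *m rhoq (cl s))) p &
    forall u, 0 <= u <= 1 -> down (p u) = sval gl u].
Proof.
move=> rs [gamma [cg g0 gC st near]].
have {}g0 : gamma 0 = x0 by apply: (@map_mx_inj _ _ (toCx R)); exact: g0.
have bs : s \notin G -> 0 < lam rhoq (cl s) y0 * lam rhoq (cl s) y0.
  by move=> sG; rewrite sqr_gt0// regular_neq0// (stab_quotient_reflection rs sG st).
have FF := at_left_proper_filter (1 : R).
have [t [[h [l [fl [ghl hs ls flE ->]]]] im]] :=
  @filter_ex _ _ FF _ (@filterI _ _ FF _ _ near (image_monodromy cg gC rs st bs)).
have [pm sm sp] := im h l ghl hs ls; rewrite g0 in sp.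
have [gl glE slE] := braid_map_class fl.
exists (cmap f \o half_monodromy rho s gamma t h l), gl; split; [exact: glE|exact: sp|].
move=> u u01; rewrite slE /=; have [y yE ->] := flE u u01.
by rewrite orbit_map_class yE.
Qed.

Lemma image_generator_G s (ct : braid_group b0) : refl s -> s \in G ->
  standard_generator Ct s ct -> braid_map f_act pM b0 ct = 1%g.
Proof.
move=> rs sG /(image_generator rs)[p [gl [-> sp pE]]].
rewrite coset_id// repr_mx1 mulmx1 in sp.
have pc : star_path rhoq y0 (cvec y0) (cvec y0) (cst (cvec y0)).
  by split; [exact: is_path_cst|move=> u _; exact: star_real].
refine (proj2 (pi1_classP gl (@loop_cst R _ (orbit_class bq))) _).
have H := star_homotopic bq ry0 sp pc; rewrite down_base in H.
have E : homotopic (orbit_class bq) (orbit_class bq) (sval gl) (down \o p).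
  by apply: homotopic_ext => [|u u01]; [exact: svalP gl|rewrite /= pE].
apply: (homotopic_trans E).
by rewrite (_ : down \o cst (cvec y0) = cst (orbit_class bq)) in H; last exact/funext.
Qed.

Lemma image_generator_not_G s (ct : braid_group b0) (c : braid_group bq) : refl s ->
  s \notin G -> standard_generator Ct s ct -> standard_generator C (cl s) c ->
  braid_map f_act pM b0 ct = c.
Proof.
move=> rs sG gct; have [p [gl [-> sp pE]]] := image_generator rs gct.
move=> [gamma [cg g0 gC st near]].
have {}g0 : gamma 0 = y0.
  by apply: (@map_mx_inj _ _ (toCx R)); rewrite -[RHS]/(cvec y0) -val_bq; exact: g0.
have rcs : reflq (cl s).
  have [g [_ _ _ gst _]] := gct; exact: stab_quotient_reflection gst.
have Wcs : cl s \in (W / G)%g by case/andP: rcs.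
have side t : 0 <= t < 1 -> same_side rhoq y0 (gamma t).
  by move=> t01; apply/(chamber_same_side _ C_chamber) => //; exact: gC.
have wall : wall_point rhoq y0 (cl s) (gamma 1).
  apply: path_wall_point => //.
    apply/(fixed_lam _ rcs); have : cl s \in rstab rhoq (gamma 1) by rewrite st cycle_id.
    by rewrite inE => /andP[_ /eqP].
  move=> r rr r0; have /andP[Wr _] := rr.
  have : r \in <[cl s]>%g.
    by rewrite -st inE Wr /=; apply/eqP/(fixed_lam _ rr).
  move=> /(refl_cycle rhoqF rcs)[r1|//].
  by have := refl_neq1 rr; rewrite r1 eqxx.
have near01 : \forall t \near (1 : R)^'-, 0 <= t < 1.
  apply: filterS2 (nbhs_left_gt (ltr01 : (0 : R) < 1)) (nbhs_left_lt (1 : R)) => t t0 t1.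
  by rewrite (ltW t0).
have FF := at_left_proper_filter (1 : R).
have [t [[h [l [fl [ghl hs ls flE ->]]]] t01]] :=
  @filter_ex _ _ FF _ (@filterI _ _ FF _ _ near near01).
have y0s : 0 < lam rhoq (cl s) y0 * lam rhoq (cl s) y0.
  by rewrite sqr_gt0// regular_neq0.
(* The standard half-turn of [q(s)] lies in the star of [y0] too, with the same ends as the image
   path [p]. *)
have sq := half_monodromy_star cg t01 Wcs ghl hs ls wall side y0s.
rewrite g0 in sq.
refine (proj2 (pi1_classP gl fl) _).
have H := star_homotopic bq ry0 sp sq.
have E0 : down (cvec (y0 *m rhoq (cl s))) = orbit_class bq.
  rewrite -down_base /cvec map_mxM; apply: orb_repr => //; exact: regular_cvec.
rewrite down_base E0 in H.
have E : homotopic (orbit_class bq) (orbit_class bq) (sval gl) (down \o p).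
  by apply: homotopic_ext => [|u u01]; [exact: svalP gl|rewrite /= pE].
have E' : homotopic (orbit_class bq) (orbit_class bq) (sval fl)
    (down \o half_monodromy rhoq (cl s) gamma t h l).
  apply: homotopic_ext => [|u u01]; [exact: svalP fl|].
  by have [y yE ->] := flE u u01; rewrite /= -yE orb_val.
exact: homotopic_trans E (homotopic_trans H (homotopic_sym E')).
Qed.

(** * Surjectivity *)

Lemma simple_stab s x : wall_point rho x0 s x -> rstab rho x = <[s]>%g.
Proof.
move=> sx; have [rs sx0 _] := sx; have /andP[Ws _] := rs.
have xs : x *m rho s = x by apply/fixed_lam.
apply/eqP; rewrite finset.eqEsubset; apply/andP; split.
  apply/fintype.subsetP => w; rewrite inE => /andP[Ww /eqP xw].
  case: (wall_point_stab rho_faithful W_reflection rx0 sx Ww xw) => ->; first exact: group1.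
  exact: cycle_id.
by rewrite cycle_subG inE Ws /= xs.
Qed.

(** The half-turn upstairs is built on the straight segment from [x0] to a wall point of [s], which
    stays in the chamber until its end. *)
Lemma generator_lift s (b : 'rV[R]_m) : s \in simple rho x0 ->
  (s \notin G -> 0 < lam rhoq (cl s) y0 * lam rhoq (cl s) b) ->
  exists p (fl : loop R (orbit_class b0)),
    star_path rhoq b (cvec y0) (cvec (y0 *m rhoq (cl s))) p /\
    forall u, 0 <= u <= 1 -> orbit_map pM (sval fl u) = down (p u).
Proof.
move=> /simpleP[x sx] bs; have [rs sx0 Hx] := sx; have /andP[Ws _] := rs.
pose gamma t : 'rV[R]_n := (1 - t) *: x0 + t *: x.
have g0 : gamma 0 = x0 by rewrite /gamma subr0 scale1r scale0r addr0.
have g1 : gamma 1 = x by rewrite /gamma subrr scale1r scale0r add0r.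
have cg : {within `[0, 1], continuous gamma}.
  apply: within_rowvec => j; apply: continuous_subspaceT.
  rewrite (_ : (fun u => _) = fun u => (1 - u) * x0 0 j + u * x 0 j).
    move=> u; apply: cvgD; apply: cvgM; [|exact: cvg_cst|exact: cvg_id|exact: cvg_cst].
    by apply: cvgB; [exact: cvg_cst|exact: cvg_id].
  by apply/funext => u; rewrite !mxE.
have gC t : 0 <= t < 1 -> Ct (gamma t).
  move=> /andP[t0 t1]; apply/(chamber_same_side _ Ct_chamber Ct_x0) => r rr.
  rewrite lamD !lamZ mulrDr mulrCA [lam rho r x0 * (t * _)]mulrCA.
  have q0 : 0 < lam rho r x0 * lam rho r x0 by rewrite sqr_gt0// regular_neq0.
  have q1 : 0 < (1 - t) * (lam rho r x0 * lam rho r x0) by rewrite mulr_gt0// subr_gt0.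
  have q2 : 0 <= t * (lam rho r x0 * lam rho r x).
    case: (Hx r rr) => [[k kE]|H]; last by rewrite mulr_ge0// ltW.
    by rewrite [lam rho r x]kE sx0 !mulr0.
  by rewrite ltr_pwDl.
have st : rstab rho (gamma 1) = <[s]>%g by rewrite g1; exact: simple_stab.
have [t im] := @filter_ex _ _ (at_left_proper_filter (1 : R)) _
  (image_monodromy cg gC rs st bs).
pose h := 2^-1 *: (gamma t + gamma t *m rho s).
pose l := 2^-1 *: (gamma t - gamma t *m rho s).
have gss : gamma t *m rho s *m rho s = gamma t by exact: refl_invol.
have halves (y z : 'rV[R]_n) : y = 2^-1 *: (y + z) + 2^-1 *: (y - z).
  by apply/rowP => j; rewrite !mxE; lra.
have ghl : gamma t = h + l by exact: halves.
have hs : h *m rho s = h by rewrite -scalemxAl mulmxDl gss addrC.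
have ls : l *m rho s = - l by rewrite -scalemxAl mulmxBl gss -scalerN opprB.
have [pm sm sp] := im h l ghl hs ls; rewrite g0 in pm sp.
have up_s : up (cvec (x0 *m rho s)) = orbit_class b0.
  by rewrite -up_base /cvec map_mxM; apply: orb_repr => //; exact: regular_cvec.
have pf := is_path_orb b0 pm sm; rewrite up_base up_s in pf.
exists (cmap f \o half_monodromy rho s gamma t h l), (exist _ _ pf); split; first exact: sp.
by move=> u u01; rewrite [sval _]/= [LHS]orbit_map_up//; exact: sm.
Qed.

(** The class to which [loops_generated] is applied; asking only for a homotopy makes it stable
    under deformation. *)
Let lifts (k : R -> orbit_space (crepr rhoq)) := is_path (down (cvec y0)) (down (cvec y0)) k /\
  exists fl : loop R (orbit_class b0),
    homotopic (down (cvec y0)) (down (cvec y0)) (orbit_map pM \o sval fl) k.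

Let lifts_homotopic k k' : lifts k -> is_path (down (cvec y0)) (down (cvec y0)) k' ->
  homotopic (down (cvec y0)) (down (cvec y0)) k k' -> lifts k'.
Proof.
move=> [_ [fl H]] pk' H'; split; [exact: pk'|exists fl].
exact: homotopic_trans H H'.
Qed.

Let lifts_cst : lifts (cst (down (cvec y0))).
Proof.
split; [exact: is_path_cst|exists (@loop_cst R _ (orbit_class b0))].
rewrite (_ : _ \o _ = cst (down (cvec y0))); first exact/homotopic_refl/is_path_cst.
by apply/funext => u; rewrite [LHS]orbit_map_class; exact: (congr1 down val_bq).
Qed.

Let lifts_cat k k' : lifts k -> lifts k' -> lifts (path_cat k k').
Proof.
move=> [pk [fl H]] [pk' [fl' H']]; split; first exact: is_path_cat pk pk'.
exists (loop_cat fl fl').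
rewrite (_ : _ \o _ = path_cat (orbit_map pM \o sval fl) (orbit_map pM \o sval fl')).
  exact: homotopic_cat H H'.
by apply/funext => u; rewrite /= /path_cat; case: ifP.
Qed.

Let lifts_rev k : lifts k -> lifts (path_rev k).
Proof.
move=> [pk [fl H]]; split; first exact: is_path_rev.
by exists (loop_rev fl); exact: homotopic_rev H.
Qed.

Let down_repr (y : 'rV[Cx R]_m) r : regular_pts (crepr rhoq) y -> r \in (W / G)%g ->
  down (y *m crepr rhoq r) = down y.
Proof. exact: orb_repr. Qed.

Let down_cs r : r \in (W / G)%g -> down (cvec (y0 *m rhoq r)) = down (cvec y0).
Proof. by move=> Wr; rewrite /cvec map_mxM; apply: down_repr Wr; exact: regular_cvec. Qed.

Lemma lifts_positive s (b : 'rV[R]_m) p : s \in simple rho x0 -> regular_pts rhoq b ->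
  (s \notin G -> 0 < lam rhoq (cl s) y0 * lam rhoq (cl s) b) ->
  star_path rhoq b (cvec y0) (cvec (y0 *m rhoq (cl s))) p -> lifts (down \o p).
Proof.
move=> s_simple rb bs sp; have [q [fl [sq qE]]] := generator_lift s_simple bs.
have /andP[Ws _] := simple_refl s_simple.
have Wcs : cl s \in (W / G)%g by exact: mem_quotient.
have pq := star_path_orb bq sq; have pp := star_path_orb bq sp.
rewrite down_cs// in pp pq.
split; [exact: pp|exists fl].
have H := star_homotopic bq rb sq sp; rewrite down_cs// in H.
apply: homotopic_trans H; apply: homotopic_sym.
by apply: homotopic_ext pq _ => u u01; rewrite /= qE.
Qed.

Lemma lifts_generator s (b : 'rV[R]_m) p : s \in simple rho x0 -> regular_pts rhoq b ->
  star_path rhoq b (cvec y0) (cvec (y0 *m rhoq (cl s))) p -> lifts (down \o p).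
Proof.
move=> s_simple rb sp.
have [sG|sG] := boolP (s \in G).
  by apply: (lifts_positive s_simple rb _ sp); rewrite sG.
have /simpleP[x sx] := s_simple; have [rs _ _] := sx; have /andP[Ws _] := rs.
have rcs : reflq (cl s) := stab_quotient_reflection rs sG (simple_stab sx).
have Wcs : cl s \in (W / G)%g by exact: mem_quotient.
have : lam rhoq (cl s) y0 * lam rhoq (cl s) b != 0 by rewrite mulf_neq0// regular_neq0.
rewrite neq_lt => /orP[neg|pos]; last by apply: (lifts_positive s_simple rb _ sp).
(* The ends are again [y0] and [y0 q(s)], but the star is now that of [b q(s)], on the side of
   [y0]. *)
have sq := star_path_repr Wcs (star_path_rev sp).
have y0ss : cvec (y0 *m rhoq (cl s)) *m crepr rhoq (cl s) = cvec y0.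
  by rewrite /cvec -map_mxM refl_invol.
have y0s : cvec y0 *m crepr rhoq (cl s) = cvec (y0 *m rhoq (cl s)).
  by rewrite /cvec map_mxM.
rewrite y0ss y0s in sq.
have rb' : regular_pts rhoq (b *m rhoq (cl s)) by exact: regular_repr.
have pos : s \notin G -> 0 < lam rhoq (cl s) y0 * lam rhoq (cl s) (b *m rhoq (cl s)).
  by rewrite lam_refl// mulrN oppr_gt0.
have Lq := lifts_rev (lifts_positive s_simple rb' pos sq).
have pp := star_path_orb bq sp; rewrite down_cs// in pp.
apply: (lifts_homotopic Lq pp); apply: homotopic_sym.
apply: homotopic_ext pp _ => u /andP[u0 u1].
rewrite /path_rev /= /path_rev subKr down_repr//.
by have [_ /(_ u)] := sp; rewrite u0 u1 => /(_ isT)/star_regular.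
Qed.

Lemma braid_map_surj (c : braid_group bq) : exists ct, braid_map f_act pM b0 ct = c.
Proof.
have [g ->] := pi1_surj c.
(* The generators are the images of all simple reflections, including 1 if one of these lies in [G];
   [lifts_generator] treats that case as well. *)
have gen : <<[set cl s | s in simple rho x0]%SET>>%g = (W / G)%g.
  rewrite /= /quotient -(reflection_group_simple W_reflection rx0).
  have sub : simple rho x0 \subset 'N(G)%g.
    apply: (fintype.subset_trans _ (normal_norm G_normal)).
    by apply/fintype.subsetP => s /simple_refl/andP[].
  by rewrite morphim_gen// morphimEsub.
have Lgen r b p : r \in [set cl s | s in simple rho x0]%SET -> regular_pts rhoq b ->
    star_path rhoq b (cvec y0) (cvec (y0 *m rhoq r)) p -> lifts (down \o p).
  by move=> /imsetP[s s_simple ->]; exact: lifts_generator.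
have all_lift k : is_path (orbit_class bq) (orbit_class bq) k -> lifts k.
  rewrite -{1 2}down_base => pk; apply: (@loops_generated _ _ _ _ _ bq rhoqF rhoqR y0 ry0 _ lifts
    gen _ lifts_cst lifts_cat lifts_homotopic Lgen k pk) => k' [] //.
have [_ [fl H]] := all_lift _ (svalP g).
have [gl glE slE] := braid_map_class fl.
exists (pi1_class fl); rewrite glE; refine (proj2 (pi1_classP gl g) _).
by move: H; rewrite down_base slE.
Qed.

End BraidImage.

Theorem proposition3p18 (R : realType) (gT : finGroupType) (W G : {group gT})
    (n m : nat) (rho : mx_representation R W n)
    (f : m.-tuple (mpoly.mpoly n R)) (rhoq : mx_representation R (W / G)%G m)
    (Ct : set 'rV[R]_n) (C : set 'rV[R]_m) (x0 : 'rV[R]_n)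
    (rho_faithful : mx_faithful rho) (W_reflection : reflection_group rho)
    (G_normal : normal G W)
    (f_splitting : graded_splitting G rho f)
    (f_act : induced_action W rho rhoq f)
    (G_good : good (map_mpolys (toCx R) f) (W / G)%G (crepr rhoq))
    (Ct_chamber : is_chamber rho Ct) (Ct_x0 : Ct x0)
    (C_chamber : is_chamber rhoq C) (Ct_C : rmap f @` Ct `<=` C) :
  exists pM : (forall x, regular_pts (crepr rho) x ->
                 regular_pts (crepr rhoq) (cmap f x)),
    let b := base_point Ct_chamber Ct_x0 in
    let p_star : braid_group b -> braid_group (regular_map pM b) :=
      braid_map f_act pM b in
    (forall c, exists ct, p_star ct = c) /\
    (forall s, wall_reflection rho Ct s ->
       forall ct, standard_generator Ct s ct ->
         (s \notin G ->
            forall c, standard_generator C (coset G s) c -> p_star ct = c) /\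
         (s \in G -> p_star ct = 1%g)).
Proof.
exists (fun z rz => cmap_regular rho_faithful W_reflection G_normal f_splitting f_act rz).
split; first exact: (braid_map_surj G_good C_chamber Ct_C).
move=> s [rs _] ct gct; split => [sG c gc|sG].
  exact: (image_generator_not_G G_good C_chamber Ct_C rs sG gct gc).
exact: (image_generator_G rho_faithful W_reflection G_normal f_splitting f_act G_good
  C_chamber Ct_C rs sG gct).
Qed.
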